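(* Work in either the $C^*$-setting or the $W^*$-setting. Let $X=(X(n))_{n\in\mathbb{Z}_+}$ be a standard subproduct system, and let $T$ be a completely contractive, covariant representation of $X$ on a Hilbert space $\mathcal{H}$. Then there exists a dilation $V$ of $T$ to a Hilbert space $\mathcal{K}$ with the following properties: (1) There exists a Hilbert space $\mathcal{U}$ such that $\mathcal{K}=(\mathcal{F}_X\otimes_\sigma\mathcal{D})\oplus\mathcal{U}$. (2) There exists a completely contractive, fully coisometric, covariant representation $Z$ of $X$ on $\mathcal{U}$ such that $V_n(\zeta)=(S_n(\zeta)\otimes I_{\mathcal{D}})\oplus Z_n(\zeta)$ for all $n\in\mathbb{Z}_+$, $\zeta\in X(n)$. Moreover, $\mathcal{U}=\{0\}$ if and only if $T$ is pure.
   Context: Conventions. Hilbert spaces are complex; $C^*$-algebras need not be unital; all representations of operator algebras on Hilbert spaces are assumed nondegenerate. $\mathcal{L}(F)$ denotes the adjointable operators on a Hilbert module $F$. Two settings are considered. $C^*$-setting: $\mathcal{M}$ is a $C^*$-algebra; a correspondence over $\mathcal{M}$ is a right Hilbert $C^*$-module $F$ over $\mathcal{M}$ (inner product $\langle\cdot,\cdot\rangle$ linear in the second variable) with a left action $a\zeta=\varphi(a)\zeta$ given by a $*$-homomorphism $\varphi:\mathcal{M}\to\mathcal{L}(F)$; tensor products are interior tensor products. $W^*$-setting: $\mathcal{M}$ is a von Neumann algebra, correspondences are required to be self-dual with $\varphi$ normal, and tensor products and direct sums of correspondences mean the self-dual completions of the usual ones. For a representation $\sigma$ of $\mathcal{M}$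 on $\mathcal{H}$, $F\otimes_\sigma\mathcal{H}$ is the Hilbert space with $(\zeta_1\otimes h_1,\zeta_2\otimes h_2)=(h_1,\sigma(\langle\zeta_1,\zeta_2\rangle)h_2)$. Standard subproduct system: a family $X=(X(n))_{n\in\mathbb{Z}_+}$ of correspondences over $\mathcal{M}$ with $X(0)=\mathcal{M}$ such that $X(n+m)$ is an orthogonally complementable sub-bimodule of $X(n)\otimes X(m)$ for all $n,m$ (where $X(n)\otimes\mathcal{M}$ and $\mathcal{M}\otimes X(n)$ are identified with $X(n)$ via the module actions, so the left actions are nondegenerate). Put $E=X(1)$; then $X(n)\subseteq E^{\otimes n}$ ($E^{\otimes 0}=\mathcal{M}$), and $p_n\in\mathcal{L}(E^{\otimes n})$ is the orthogonal projection onto $X(n)$. Completely contractive, covariant representation of $X$ on $\mathcal{H}$: a family $T=(T_n)_{n\in\mathbb{Z}_+}$ of linear maps $T_n:X(n)\to B(\mathcal{H})$ such that $\sigma:=T_0$ is a $C^*$-representation of $\mathcal{M}$ on $\mathcal{H}$; each $T_n$ is completely contractive (with $X(n)$ viewed inside its linking algebra); $T_n(\zeta a)=T_n(\zeta)\sigma(a)$ and $T_n(a\zeta)=\sigma(a)T_n(\zeta)$; and $T_{n+m}(p_{n+m}(\zeta\otimes\eta))=T_n(\zeta)T_m(\eta)$ for $\zeta\in X(n),\eta\in X(m)$. In the $W^*$-setting $\sigma$ is also required to be normal, and each $T_n$ continuous from the $\sigma$-topology of $X(n)$ (generated by the functionals $x\mapsto\sum_i\omega_i(\langle\eta_i,x\rangle)$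 with $\omega_i\in\mathcal{M}_*$, $\eta_i\in X(n)$, $\sum_i\|\omega_i\|\|\eta_i\|<\infty$) to the ultraweak topology (this continuity is automatic when $\sigma$ is normal). For each $n$, $\widetilde{T}_n:X(n)\otimes_\sigma\mathcal{H}\to\mathcal{H}$ is the contraction $\widetilde{T}_n(\zeta\otimes h)=T_n(\zeta)h$. $T$ is fully coisometric if $\widetilde{T}_n$ is coisometric for all $n$. $T$ is pure if $\widetilde{T}_n\widetilde{T}_n^*\to 0$ in the strong operator topology. $\Delta_*(T):=(I_{\mathcal{H}}-\widetilde{T}_1\widetilde{T}_1^* )^{1/2}$ and $\mathcal{D}:=\overline{\operatorname{Im}\Delta_*(T)}$. $\Delta_*(T)$ commutes with $\sigma(\mathcal{M})$, so $\mathcal{D}$ reduces $\sigma$; the restriction of $\sigma$ to $\mathcal{D}$ is again denoted $\sigma$. $X$-Fock space and shift: $\mathcal{F}_X=\bigoplus_{n\in\mathbb{Z}_+}X(n)$, and for $\zeta\in X(n)$, $S_n(\zeta)\in\mathcal{L}(\mathcal{F}_X)$ is given by $S_n(\zeta)\eta=p_{n+m}(\zeta\otimes\eta)$ for $\eta\in X(m)$; $S_n(\zeta)\otimes I_{\mathcal{D}}$ is the induced operator on $\mathcal{F}_X\otimes_\sigma\mathcal{D}$. Dilation: if $T,V$ are completely contractive, covariant representations of $X$ on $\mathcal{H},\mathcal{K}$, where $\mathcal{H}$ is a subspace of $\mathcal{K}$ (possibly after identifying $\mathcal{H}$ with its image under an isometry $\mathcal{H}\to\mathcal{K}$), then $V$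 is a dilation of $T$ if for all $n\in\mathbb{Z}_+$, $\zeta\in X(n)$, $V_n(\zeta)^*$ leaves $\mathcal{H}$ invariant and $V_n(\zeta)^*|_{\mathcal{H}}=T_n(\zeta)^*$. *)

(* Defs.v *)
From HB Require Import structures.
From mathcomp Require Import all_boot all_order all_algebra.
From mathcomp Require Import all_classical all_reals all_analysis.
From mathcomp Require Import complex.

Set Implicit Arguments.
Unset Strict Implicit.
Unset Printing Implicit Defensive.

Import Order.TTheory GRing.Theory Num.Theory.
Import numFieldNormedType.Exports.

Local Open Scope classical_set_scope.
Local Open Scope ring_scope.

(* The complex numbers.  Locked: otherwise unification keeps unfolding the
   operations of R[i] when it looks for its normed space structure. *)
HB.lock Definition cplx (R : realType) : numClosedFieldType := R[i].

(* Inner products are linear in the SECOND variable throughout.  Norms of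
   normed spaces over cplx R take values in cplx R (in its nonnegative reals). *)

HB.mixin Record isHilbert (R : realType) H of CompleteNormedModule (cplx R) H := {
  hip : H -> H -> cplx R;
  hip_linear : forall x c y z, hip x (c *: y + z) = c * hip x y + hip x z;
  hip_conj : forall x y, (hip x y)^* = hip y x;
  hip_norm : forall x, hip x x = `|x| ^+ 2 }.

#[short(type="hilbertType")]
HB.structure Definition Hilbert (R : realType) :=
  {H of CompleteNormedModule (cplx R) H & isHilbert R H}.

(* Not necessarily unital. *)
HB.mixin Record isCStar (R : realType) A of CompleteNormedModule (cplx R) A := {
  amul : A -> A -> A;
  astar : A -> A;
  amulA : associative amul;
  amulDl : left_distributive amul +%R;
  amulDr : right_distributive amul +%R;
  amulZl : forall (c : cplx R) a b, amul (c *: a) b = c *: amul a b;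
  amulZr : forall (c : cplx R) a b, amul a (c *: b) = c *: amul a b;
  astarD : forall a b, astar (a + b) = astar a + astar b;
  astarZ : forall (c : cplx R) a, astar (c *: a) = c^* *: astar a;
  astarM : forall a b, astar (amul a b) = amul (astar b) (astar a);
  astarK : involutive astar;
  anorm_mul : forall a b, `|amul a b| <= `|a| * `|b|;
  anorm_star : forall a, `|amul (astar a) a| = `|a| ^+ 2 }.

#[short(type="cstarType")]
HB.structure Definition CStarAlgebra (R : realType) :=
  {A of CompleteNormedModule (cplx R) A & isCStar R A}.

HB.mixin Record isHilbertModule (R : realType) (A : cstarType R) F
    of CompleteNormedModule (cplx R) F := {
  ract : F -> A -> F;
  mip : F -> F -> A;
  ractA : forall x a b, ract (ract x a) b = ract x (amul a b);
  ractDl : forall x y a, ract (x + y) a = ract x a + ract y a;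
  ractDr : forall x a b, ract x (a + b) = ract x a + ract x b;
  ractZl : forall (c : cplx R) x a, ract (c *: x) a = c *: ract x a;
  ractZr : forall (c : cplx R) x a, ract x (c *: a) = c *: ract x a;
  mip_linear : forall x (c : cplx R) y z,
    mip x (c *: y + z) = c *: mip x y + mip x z;
  mip_ract : forall x y a, mip x (ract y a) = amul (mip x y) a;
  mip_star : forall x y, astar (mip x y) = mip y x;
  mip_ge0 : forall x, exists b : A, mip x x = amul (astar b) b;
  mip_norm : forall x, `|mip x x| = `|x| ^+ 2 }.

#[short(type="hilbmodType")]
HB.structure Definition HilbertModule (R : realType) (A : cstarType R) :=
  {F of CompleteNormedModule (cplx R) F & isHilbertModule R A F}.

(* lact a is adjointable with adjoint lact (astar a); in particular it is
   linear, bounded and commutes with the right action. *)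
HB.mixin Record isCorrespondence (R : realType) (A : cstarType R) F
    of HilbertModule R A F := {
  lact : A -> F -> F;
  lact_linear : forall (c : cplx R) a b x,
    lact (c *: a + b) x = c *: lact a x + lact b x;
  lactM : forall a b x, lact (amul a b) x = lact a (lact b x);
  lact_adj : forall a (x y : F), mip (lact a x) y = mip x (lact (astar a) y) :> A }.

#[short(type="corrType")]
HB.structure Definition Correspondence (R : realType) (A : cstarType R) :=
  {F of HilbertModule R A F & isCorrespondence R A F}.

Section Operators.
Variable R : realType.

Record bop (H K : hilbertType R) := Bop {
  bop_fun :> {linear H -> K};
  bop_continuous : continuous bop_fun }.

Definition adjoint (H K : hilbertType R) (f : bop H K) (g : bop K H) : Prop :=
  forall x y, hip (f x) y = hip x (g y).

Definition isometric_bop (H K : hilbertType R) (f : bop H K) : Prop :=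
  forall x y, hip (f x) (f y) = hip x y.

Definition positive_bop (H : hilbertType R) (f : bop H H) : Prop :=
  forall x, 0 <= hip x (f x).

Definition commute_bop (H : hilbertType R) (f g : bop H H) : Prop :=
  forall x, f (g x) = g (f x).

Definition lspan (V : lmodType (cplx R)) (B : set V) : set V :=
  [set v | exists (n : nat) (c : 'I_n -> cplx R) (b : 'I_n -> V),
     (forall i, B (b i)) /\ v = \sum_i c i *: b i].

(* Closure and continuity for the coarsest topologies making the functionals
   in P (resp. P and Q) continuous, expressed with convergence of filters. *)
Definition closure_wrt (V : Type) (P : set (V -> cplx R)) (B : set V) : set V :=
  [set x | exists F : set_system V,
     [/\ ProperFilter F, F B & forall f, P f -> f @ F --> f x]].

Definition continuous_wrt (V W : Type) (P : set (V -> cplx R))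
    (Q : set (W -> cplx R)) (T : V -> W) : Prop :=
  forall (F : set_system V) (x : V), ProperFilter F ->
    (forall f, P f -> f @ F --> f x) ->
    forall g, Q g -> (fun v => g (T v)) @ F --> g (T x).

Definition square_summable (H : hilbertType R) (h : nat -> H) : Prop :=
  cvgn (series (fun i => `|h i| ^+ 2)).

Definition ultraweak (H : hilbertType R) : set (bop H H -> cplx R) :=
  [set w | exists h k : nat -> H, [/\ square_summable h, square_summable k &
     forall t : bop H H, series (fun i => hip (h i) (t (k i))) @ \oo --> w t]].

Definition star_rep (A : cstarType R) (H : hilbertType R)
    (s : A -> bop H H) : Prop :=
  [/\ forall (c : cplx R) a b h, s (c *: a + b) h = c *: s a h + s b h,
      forall a b h, s (amul a b) h = s a (s b h) &
      forall a, adjoint (s a) (s (astar a))].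

Definition nondegenerate (A : cstarType R) (H : hilbertType R)
    (s : A -> bop H H) : Prop :=
  closure (lspan [set v | exists a h, v = s a h]) = setT.

End Operators.

(* Realizes A as a von Neumann algebra on vn_space: a *-algebra of operators
   equal to its bicommutant. *)
Record von_neumann (R : realType) (A : cstarType R) := {
  vn_space : hilbertType R;
  vn_rep : A -> bop vn_space vn_space;
  vn_star_rep : star_rep vn_rep;
  vn_inj : forall a b, vn_rep a =1 vn_rep b -> a = b;
  vn_bicommutant : forall t : bop vn_space vn_space,
    (forall s, (forall a, commute_bop s (vn_rep a)) -> commute_bop s t) ->
    exists a, t =1 vn_rep a }.

Section Settings.
Variables (R : realType) (A : cstarType R).

Variant setting := CStarSetting | WStarSetting of von_neumann A.

Definition predual (N : von_neumann A) : set (A -> cplx R) :=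
  [set f | exists2 w, @ultraweak R (vn_space N) w & f = w \o vn_rep N].

(* c i below is any bound for the norm of the functional w i. *)
Definition sigma_functionals (N : von_neumann A) (F : hilbmodType A) :
    set (F -> cplx R) :=
  [set f | exists (w : nat -> A -> cplx R) (eta : nat -> F) (c : nat -> cplx R),
     [/\ forall i, predual N (w i),
         forall i a, `|w i a| <= c i * `|a|,
         cvgn (series (fun i => c i * `|eta i|)) &
         forall x, series (fun i => w i (mip (eta i) x)) @ \oo --> f x]].

Definition adjointable (F G : hilbmodType A) (f : F -> G) : Prop :=
  exists g : G -> F, forall x y, mip (f x) y = mip x (g y) :> A.

(* The normal functionals on the W*-algebra of adjointable operators of a
   self-dual module F; only their values on adjointable operators matter. *)
Definition ultraweak_adjointable (N : von_neumann A) (F : hilbmodType A) :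
    set ((F -> F) -> cplx R) :=
  [set g | exists (w : nat -> A -> cplx R) (x y : nat -> F) (c : nat -> cplx R),
     [/\ forall i, predual N (w i),
         forall i a, `|w i a| <= c i * `|a|,
         cvgn (series (fun i => c i * `|x i| * `|y i|)) &
         forall t, adjointable t ->
           series (fun i => w i (mip (x i) (t (y i)))) @ \oo --> g t]].

Definition self_dual (F : hilbmodType A) : Prop :=
  forall f : {linear F -> A}, continuous f ->
    (forall x a, f (ract x a) = amul (f x) a) ->
    exists y : F, forall x, f x = mip y x.

Definition setting_corr (S : setting) (F : corrType A) : Prop :=
  match S with
  | CStarSetting => True
  | WStarSetting N => self_dual F /\
      continuous_wrt (predual N) (@ultraweak_adjointable N F) (@lact R A F)
  end.

Definition module_closure (S : setting) (F : hilbmodType A) (B : set F) :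
    set F :=
  match S with
  | CStarSetting => closure B
  | WStarSetting N => closure_wrt (@sigma_functionals N F) B
  end.

(* t exhibits G as the (self-dual, in the W*-setting) interior tensor product
   of E and F.  Bilinearity, balancedness and right linearity of t follow from
   the formula for the inner product. *)
Definition interior_tensor (S : setting) (E F G : corrType A)
    (t : E -> F -> G) : Prop :=
  [/\ forall x x' y y', mip (t x y) (t x' y') = mip y (lact (mip x x' : A) y') :> A,
      forall (a : A) x y, t (lact a x) y = lact a (t x y) &
      module_closure S (lspan [set w | exists x y, w = t x y]) = setT].

(* u identifies A, as a correspondence over itself, with F. *)
Definition identity_corr (F : corrType A) (u : A -> F) : Prop :=
  [/\ forall (c : cplx R) a b, u (c *: a + b) = c *: u a + u b,
      forall a b, mip (u a) (u b) = amul (astar a) b,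
      forall a b, ract (u a) b = u (amul a b),
      forall a b, lact a (u b) = u (amul a b) &
      forall x, exists a, u a = x].

Definition corr_iso (E F : corrType A) (f : E -> F) : Prop :=
  [/\ forall x y, mip (f x) (f y) = mip x y :> A,
      forall (a : A) x, f (lact a x) = lact a (f x) &
      forall y, exists x, f x = y].

(* The tensor powers of E.  tp_cat n m is the tensor product map
   E^n x E^m -> E^(n+m); its associativity is only stated with one factor in
   front, where both sides have the same type by computation, and follows in
   general by induction.  interior_tensor for tp_cat 0 n entails, by
   tp_cat_unitl, that the left actions are nondegenerate. *)
Record tensor_powers (S : setting) (E : corrType A) := {
  tp :> nat -> corrType A;
  tp_setting : forall n, setting_corr S (tp n);
  tp_unit : A -> tp 0;
  tp_unitP : identity_corr tp_unit;
  tp_base : E -> tp 1;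
  tp_baseP : corr_iso tp_base;
  tp_cat : forall n m, tp n -> tp m -> tp (n + m);
  tp_catP : forall n m, interior_tensor S (@tp_cat n m);
  tp_cat_unitl : forall n a (x : tp n), tp_cat (tp_unit a) x = lact a x;
  tp_cat_unitr : forall a (x : tp 1), @tp_cat 1 0 x (tp_unit a) = ract x a;
  tp_catA : forall n m (e : tp 1) (x : tp n) (y : tp m),
    @tp_cat (1 + n) m (tp_cat e x) y = @tp_cat 1 (n + m) e (tp_cat x y) }.

(* sp_incl n is the inclusion of X(n) in the n-th tensor power of E = X(1);
   its adjoint sp_proj n is the orthogonal projection p_n, with values seen in
   X(n).  X(n) (x) X(m) is, inside the (n+m)-th tensor power, the closed span
   of the tensors of elements of X(n) and X(m). *)
Record subproduct_system (S : setting) := {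
  sp :> nat -> corrType A;
  sp_setting : forall n, setting_corr S (sp n);
  sp_unit : A -> sp 0;
  sp_unitP : identity_corr sp_unit;
  sp_pow : tensor_powers S (sp 1);
  sp_incl : forall n, sp n -> sp_pow n;
  sp_proj : forall n, sp_pow n -> sp n;
  sp_incl_isom : forall n (x y : sp n),
    mip (sp_incl x) (sp_incl y) = mip x y :> A;
  sp_incl_lact : forall n a (x : sp n), sp_incl (lact a x) = lact a (sp_incl x);
  sp_incl_adj : forall n (x : sp n) (w : sp_pow n),
    mip (sp_incl x) w = mip x (sp_proj w) :> A;
  sp_incl0 : forall a, sp_incl (sp_unit a) = tp_unit sp_pow a;
  sp_incl1 : forall x : sp 1, sp_incl x = tp_base sp_pow x;
  sp_incl_tensor : forall n m (z : sp (n + m)),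
    module_closure S
      (lspan [set w | exists (x : sp n) (y : sp m),
                        w = tp_cat (sp_incl x) (sp_incl y)])
      (sp_incl z) }.

Definition sp_mul (S : setting) (X : subproduct_system S) n m
    (zeta : X n) (eta : X m) : X (n + m)%N :=
  sp_proj (tp_cat (sp_incl zeta) (sp_incl eta)).

(* The norm of a k x k matrix over F inside the matrices over the linking
   algebra, i.e. as an operator on (F (+) A)^k: the entry zeta i j maps (y, b)
   to (zeta i j b, 0). *)
Definition linking_norm_le (F : hilbmodType A) k (zeta : 'M[F]_k) (c : cplx R) :
    Prop :=
  0 <= c /\
  forall (y : 'I_k -> F) (b : 'I_k -> A),
    let z i := \sum_j ract (zeta i j) (b j) in
    `|\sum_i (mip (z i) (z i) : A)| <=
      c ^+ 2 * `|\sum_j (mip (y j) (y j) + amul (astar (b j)) (b j))|.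

Definition opmatrix_norm_le (H : hilbertType R) k (t : 'I_k -> 'I_k -> bop H H)
    (c : cplx R) : Prop :=
  0 <= c /\
  forall h : 'I_k -> H,
    \sum_i `|\sum_j t i j (h j)| ^+ 2 <= c ^+ 2 * \sum_j `|h j| ^+ 2.

Definition completely_contractive (F : hilbmodType A) (H : hilbertType R)
    (T : F -> bop H H) : Prop :=
  forall k (zeta : 'M[F]_k) c, linking_norm_le zeta c ->
    opmatrix_norm_le (fun i j => T (zeta i j)) c.

Definition setting_continuous (S : setting) (X : subproduct_system S)
    (H : hilbertType R) (T : forall n, X n -> bop H H) : Prop :=
  match S with
  | CStarSetting => True
  | WStarSetting N =>
      continuous_wrt (predual N) (@ultraweak R H)
        (fun a => T 0%N (sp_unit X a)) /\
      forall n, continuous_wrt (@sigma_functionals N (X n)) (@ultraweak R H)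
        (T n)
  end.

Record ccc_rep (S : setting) (X : subproduct_system S) (H : hilbertType R) := {
  rep :> forall n, X n -> bop H H;
  rep_linear : forall n (c : cplx R) (x y : X n) h,
    rep (c *: x + y) h = c *: rep x h + rep y h;
  rep_star : star_rep (fun a => rep (sp_unit X a));
  rep_nondegenerate : nondegenerate (fun a => rep (sp_unit X a));
  rep_cc : forall n, completely_contractive (@rep n);
  rep_ract : forall n (x : X n) (a : A) h,
    rep (ract x a) h = rep x (rep (sp_unit X a) h);
  rep_lact : forall n (x : X n) (a : A) h,
    rep (lact a x) h = rep (sp_unit X a) (rep x h);
  rep_mul : forall n m (x : X n) (y : X m) h,
    rep (sp_mul x y) h = rep x (rep y h);
  rep_continuous : setting_continuous rep }.

(* t exhibits G as the Hilbert space F (x)_s H. *)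
Definition hilbert_tensor (F : hilbmodType A) (H G : hilbertType R)
    (s : A -> bop H H) (t : F -> H -> G) : Prop :=
  (forall x y h k, hip (t x h) (t y k) = hip h (s (mip x y) k)) /\
  closure (lspan [set v | exists x h, v = t x h]) = setT.

Section Representations.
Variables (S : setting) (X : subproduct_system S) (H : hilbertType R).
Implicit Types T : ccc_rep X H.

Definition rep0 T (a : A) : bop H H := T 0%N (sp_unit X a).

(* L is the operator T~_n from G = X(n) (x)_sigma H to H. *)
Definition is_tilde T n (G : hilbertType R) (t : X n -> H -> G)
    (L : bop G H) : Prop :=
  hilbert_tensor (rep0 T) t /\ forall x h, L (t x h) = T n x h.

(* Q = T~_n T~_n^*. *)
Definition is_tilde_tilde_adj T n (Q : bop H H) : Prop :=
  exists (G : hilbertType R) (t : X n -> H -> G) (L : bop G H) (L' : bop H G),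
    [/\ is_tilde T t L, adjoint L L' & forall h, Q h = L (L' h)].

Definition fully_coisometric T : Prop :=
  forall n, exists2 Q, is_tilde_tilde_adj T n Q & forall h, Q h = h.

Definition pure T : Prop :=
  exists2 Q : nat -> bop H H, forall n, is_tilde_tilde_adj T n (Q n) &
    forall h, (fun n => Q n h) @ \oo --> (0 : H).

Definition is_defect T (Delta : bop H H) : Prop :=
  exists2 Q, is_tilde_tilde_adj T 1 Q &
    positive_bop Delta /\ forall h, Delta (Delta h) = h - Q h.

End Representations.

Definition dilation (S : setting) (X : subproduct_system S)
    (H K : hilbertType R) (W : bop H K) (T : ccc_rep X H) (V : ccc_rep X K) :
    Prop :=
  isometric_bop W /\
  forall n (zeta : X n), exists (V' : bop K K) (T' : bop H H),
    [/\ adjoint (V n zeta) V', adjoint (T n zeta) T' &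
        forall h, V' (W h) = W (T' h)].

(* The direct sum of the correspondences X(n) (self-dual in the W*-setting). *)
Record fock_space (S : setting) (X : subproduct_system S) := {
  fock :> corrType A;
  fock_setting : setting_corr S fock;
  fock_in : forall n, X n -> fock;
  fock_in_isom : forall n (x y : X n), mip (fock_in x) (fock_in y) = mip x y :> A;
  fock_in_orth : forall n m (x : X n) (y : X m), n != m ->
    mip (fock_in x) (fock_in y) = 0 :> A;
  fock_in_lact : forall n a (x : X n), fock_in (lact a x) = lact a (fock_in x);
  fock_total :
    module_closure S (lspan [set w | exists n (x : X n), w = fock_in x]) = setT }.

Definition is_shift (S : setting) (X : subproduct_system S) (FX : fock_space X)
    (Sh : forall n, X n -> FX -> FX) : Prop :=
  forall n (zeta : X n), adjointable (Sh n zeta) /\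
    forall m (eta : X m), Sh n zeta (fock_in FX eta) = fock_in FX (sp_mul zeta eta).

(* L = f (x) I on G = F (x)_s D, t being the tensor map. *)
Definition is_induced (F : hilbmodType A) (D G : hilbertType R)
    (t : F -> D -> G) (f : F -> F) (L : bop G G) : Prop :=
  forall x d, L (t x d) = t (f x) d.

End Settings.

Definition hilbert_sum (R : realType) (G U K : hilbertType R)
    (i : bop G K) (j : bop U K) : Prop :=
  [/\ isometric_bop i, isometric_bop j, forall g u, hip (i g) (j u) = 0 &
      forall k, exists g u, k = i g + j u].

(* Main.v *)
Require Import Defs.
From HB Require Import structures.
From mathcomp Require Import all_boot all_order all_algebra.
From mathcomp Require Import all_classical all_reals all_analysis.
From mathcomp Require Import complex ring.

(* Write s = T_0 and let L_n = T~_n, with adjoint xi_n : H -> X(n) (x)_s H.  Comparing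
   X(n+m) (x) H with X(n) (x) X(m) (x) H gives
     <(1 (x) xi_m) xi_n h, (1 (x) xi_m) xi_n h'> = <xi_(n+m) h, xi_(n+m) h'>,
   so the operators Q_n = L_n xi_n decrease strongly to some Q >= 0.  As Delta^2 = 1 - Q_1,
   the series K h = sum_n (1 (x) Delta) xi_n h telescopes, converges in F_X (x) D, and
   satisfies K^* K = 1 - Q and K^* (S_n(x) (x) 1) = T_n(x) K^*.
   Completing H for the form <h, Q h'> gives a space U and a map q : H -> U with q^* q = Q.
   By the displayed identity, q h |-> (1 (x) q) xi_n h extends to an isometry
   U -> X(n) (x) U; its adjoint is the tilde operator of a fully coisometric representation
   Z of X on U with q^* Z_n(x) = T_n(x) q^*.  Then h |-> (K h, q h) embeds H in
   (F_X (x) D) (+) U, and U = 0 iff Q = 0 iff T is pure.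
   In the W*-setting the continuity of V and Z is automatic: a functional f on a module F
   with |f x|^2 <= M w(<x, x>) for a normal positive w is absolutely summable in the sense
   of sigma_functionals. *)

Set Implicit Arguments.
Unset Strict Implicit.
Unset Printing Implicit Defensive.
Import Order.TTheory GRing.Theory Num.Theory.
Import numFieldNormedType.Exports.
Local Open Scope classical_set_scope.
Local Open Scope ring_scope.

(** * Limits of complex sequences *)

(** K^*K + q^*q = 1 makes h |-> (K h, q h) isometric, and the two intertwining relations say that
    the adjoints of V preserve its image. The work lies in making the operators exist. Contractivity
    of the T~_n is not read off complete contractivity: T~_1 is a contraction because 1 - T~_1
    T~_1^* is the square of Delta, and T~_(n+1) is T~_1 (1 (x) T~_n) composed with the adjoint of
    the multiplication. Conversely, a contractive tilde operator has to be shown to give a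
    completely contractive map. There, as for the positivity of c^*c in an algebra without unit,
    spectral theory is replaced by the growth of powers: a self-adjoint operator whose n-th power
    grows at most like t^n times a linear factor has norm at most t. Square roots come from a
    polynomial iteration, so that commutation relations pass to them. Elementary tensors are dense
    in norm, but in the W*-setting only for the sigma-topology; hence identities on X(n+m) are
    tested by functionals which are first shown to be continuous for the topology at hand. *)

Section ComplexNumbers.
Variable R : realType.
Local Notation C := (cplx R).

(** The one place where [cplx] is unlocked: order, archimedean property and completeness of the real
    line are transported along this embedding. *)
Lemma cplx_real_embedding : exists f : {rmorphism R -> C},
  {mono f : x y / x <= y} /\ forall z : C, z \is Num.real -> exists r, f r = z.
Proof.
have: cplx R = R[i] :> numClosedFieldType by rewrite cplx.unlock.
move: (cplx R) => F ->; exists (GRing.RMorphism.clone _ _ (real_complex R) _).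
by split=> [x y /=|z /complex_realP[k ->]]; [exact: lecR | exists k].
Qed.

Lemma ge0_limit (u : nat -> C) l : (forall n, 0 <= u n) -> u @ \oo --> l -> 0 <= l.
Proof.
move=> u0 ul; have: (fun n => `|u n|) @ \oo --> `|l| by exact: cvg_norm.
rewrite (_ : (fun n => `|u n|) = u); last by apply/funext => n; rewrite ger0_norm.
by move=> /(cvg_unique _ ul) ->.
Qed.

Lemma le_limit (u v : nat -> C) l m :
  (forall n, u n <= v n) -> u @ \oo --> l -> v @ \oo --> m -> l <= m.
Proof.
move=> uv ul vm; rewrite -subr_ge0; apply: (@ge0_limit (fun n => v n - u n)).
  by move=> n; rewrite subr_ge0.
exact: cvgB.
Qed.

Lemma lim_unique (E : normedModType C) (u : nat -> E) (l m : E) :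
  u @ \oo --> l -> u @ \oo --> m -> l = m.
Proof. by move=> ul um; apply: cvg_unique ul um; exact: norm_hausdorff. Qed.

Lemma clim_unique (u : nat -> C) (l m : C) :
  u @ \oo --> l -> u @ \oo --> m -> l = m.
Proof. by move=> ul um; apply: cvg_unique ul um; exact: norm_hausdorff. Qed.

Lemma cplx_archi (e : C) : 0 < e -> exists n : nat, n.+1%:R^-1 < e.
Proof.
have [f [fle fs]] := cplx_real_embedding.
move=> e0; have [r re] := fs _ (gtr0_real e0).
have r0 : 0 < r by move: e0; rewrite -re -(rmorph0 f) (leW_mono fle).
exists (Num.bound r^-1); rewrite -re.
have -> : (Num.bound r^-1).+1%:R = f (Num.bound r^-1).+1%:R by rewrite rmorph_nat.
rewrite -fmorphV (leW_mono fle) invf_plt ?posrE ?ltr0n//.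
by rewrite (lt_trans (archi_boundP _)) ?invr_ge0 ?(ltW r0)// ltr_nat.
Qed.

Lemma cvgn_le0P (E : normedModType C) (u : nat -> E) l :
  u @ \oo --> l <->
  (forall e : C, 0 < e -> exists N, forall n, (N <= n)%N -> `|u n - l| <= e).
Proof.
split=> [ul e e0|h].
  have /cvgrPdistC_le/(_ e e0) [N _ hN] := ul.
  by exists N => n Nn; exact: hN.
apply/cvgrPdistC_le => e e0; have [N hN] := h e e0.
by exists N => // n /= Nn; exact: hN.
Qed.

Lemma cvg_rate (E : normedModType C) (u : nat -> E) l (b : nat -> C) :
  (forall n, `|u n - l| <= b n) -> b @ \oo --> 0 -> u @ \oo --> l.
Proof.
move=> ub /cvgn_le0P b0; apply/cvgn_le0P => e /b0 [N hN]; exists N => n /hN.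
by rewrite subr0 ger0_norm ?(le_trans _ (ub n))// => /(le_trans (ub n)).
Qed.

Lemma cvg_invS : (fun n : nat => n.+1%:R^-1 : C) @ \oo --> 0.
Proof.
apply/cvgn_le0P => e /cplx_archi [N hN]; exists N => n Nn.
rewrite subr0 ger0_norm ?invr_ge0 ?ler0n//; apply: le_trans (ltW hN).
by rewrite lef_pV2 ?posrE ?ltr0n// ler_nat.
Qed.

(** Nonnegative complex numbers are real, so a real infimum can be used. It is the source of the
    minimising and of the monotone sequences below. *)
Lemma lower_bound (E : set C) : E !=set0 -> (forall x, E x -> 0 <= x) ->
  exists2 i, 0 <= i & (forall x, E x -> i <= x) /\
    forall e, 0 < e -> exists2 x, E x & x < i + e.
Proof.
have [f [fle fs]] := cplx_real_embedding.
move=> [x0 Ex0] E0; pose S := [set r | E (f r)].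
have lbS : lbound S 0 by move=> r /E0; rewrite -(rmorph0 f) fle.
have hS : has_inf S.
  split; last by exists 0.
  by have [r rx] := fs _ (ger0_real (E0 _ Ex0)); exists r; rewrite /S /= rx.
exists (f (inf S)).
  by rewrite -(rmorph0 f) fle; apply: lb_le_inf => //; case: hS.
split=> [x Ex|e e0].
  have [r rx] := fs _ (ger0_real (E0 _ Ex)).
  by rewrite -rx fle; apply: ge_inf; [case: hS|rewrite /S /= rx].
have [r re] := fs _ (gtr0_real e0).
have r0 : 0 < r by move: e0; rewrite -re -(rmorph0 f) (leW_mono fle).
have [s Ss sl] := inf_adherent r0 hS.
by exists (f s) => //; rewrite -re -rmorphD (leW_mono fle).
Qed.

Lemma cauchyseq_cvg (E : completeNormedModType C) (u : nat -> E) :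
  (forall e : C, 0 < e -> exists N, forall m n,
     (N <= m)%N -> (N <= n)%N -> `|u m - u n| <= e) ->
  exists l : E, u @ \oo --> l.
Proof.
move=> h; suff: cvgn u by move=> /cvg_ex.
apply: cauchy_cvg; apply: cauchy_exP => e e0.
have [N hN] := h _ (divr_gt0 e0 (ltr0n C 2)).
exists (u N), N => // n /= Nn; rewrite -ball_normE /=.
rewrite (le_lt_trans (hN _ _ (leqnn N) Nn))// ltr_pdivrMr// ltr_pMr//.
by rewrite ltr1n.
Qed.

(* Completeness of C is inherited from the real line by embedding it. *)
Lemma real_cauchy_cvg (u : nat -> C) : (forall n, u n \is Num.real) ->
  (forall e : C, 0 < e -> exists N, forall m n,
     (N <= m)%N -> (N <= n)%N -> `|u m - u n| <= e) ->
  exists l : C, u @ \oo --> l.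
Proof.
have [f [fle fs]] := cplx_real_embedding.
have fnorm x : f `|x| = `|f x|.
  case: (leP 0 x) => x0.
    by rewrite !ger0_norm// -(rmorph0 f) fle.
  by rewrite !ltr0_norm ?rmorphN// -(rmorph0 f) (leW_mono fle).
move=> ur h; have /choice [v vu] n : exists r, f r = u n by exact: fs.
have [l vl] : exists l : R^o, (v : nat -> R^o) @ \oo --> l.
  suff: cvgn (v : nat -> R^o) by move=> /cvg_ex.
  apply: cauchy_cvg; apply: cauchy_exP => e e0.
  have e20 : 0 < f (e / 2).
    by rewrite -(rmorph0 f) (leW_mono fle) divr_gt0.
  have [N hN] := h _ e20.
  exists (v N), N => // n /= Nn; rewrite -ball_normE /=.
  have := hN _ _ (leqnn N) Nn; rewrite -!vu -rmorphB -fnorm fle => le2.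
  by rewrite (le_lt_trans le2)// ltr_pdivrMr// ltr_pMr// ltr1n.
exists (f l); apply/cvgn_le0P => e e0.
have [r re] := fs _ (gtr0_real e0).
have r0 : 0 < r by move: e0; rewrite -re -(rmorph0 f) (leW_mono fle).
have /cvgrPdistC_le/(_ r r0) [N _ hN] := vl.
exists N => n Nn; rewrite -vu -rmorphB -fnorm -re fle; exact: hN.
Qed.

Lemma cplx_cauchy_cvg (u : nat -> C) :
  (forall e : C, 0 < e -> exists N, forall m n,
     (N <= m)%N -> (N <= n)%N -> `|u m - u n| <= e) ->
  exists l : C, u @ \oo --> l.
Proof.
move=> h.
have [a ha] : exists l : C, (fun n => 'Re (u n)) @ \oo --> l.
  apply: real_cauchy_cvg => [n|e /h [N hN]]; first exact: Creal_Re.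
  exists N => m n /hN /[apply]; apply: le_trans.
  by rewrite -raddfB; case: (leif_normC_Re_Creal (u m - u n)).
have [b hb] : exists l : C, (fun n => 'Im (u n)) @ \oo --> l.
  apply: real_cauchy_cvg => [n|e /h [N hN]]; first exact: Creal_Im.
  exists N => m n /hN /[apply]; apply: le_trans.
  rewrite -raddfB -(@ler_pXn2r _ 2)// ?nnegrE// [leRHS]normC2_Re_Im.
  by rewrite real_normK ?Creal_Im// lerDr -realEsqr Creal_Re.
exists (a + 'i * b); rewrite (_ : u = fun n => 'Re (u n) + 'i * 'Im (u n)).
  by apply: cvgD => //; apply: cvgM => //; exact: cvg_cst.
by apply/funext => n; exact: Crect.
Qed.

End ComplexNumbers.

(** * Positive semidefinite kernels and approximate Riesz representation *)

Section Kernels.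
Variable R : realType.
Local Notation C := (cplx R).

Lemma le_subE (x y z : C) : 0 <= x -> z - y = x -> y <= z.
Proof. by move=> x0 zy; rewrite -subr_ge0 zy. Qed.

(** The discriminant argument behind the scalar Cauchy-Schwarz inequalities below, with c = - s d^*
    for real s >= 0. If K > 0 take s = 1/K; if K = 0, the value s = (e + 1)/|d|^2 would give 2(e +
    1) <= e. *)
Lemma quadratic_ineq (d K e : C) : 0 <= K -> 0 <= e ->
  (forall c, 0 <= e + (c * d + (c * d)^*) + `|c| ^+ 2 * K) ->
  `|d| ^+ 2 <= e * K.
Proof.
move=> K0 e0 h.
have hs (s : C) : 0 <= s -> `|d| ^+ 2 * (s *+ 2) <= e + s ^+ 2 * `|d| ^+ 2 * K.
  move=> s0; have := h (- (s * d^*)).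
  rewrite normrN normrM norm_conjC exprMn (ger0_norm s0) rmorphM rmorphN rmorphM.
  rewrite /= conjCK (conj_Creal (ger0_real s0)) normCKC.
  by move=> /le_subE; apply; ring.
have [K1|K1] := eqVneq K 0; last first.
  have Kp : 0 < K by rewrite lt_def K1.
  have := hs K^-1; rewrite invr_ge0 => /(_ K0).
  rewrite (_ : K^-1 ^+ 2 * _ * K = `|d| ^+ 2 / K); last first.
    by field.
  by rewrite mulr2n mulrDr lerD2r ler_pdivrMr.
rewrite K1 mulr0; have [->|d0] := eqVneq d 0; first by rewrite normr0 expr0n.
have dp : 0 < `|d| ^+ 2 by rewrite exprn_gt0 ?normr_gt0.
have := hs ((e + 1) / `|d| ^+ 2); rewrite K1 mulr0 addr0.
rewrite divr_ge0 ?(ltW dp) ?addr_ge0 ?ler01// => /(_ isT).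
rewrite -mulrnAr mulrCA mulrnAr divff ?gt_eqF// => le0; exfalso.
have: 0 < e + 2 by rewrite ltr_wpDl.
rewrite (_ : e + 2 = (e + 1) * 2%:R - e); last by ring.
by rewrite subr_gt0 => /(le_lt_trans le0); rewrite ltxx.
Qed.

Variable I : Type.
Implicit Types l m : seq (C * I).

(** Formal finite combinations of indices are unreduced lists of pairs: only the values of forms and
    functionals on them matter, and concatenation serves as addition. *)
Definition scl (c : C) l : seq (C * I) := [seq (c * p.1, p.2) | p <- l].

Definition ev (f : I -> C) l : C := \sum_(p <- l) p.1 * f p.2.

Definition kform (k : I -> I -> C) l m : C :=
  \sum_(p <- l) \sum_(q <- m) p.1^* * q.1 * k p.2 q.2.

Definition psd (k : I -> I -> C) :=
  (forall i j, (k i j)^* = k j i) /\ forall l, 0 <= kform k l l.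

Lemma ev_cat f l m : ev f (l ++ m) = ev f l + ev f m.
Proof. by rewrite /ev big_cat. Qed.

Lemma ev_scl f c l : ev f (scl c l) = c * ev f l.
Proof.
by rewrite /ev big_map mulr_sumr; apply: eq_bigr => p _; rewrite mulrA.
Qed.

Lemma ev1 f c i : ev f [:: (c, i)] = c * f i.
Proof. by rewrite /ev big_seq1. Qed.

Lemma kformE k l m :
  kform k l m = ev (fun j => \sum_(p <- l) p.1^* * k p.2 j) m.
Proof.
rewrite /kform /ev exchange_big /=; apply: eq_bigr => q _.
by rewrite mulr_sumr; apply: eq_bigr => p _; rewrite mulrA [q.1 * _]mulrC.
Qed.

Lemma kform_catr k l m m' : kform k l (m ++ m') = kform k l m + kform k l m'.
Proof. by rewrite !kformE ev_cat. Qed.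

Lemma kform_sclr k c l m : kform k l (scl c m) = c * kform k l m.
Proof. by rewrite !kformE ev_scl. Qed.

Lemma kform_catl k l l' m : kform k (l ++ l') m = kform k l m + kform k l' m.
Proof. by rewrite /kform big_cat. Qed.

Lemma kform_scll k c l m : kform k (scl c l) m = c^* * kform k l m.
Proof.
rewrite /kform big_map mulr_sumr; apply: eq_bigr => p _.
by rewrite mulr_sumr; apply: eq_bigr => q _ /=; rewrite rmorphM -!mulrA.
Qed.

Lemma kform_conj k l m : (forall i j, (k i j)^* = k j i) ->
  (kform k l m)^* = kform k m l.
Proof.
move=> hk; rewrite /kform exchange_big /= rmorph_sum; apply: eq_bigr => p _.
rewrite rmorph_sum; apply: eq_bigr => q _ /=.
by rewrite !rmorphM /= conjCK hk [X in X * _]mulrC.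
Qed.

Lemma kform_quad k l m c : (forall i j, (k i j)^* = k j i) ->
  kform k (l ++ scl c m) (l ++ scl c m) =
  kform k l l + (c * kform k l m + (c * kform k l m)^*) + `|c| ^+ 2 * kform k m m.
Proof.
move=> hk; rewrite !kform_catr !kform_catl !kform_sclr !kform_scll.
by rewrite rmorphM /= kform_conj// normCKC; ring.
Qed.

Lemma kform_cs k l m : psd k ->
  `|kform k l m| ^+ 2 <= kform k l l * kform k m m.
Proof.
by move=> [hk pk]; apply: quadratic_ineq => // c; rewrite -kform_quad.
Qed.

(* Minimizing |v_l|^2 - 2 Re f(l) up to e over finite combinations l. *)
Lemma approx_riesz k f (M e : C) : psd k -> 0 <= M -> 0 < e ->
  (forall l, `|ev f l| ^+ 2 <= M * kform k l l) ->
  exists l, forall m, `|ev f m - kform k l m| ^+ 2 <= e * kform k m m.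
Proof.
move=> [hk pk] M0 e0 fM.
(* The constant [M] makes the energy nonnegative: |2 Re f(l)| <= 2 sqrt(M k(l,l)) <= k(l,l) + M. *)
pose phi l := kform k l l - (ev f l + (ev f l)^*) + M.
have phi0 l : 0 <= phi l.
  have kM : 0 <= kform k l l + M by rewrite addr_ge0.
  rewrite /phi addrAC subr_ge0 (@le_trans _ _ (`|ev f l + (ev f l)^*|))//.
    by rewrite real_ler_norm// CrealE rmorphD /= conjCK addrC.
  rewrite (le_trans (ler_normD _ _))// norm_conjC -mulr2n.
  rewrite -(@ler_pXn2r _ 2)// ?nnegrE ?mulrn_wge0//.
  rewrite -mulr_natl exprMn (@le_trans _ _ (2 ^+ 2 * (M * kform k l l)))//.
    by rewrite ler_wpM2l// exprn_ge0.
  apply: (@le_subE ((kform k l l - M) ^+ 2)); last by ring.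
  by rewrite real_exprn_even_ge0// rpredB// ger0_real.
have [||i i0 [ile iex]] := @lower_bound R [set z | exists l, z = phi l].
- by exists (phi [::]), [::].
- by move=> z [l ->].
have [_ [l ->] li] := iex e e0; exists l => m.
(* As [l] is minimal up to [e], phi(l + c m) >= phi(l) - e for all c; this is the quadratic
   inequality for d = k(l,m) - f(m). *)
rewrite distrC; apply: quadratic_ineq => //; first exact: ltW.
move=> c; have : phi l - e <= phi (l ++ scl c m).
  by rewrite lerBlDr (le_trans (ltW li))// lerD2r ile//; exists (l ++ scl c m).
rewrite -subr_ge0 => /le_trans; apply; rewrite /phi kform_quad// ev_cat ev_scl.
rewrite rmorphD !rmorphM /= !rmorphB /= le_eqVlt; apply/orP; left; apply/eqP.
by ring.
Qed.

End Kernels.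

(** * Hilbert spaces and their bounded operators *)

Section HilbertBasics.
Variables (R : realType) (H : hilbertType R).
Local Notation C := (cplx R).
Implicit Types x y z : H.

Lemma hipDr x y z : hip x (y + z) = hip x y + hip x z.
Proof. by rewrite -[y]scale1r hip_linear mul1r scale1r. Qed.

Lemma hip0r x : hip x 0 = 0.
Proof. by apply: (addrI (hip x 0)); rewrite -hipDr !addr0. Qed.

Lemma hipZr c x y : hip x (c *: y) = c * hip x y.
Proof. by rewrite -[_ *: _]addr0 hip_linear hip0r addr0. Qed.

Lemma hipNr x y : hip x (- y) = - hip x y.
Proof. by rewrite -scaleN1r hipZr mulN1r. Qed.

Lemma hipBr x y z : hip x (y - z) = hip x y - hip x z.
Proof. by rewrite hipDr hipNr. Qed.

Lemma hip_sumr (T : Type) (s : seq T) (P : pred T) x (F : T -> H) :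
  hip x (\sum_(i <- s | P i) F i) = \sum_(i <- s | P i) hip x (F i).
Proof. by apply: (big_morph (hip x)); [exact: hipDr|exact: hip0r]. Qed.

Lemma hipDl x y z : hip (x + y) z = hip x z + hip y z.
Proof. by rewrite -hip_conj hipDr rmorphD /= !hip_conj. Qed.

Lemma hip0l x : hip 0 x = 0.
Proof. by rewrite -hip_conj hip0r rmorph0. Qed.

Lemma hipZl c x y : hip (c *: x) y = c^* * hip x y.
Proof. by rewrite -hip_conj hipZr rmorphM /= !hip_conj. Qed.

Lemma hipNl x y : hip (- x) y = - hip x y.
Proof. by rewrite -hip_conj hipNr rmorphN /= !hip_conj. Qed.

Lemma hipBl x y z : hip (x - y) z = hip x z - hip y z.
Proof. by rewrite hipDl hipNl. Qed.

Lemma hip_suml (T : Type) (s : seq T) (P : pred T) x (F : T -> H) :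
  hip (\sum_(i <- s | P i) F i) x = \sum_(i <- s | P i) hip (F i) x.
Proof.
by apply: (big_morph (fun y => hip y x)) => [y z|]; rewrite (hipDl, hip0l).
Qed.

Lemma hip_ge0 x : 0 <= hip x x.
Proof. by rewrite hip_norm exprn_ge0. Qed.

Lemma hip_eq0 x : hip x x = 0 -> x = 0.
Proof. by move/eqP; rewrite hip_norm sqrf_eq0 normr_eq0 => /eqP. Qed.

Lemma hip_injl x y : (forall z, hip x z = hip y z) -> x = y.
Proof.
by move=> h; apply/eqP; rewrite -subr_eq0; apply/eqP/hip_eq0;
  rewrite hipBl h subrr.
Qed.

Lemma hip_injr x y : (forall z, hip z x = hip z y) -> x = y.
Proof. by move=> h; apply: hip_injl => z; rewrite -hip_conj h hip_conj. Qed.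

Lemma hip_cs x y : `|hip x y| <= `|x| * `|y|.
Proof.
rewrite -(@ler_pXn2r _ 2)// ?nnegrE ?mulr_ge0// exprMn.
apply: quadratic_ineq; rewrite ?exprn_ge0// => c.
rewrite -!hip_norm; have := hip_ge0 (x + c *: y).
rewrite !hipDl !hipDr !hipZl !hipZr rmorphM /= hip_conj => h.
by apply: le_trans h _; rewrite normCK le_eqVlt; apply/orP; left; apply/eqP; ring.
Qed.

Lemma norm_addE x y :
  `|x + y| ^+ 2 = `|x| ^+ 2 + (hip x y + hip y x) + `|y| ^+ 2.
Proof. by rewrite -!hip_norm hipDl !hipDr !addrA. Qed.

Lemma norm_subE x y :
  `|x - y| ^+ 2 = `|x| ^+ 2 - (hip x y + hip y x) + `|y| ^+ 2.
Proof. by rewrite norm_addE normrN hipNr hipNl opprD. Qed.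

Lemma cvg_hip (u v : nat -> H) x y :
  u @ \oo --> x -> v @ \oo --> y -> (fun n => hip (u n) (v n)) @ \oo --> hip x y.
Proof.
move=> ux vy.
have d0 (w : nat -> H) z : w @ \oo --> z -> (fun n => `|w n - z|) @ \oo --> (0 : C).
  move=> wz; rewrite -(normr0 H) -(subrr z); apply: cvg_norm.
  by apply: cvgB => //; exact: cvg_cst.
have h0 : (fun n => `|u n - x| * `|v n| + `|x| * `|v n - y|) @ \oo --> (0 : C).
  rewrite -[0 : C]addr0 -{1}[0 : C](mul0r `|y|) -[X in _ + X](mulr0 `|x|).
  apply: cvgD; first by apply: cvgM; [exact: d0|exact: cvg_norm].
  by apply: cvgM; [exact: cvg_cst|exact: d0].
apply: cvg_rate h0 => n.
rewrite (_ : _ - _ = hip (u n - x) (v n) + hip x (v n - y)).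
  by rewrite (le_trans (ler_normD _ _))// lerD// hip_cs.
by rewrite hipBl hipBr addrA subrK.
Qed.

End HilbertBasics.

Section LinearCombinations.
Variables (R : realType).
Local Notation C := (cplx R).

Definition lc (V : lmodType C) (I : Type) (t : I -> V) (l : seq (C * I)) : V :=
  \sum_(p <- l) p.1 *: t p.2.

Lemma lc_cat (V : lmodType C) (I : Type) (t : I -> V) l m :
  lc t (l ++ m) = lc t l + lc t m.
Proof. by rewrite /lc big_cat. Qed.

Lemma lc_scl (V : lmodType C) (I : Type) (t : I -> V) c l :
  lc t (scl c l) = c *: lc t l.
Proof.
by rewrite /lc big_map scaler_sumr; apply: eq_bigr => p _; rewrite scalerA.
Qed.

Lemma lc1 (V : lmodType C) (I : Type) (t : I -> V) c i :
  lc t [:: (c, i)] = c *: t i.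
Proof. by rewrite /lc big_seq1. Qed.

Lemma hip_lcl (H : hilbertType R) I (t : I -> H) l h :
  hip (lc t l) h = \sum_(p <- l) p.1^* * hip (t p.2) h.
Proof. by rewrite hip_suml; apply: eq_bigr => p _; rewrite hipZl. Qed.

Lemma hip_lcr (H : hilbertType R) I (t : I -> H) l h :
  hip h (lc t l) = ev (fun i => hip h (t i)) l.
Proof. by rewrite hip_sumr; apply: eq_bigr => p _; rewrite hipZr. Qed.

Lemma hip_lc (H : hilbertType R) I (t : I -> H) l m :
  hip (lc t l) (lc t m) = kform (fun i j => hip (t i) (t j)) l m.
Proof.
rewrite hip_lcl; apply: eq_bigr => p _; rewrite hip_lcr mulr_sumr.
by apply: eq_bigr => q _; rewrite mulrA.
Qed.

Lemma psd_gram (H : hilbertType R) I (t : I -> H) :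
  psd (fun i j => hip (t i) (t j)).
Proof.
by split=> [i j|l]; [exact: hip_conj|rewrite -hip_lc hip_ge0].
Qed.

Lemma linear_lc (V W : lmodType C) (f : {linear V -> W}) I (t : I -> V) l :
  f (lc t l) = lc (f \o t) l.
Proof. by rewrite linear_sum; apply: eq_bigr => p _; rewrite linearZ. Qed.

Lemma lspanE (V : lmodType C) (I : Type) (t : I -> V) :
  lspan (range t) = range (lc t).
Proof.
apply/seteqP; split=> v.
  move=> [n [c [b [hb ->]]]]; have /choice [i hi] j : exists i, t i = b j.
    by have [i _ <-] := hb j; exists i.
  exists [seq (c j, i j) | j <- enum 'I_n] => //.
  by rewrite /lc big_map big_enum; apply: eq_bigr => j _; rewrite hi.
move=> [l _ <-]; exists (size l), (fun j => (tnth (in_tuple l) j).1),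
  (fun j => t (tnth (in_tuple l) j).2); split=> [j|]; first by exists (tnth (in_tuple l) j).2.
by rewrite /lc [LHS]big_tnth.
Qed.

End LinearCombinations.

Section BoundedOperators.
Variables (R : realType).
Local Notation C := (cplx R).

Lemma bop_bounded (H K : hilbertType R) (f : bop H K) :
  exists2 M : C, 0 <= M & forall x, `|f x| <= M * `|x|.
Proof.
have /linear_bounded_continuous/linear_boundedP := @bop_continuous _ _ _ f.
by move=> /pinfty_ex_gt0 [M M0 hM]; exists M => //; exact: ltW.
Qed.

Lemma bop_cvg (H K : hilbertType R) (f : bop H K) (u : nat -> H) x :
  u @ \oo --> x -> (fun n => f (u n)) @ \oo --> f x.
Proof. by move=> ux; apply: (cvg_comp _ _ ux); exact: bop_continuous. Qed.

Lemma bopP (H K : hilbertType R) (f : H -> K) (M : C) :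
  (forall c x y, f (c *: x + y) = c *: f x + f y) ->
  (forall x, `|f x| <= M * `|x|) -> {F : bop H K | forall x, F x = f x}.
Proof.
move=> lf bf.
pose L := HB.pack_for {linear H -> K} f (GRing.isLinear.Build _ _ _ _ f lf).
have Lc : continuous L.
  apply/linear_bounded_continuous/linear_boundedP; near=> r => x.
  rewrite (le_trans (bf x))// (@le_trans _ _ (`|M| * `|x|))//.
    rewrite -[leLHS]ger0_norm ?(le_trans _ (bf x))// normrM.
    by rewrite normr_id.
  by rewrite ler_wpM2r//; near: r; exact: nbhs_pinfty_ge.
by exists (Bop Lc).
Unshelve. all: by end_near. Qed.

End BoundedOperators.

(** A Cauchy filter contains a ball of radius 1/(n+1) for every n; the centres form a Cauchy
    sequence, and its limit is the limit of the filter. *)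
Lemma seq_complete (R : realType) (E : normedModType (cplx R)) :
  (forall u : nat -> E, (forall e : cplx R, 0 < e -> exists N, forall m n,
     (N <= m)%N -> (N <= n)%N -> `|u m - u n| <= e) ->
   exists l : E, u @ \oo --> l) ->
  forall F : set_system E, ProperFilter F -> cauchy F -> cvg F.
Proof.
move=> sc F FF /cauchyP Fc.
have i0 n : 0 < n.+1%:R^-1 :> cplx R by rewrite invr_gt0 ltr0n.
have /choice [u hu] n : exists x : E, F (ball x (n.+1%:R^-1 : cplx R)).
  by have [x hx] := Fc _ (i0 n); exists x.
have umn m n : `|u m - u n| <= m.+1%:R^-1 + n.+1%:R^-1.
  have [x []] := filter_ex (filterI (hu m) (hu n)).
  rewrite -!ball_normE /= => h1 h2; rewrite (le_trans (ler_distD x _ _))// lerD ?ltW//.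
  by rewrite distrC.
have ie (e : cplx R) : 0 < e -> exists N, forall n, (N <= n)%N -> n.+1%:R^-1 <= e / 2.
  move=> e0; have /cplx_archi [N hN] : 0 < e / 2 by rewrite divr_gt0.
  exists N => n Nn; apply: le_trans (ltW hN).
  by rewrite lef_pV2 ?posrE ?ltr0n// ler_nat.
have [l ul] : exists l : E, u @ \oo --> l.
  apply: sc => e e0; have [N hN] := ie e e0.
  exists N => m n /hN Nm /hN Nn; rewrite (le_trans (umn m n))//.
  by rewrite [leRHS](splitr e) lerD.
apply/cvg_ex; exists l; apply/fcvgrPdist_lt => e e0.
have [N hN] := ie _ (divr_gt0 e0 (ltr0n _ 2)).
have [M hM] := (cvgn_le0P u l).1 ul _ (divr_gt0 e0 (ltr0n _ 2)).
pose n := maxn M N.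
apply: filterS (hu n) => x; rewrite -ball_normE /= => xn.
rewrite (le_lt_trans (ler_distD (u n) _ _))// [ltRHS](splitr e) ler_ltD//.
  by rewrite distrC hM// leq_maxl.
apply: lt_le_trans xn (le_trans (hN n (leq_maxr _ _)) _).
by rewrite ler_pdivrMr// ler_peMr ?divr_ge0 ?ltW ?ltr1n//.
Qed.

Lemma norm2D (R : realType) (a b : cplx R) :
  `|a + b| ^+ 2 <= (`|a| ^+ 2 + `|b| ^+ 2) *+ 2.
Proof.
apply: (@le_trans _ _ ((`|a| + `|b|) ^+ 2)).
  by rewrite lerXn2r ?nnegrE ?addr_ge0// ler_normD.
apply: (@le_subE _ ((`|a| - `|b|) ^+ 2)); last by ring.
by rewrite real_exprn_even_ge0// rpredB// normr_real.
Qed.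

(** * The Hilbert space of a positive semidefinite kernel *)

Section KernelSpace.
Variables (R : realType) (I : Type).
Local Notation C := (cplx R).
Implicit Types (l m : seq (C * I)).

(* The completion of the finite combinations of I under the form k, realized
   by the functions on I which represent limits of such combinations; thus no
   quotient is needed. *)
Variable k : I -> I -> C.
Hypothesis k_psd : psd k.
Implicit Types f g : I -> C.

(** The value f i stands for the inner product of the i-th generator with the vector represented by
    f, so [fe f m] is the inner product of the combination [m] with that vector. *)
Definition fe f m : C := \sum_(p <- m) p.1^* * f p.2.

Lemma fe_cat f l m : fe f (l ++ m) = fe f l + fe f m.
Proof. by rewrite /fe big_cat. Qed.

Lemma fe_scl f c m : fe f (scl c m) = c^* * fe f m.
Proof.
rewrite /fe big_map mulr_sumr; apply: eq_bigr => p _ /=.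
by rewrite rmorphM mulrA.
Qed.

Lemma fe_linear c f g m : fe (c *: f + g) m = c * fe f m + fe g m.
Proof.
rewrite /fe mulr_sumr -big_split /=; apply: eq_bigr => p _.
by rewrite mulrDr mulrCA.
Qed.

(** The vector represented by f is within distance sqrt e of the combination [l], expressed by
    duality against all combinations. *)
Definition appr f l (e : C) := forall m, `|fe f m - kform k m l| ^+ 2 <= e * kform k m m.

(* The dummy dependency on k_psd lets the structures on khs below be inferred. *)
Definition approximable : {pred I -> C} := let _ := k_psd in
  fun f => `[< forall e : C, 0 < e -> exists l, appr f l e >].

Lemma appr_linear c f g l m (e e' : C) : appr f l e -> appr g m e' ->
  appr (c *: f + g) (scl c l ++ m) ((`|c| ^+ 2 * e + e') *+ 2).
Proof.
move=> fl gm n; rewrite fe_linear kform_catr kform_sclr.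
rewrite (_ : _ - _ = c * (fe f n - kform k n l) + (fe g n - kform k n m)); last by ring.
rewrite (le_trans (norm2D _ _))// mulrnAl lerMn2r /= normrM exprMn.
by rewrite mulrDl lerD// -[leRHS]mulrA ler_wpM2l// exprn_ge0.
Qed.

Lemma appr_le f l (e e' : C) : e <= e' -> appr f l e -> appr f l e'.
Proof.
move=> ee fl m; apply: le_trans (fl m) _.
by rewrite ler_wpM2r//; case: k_psd => _; apply.
Qed.

Lemma approximable_submod : submod_closed approximable.
Proof.
split=> [|c f g /asboolP hf /asboolP hg].
  apply/asboolP => e e0; exists [::] => m.
  rewrite (_ : fe 0 m = 0); last by apply: big1 => p _; rewrite mulr0.
  rewrite (_ : kform k m [::] = 0).
    rewrite subrr normr0 expr0n /= mulr_ge0 ?(ltW e0)//.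
    by case: k_psd => _; apply.
  by apply: big1 => p _; exact: big_nil.
apply/asboolP => e e0.
have c0 : 0 < `|c| ^+ 2 + 1 :> C by rewrite ltr_wpDl ?exprn_ge0.
have e4 : 0 < e / 4 by rewrite divr_gt0.
have [l hl] := hf _ (divr_gt0 e4 c0); have [m hm] := hg _ e4.
exists (scl c l ++ m); apply: appr_le (appr_linear c hl hm).
rewrite (@le_trans _ _ ((e / 4 + e / 4) *+ 2))//.
  rewrite lerMn2r /= lerD2r mulrC -mulrA ler_piMr ?ltW//.
  by rewrite mulrC ltr_pdivrMr// mul1r ltrDl.
by rewrite (_ : _ *+ 2 = e) //; field.
Qed.


HB.instance Definition _ :=
  GRing.isSubmodClosed.Build C (I -> C) approximable approximable_submod.

Record khs := Khs { khs_val : I -> C; _ : khs_val \in approximable }.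
HB.instance Definition _ := [isSub for khs_val].
HB.instance Definition _ := [Choice of khs by <:].
HB.instance Definition _ := [SubChoice_isSubLmodule of khs by <:].

Implicit Types u v w : khs.

Lemma khs_linear c u v m :
  fe (khs_val (c *: u + v)) m = c * fe (khs_val u) m + fe (khs_val v) m.
Proof. by rewrite -fe_linear. Qed.

Lemma khs_apprP u n : exists l, appr (khs_val u) l (n.+1%:R^-1).
Proof. by case: u => f /= /asboolP; apply; rewrite invr_gt0 ltr0n. Qed.

Definition ap u n := sval (cid (khs_apprP u n)).

Lemma apP u n m :
  `|fe (khs_val u) m - kform k m (ap u n)| ^+ 2 <= n.+1%:R^-1 * kform k m m.
Proof. by rewrite /ap; case: cid. Qed.

Lemma kform_ge0 m : 0 <= kform k m m.
Proof. by case: k_psd => _; apply. Qed.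

Lemma fe_apE u m : (fun n => kform k m (ap u n)) @ \oo --> fe (khs_val u) m.
Proof.
apply/cvgn_le0P => e e0.
have [N hN] : exists N : nat, N.+1%:R^-1 * kform k m m < e ^+ 2.
  have c0 : 0 < kform k m m + 1 by rewrite ltr_wpDl ?kform_ge0.
  have [|N hN] := @cplx_archi R (e ^+ 2 / (kform k m m + 1)).
    by rewrite divr_gt0 ?exprn_gt0.
  exists N; move: hN; rewrite ltr_pdivlMr//; apply: le_lt_trans.
  by rewrite ler_wpM2l ?invr_ge0 ?ler0n// lerDl ler01.
exists N => n Nn; rewrite distrC -(@ler_pXn2r _ 2)// ?nnegrE ?(ltW e0)//.
apply: le_trans (apP u n m) _; apply: le_trans (ltW hN).
by rewrite ler_wpM2r ?kform_ge0// lef_pV2 ?posrE ?ltr0n// ler_nat.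
Qed.

(** Comparison with the approximation of index 0 bounds the functional [fe], with constant [M1];
    testing this functional on [ap u n] itself then bounds the norm of [ap u n]. *)
Lemma ap_bounded u : exists2 M : C, 0 <= M & forall n, kform k (ap u n) (ap u n) <= M.
Proof.
pose l0 := ap u 0; pose M1 := (kform k l0 l0 + 1) *+ 2; pose M := (M1 + 1) *+ 2.
have M10 : 0 <= M1 by rewrite mulrn_wge0// addr_ge0 ?kform_ge0.
have M0 : 0 <= M by rewrite mulrn_wge0// addr_ge0.
exists M => // n; set m := ap u n; have [->//|m0] := eqVneq (kform k m m) 0.
have mp : 0 < kform k m m by rewrite lt_def m0 kform_ge0.
have h1 : `|fe (khs_val u) m| ^+ 2 <= M1 * kform k m m.
  rewrite -[fe _ _](subrK (kform k m l0)) (le_trans (norm2D _ _))//.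
  rewrite mulrnAl lerMn2r /= addrC mulrDl lerD ?[_ l0 l0 * _]mulrC ?kform_cs//.
  by have := apP u 0 m; rewrite invr1.
have h2 : `|kform k m m| ^+ 2 <= M * kform k m m.
  rewrite -[X in `|X|](subKr (fe (khs_val u) m)) (le_trans (norm2D _ _))//.
  rewrite mulrnAl lerMn2r /= normrN mulrDl lerD// (le_trans (apP u n m))//.
  by rewrite ler_wpM2r ?kform_ge0// invf_le1 ?ltr0n// ler1n.
by move: h2; rewrite ger0_norm ?kform_ge0// expr2 ler_pM2r.
Qed.

Lemma fe_bounded u : exists2 M : C, 0 <= M &
  forall m, `|fe (khs_val u) m| ^+ 2 <= M * kform k m m.
Proof.
have [M M0 hM] := ap_bounded u; exists M => // m.
have h1 : (fun n => `|kform k m (ap u n)| ^+ 2) @ \oo --> `|fe (khs_val u) m| ^+ 2.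
  by rewrite [_ ^+ _]expr2; under eq_fun do rewrite expr2;
    apply: cvgM; apply: cvg_norm; exact: fe_apE.
apply: (le_limit _ h1 (cvg_cst _)) => n /=; rewrite (le_trans (kform_cs _ _ k_psd))//.
by rewrite mulrC ler_wpM2r ?kform_ge0.
Qed.

Definition lsub l m : seq (C * I) := l ++ scl (-1) m.

Lemma fe_lsub f l m : fe f (lsub l m) = fe f l - fe f m.
Proof. by rewrite fe_cat fe_scl rmorphN1 mulN1r. Qed.

(** Both approximations are tested on the difference d of the two combinations, which gives |d|^4 <=
    2 (e + e') |d|^2. *)
Lemma appr_close f l m (e e' : C) : appr f l e -> appr f m e' -> 0 <= e -> 0 <= e' ->
  kform k (lsub l m) (lsub l m) <= (e + e') *+ 2.
Proof.
move=> fl fm e0 e'0; set d := lsub l m.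
have [->|d0] := eqVneq (kform k d d) 0; first by rewrite mulrn_wge0 ?addr_ge0.
have dp : 0 < kform k d d by rewrite lt_def d0 kform_ge0.
rewrite -(ler_pM2r dp) -expr2 -[X in X ^+ 2]ger0_norm ?kform_ge0//.
rewrite [X in `|X|](_ : _ =
  - (fe f d - kform k d l) + (fe f d - kform k d m)); last first.
  by rewrite {2}/d /lsub kform_catr kform_sclr; ring.
rewrite (le_trans (norm2D _ _))// mulrnAl lerMn2r /= normrN mulrDl lerD//.
Qed.

Lemma small_inv (c e : C) : 0 <= c -> 0 < e ->
  exists N, forall n, (N <= n)%N -> c * n.+1%:R^-1 <= e.
Proof.
move=> c0 e0; have c1 : 0 < c + 1 by rewrite ltr_wpDl.
have [|N hN] := @cplx_archi R (e / (c + 1)); first by rewrite divr_gt0.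
exists N => n Nn; rewrite ltr_pdivlMr// in hN; rewrite mulrC.
rewrite (le_trans _ (ltW hN))// ler_pM ?invr_ge0 ?ler0n ?lerDl ?ler01//.
by rewrite lef_pV2 ?posrE ?ltr0n// ler_nat.
Qed.

Lemma ap_appr u n : appr (khs_val u) (ap u n) n.+1%:R^-1.
Proof. exact: apP. Qed.

Lemma ip_cvg_ex u v : exists z : C, (fun n => fe (khs_val v) (ap u n)) @ \oo --> z.
Proof.
apply: cplx_cauchy_cvg => e e0; have [M M0 hM] := fe_bounded v.
have [N hN] := small_inv (mulrn_wge0 2 (mulrn_wge0 2 M0)) (exprn_gt0 2 e0).
exists N => m n Nm Nn; rewrite -fe_lsub -(@ler_pXn2r _ 2)// ?nnegrE ?(ltW e0)//.
apply: le_trans (hM _) _; apply: le_trans (hN N (leqnn N)).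
rewrite !mulrnAl -!mulrnAr ler_wpM2l//.
have i0 p : 0 <= p.+1%:R^-1 :> C by rewrite invr_ge0 ler0n.
apply: le_trans (appr_close (ap_appr u m) (ap_appr u n) (i0 _) (i0 _)) _.
by rewrite lerMn2r /= mulr2n lerD// lef_pV2 ?posrE ?ltr0n// ler_nat.
Qed.

Definition khs_ip u v : C := sval (cid (ip_cvg_ex u v)).

Lemma khs_ipP u v : (fun n => fe (khs_val v) (ap u n)) @ \oo --> khs_ip u v.
Proof. by rewrite /khs_ip; case: cid. Qed.

Lemma cvg_sq_rate (x : nat -> C) z (b : nat -> C) :
  (forall n, `|x n - z| ^+ 2 <= b n) -> b @ \oo --> 0 -> x @ \oo --> z.
Proof.
move=> xb /cvgn_le0P b0; apply/cvgn_le0P => e e0.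
have [N hN] := b0 _ (exprn_gt0 2 e0); exists N => n /hN.
rewrite subr0 ger0_norm ?(le_trans _ (xb n)) ?exprn_ge0// => h.
by rewrite -(@ler_pXn2r _ 2)// ?nnegrE ?(ltW e0)// (le_trans (xb n)).
Qed.

(** The symmetric form of the limit defining [khs_ip]: hermitian symmetry and positivity are
    inherited from [k] through it. *)
Lemma khs_ip_kform u v : (fun n => kform k (ap u n) (ap v n)) @ \oo --> khs_ip u v.
Proof.
have [M M0 hM] := ap_bounded u.
have h0 : (fun n => kform k (ap u n) (ap v n) - fe (khs_val v) (ap u n)) @ \oo --> 0.
  apply: (@cvg_sq_rate _ _ (fun n => n.+1%:R^-1 * M)).
    move=> n; rewrite subr0 distrC (le_trans (apP v n _))//.
    by rewrite ler_wpM2l ?invr_ge0 ?ler0n.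
  by rewrite -[0](mul0r M); apply: cvgM; [exact: cvg_invS|exact: cvg_cst].
rewrite (_ : (fun n => _) = (fun n => (kform k (ap u n) (ap v n)
    - fe (khs_val v) (ap u n)) + fe (khs_val v) (ap u n))).
  by rewrite -[khs_ip _ _]add0r; apply: cvgD => //; exact: khs_ipP.
by apply/funext => n; rewrite subrK.
Qed.

Lemma khs_ip_linear u c v w : khs_ip u (c *: v + w) = c * khs_ip u v + khs_ip u w.
Proof.
apply: (clim_unique (@khs_ipP u (c *: v + w))).
under eq_fun do rewrite khs_linear.
by apply: cvgD; [apply: cvgM; [exact: cvg_cst|exact: khs_ipP]|exact: khs_ipP].
Qed.

Lemma cvg_conj (x : nat -> C) z : x @ \oo --> z -> (fun n => (x n)^*) @ \oo --> z^*.
Proof.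
move=> /cvgn_le0P h; apply/cvgn_le0P => e /h [N hN]; exists N => n /hN.
by rewrite -rmorphB norm_conjC.
Qed.

Lemma khs_ip_conj u v : (khs_ip u v)^* = khs_ip v u.
Proof.
apply: (clim_unique (cvg_conj (@khs_ip_kform u v))).
under eq_fun do rewrite (kform_conj _ _ (proj1 k_psd)).
exact: khs_ip_kform.
Qed.

Lemma khs_ip_ge0 u : 0 <= khs_ip u u.
Proof. by apply: ge0_limit (@khs_ip_kform u u) => n; exact: kform_ge0. Qed.

Lemma fe_bound u m : `|fe (khs_val u) m| ^+ 2 <= khs_ip u u * kform k m m.
Proof.
have h1 : (fun n => `|kform k m (ap u n)| ^+ 2) @ \oo --> `|fe (khs_val u) m| ^+ 2.
  by rewrite [_ ^+ _]expr2; under eq_fun do rewrite expr2;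
    apply: cvgM; apply: cvg_norm; exact: fe_apE.
have h2 : (fun n => kform k (ap u n) (ap u n) * kform k m m) @ \oo -->
    khs_ip u u * kform k m m.
  by apply: cvgM; [exact: khs_ip_kform|exact: cvg_cst].
by apply: (le_limit _ h1 h2) => n /=; rewrite mulrC kform_cs.
Qed.

(** Testing on [ap u n] and passing to the limit. With [fe_bound] it identifies the norm with that
    of the functional [fe], so norm convergence follows from estimates on combinations. *)
Lemma fe_le u (c : C) : 0 <= c ->
  (forall m, `|fe (khs_val u) m| ^+ 2 <= c * kform k m m) -> khs_ip u u <= c.
Proof.
move=> c0 h; have h1 : (fun n => `|fe (khs_val u) (ap u n)| ^+ 2) @ \oo -->
    `|khs_ip u u| ^+ 2.
  by rewrite [_ ^+ _]expr2; under eq_fun do rewrite expr2;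
    apply: cvgM; apply: cvg_norm; exact: khs_ipP.
have h2 : (fun n => c * kform k (ap u n) (ap u n)) @ \oo --> c * khs_ip u u.
  by apply: cvgM; [exact: cvg_cst|exact: khs_ip_kform].
have := le_limit (fun n => h _) h1 h2; rewrite ger0_norm ?khs_ip_ge0//.
have [->//|u0] := eqVneq (khs_ip u u) 0.
by rewrite expr2 ler_pM2r// lt_def u0 khs_ip_ge0.
Qed.

Lemma fe1 f i : fe f [:: (1, i)] = f i.
Proof. by rewrite /fe big_seq1 /= rmorph1 mul1r. Qed.

Lemma khs_ip_eq0 u : khs_ip u u = 0 -> u = 0.
Proof.
move=> u0; apply: val_inj; apply/funext => i; rewrite -fe1.
have := fe_bound u [:: (1, i)]; rewrite u0 mul0r => h.
by apply/eqP; rewrite -normr_eq0 -sqrf_eq0 eq_le h exprn_ge0.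
Qed.

Lemma khs_ipDr u v w : khs_ip u (v + w) = khs_ip u v + khs_ip u w.
Proof. by rewrite -[v]scale1r khs_ip_linear mul1r scale1r. Qed.

Lemma khs_ip0r u : khs_ip u 0 = 0.
Proof. by apply: (addrI (khs_ip u 0)); rewrite -khs_ipDr !addr0. Qed.

Lemma khs_ipZr u c v : khs_ip u (c *: v) = c * khs_ip u v.
Proof. by rewrite -[_ *: _]addr0 khs_ip_linear khs_ip0r addr0. Qed.

Lemma khs_ipDl u v w : khs_ip (u + v) w = khs_ip u w + khs_ip v w.
Proof. by rewrite -khs_ip_conj khs_ipDr rmorphD /= !khs_ip_conj. Qed.

Lemma khs_ipZl u c v : khs_ip (c *: v) u = c^* * khs_ip v u.
Proof. by rewrite -khs_ip_conj khs_ipZr rmorphM /= !khs_ip_conj. Qed.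

Lemma khs_cs u v : `|khs_ip u v| ^+ 2 <= khs_ip u u * khs_ip v v.
Proof.
apply: quadratic_ineq; rewrite ?khs_ip_ge0// => c.
have := khs_ip_ge0 (u + c *: v).
rewrite !khs_ipDl !khs_ipDr !khs_ipZl !khs_ipZr rmorphM /= khs_ip_conj => h.
by apply: le_trans h _; rewrite normCK le_eqVlt; apply/orP; left; apply/eqP; ring.
Qed.

Definition khs_norm u : C := sqrtC (khs_ip u u).

Lemma khs_norm_sq u : khs_norm u ^+ 2 = khs_ip u u.
Proof. exact: sqrtCK. Qed.

Lemma khs_norm_ge0 u : 0 <= khs_norm u.
Proof. by rewrite sqrtC_ge0 khs_ip_ge0. Qed.

Lemma khs_normD u v : khs_norm (u + v) <= khs_norm u + khs_norm v.
Proof.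
rewrite -(@ler_pXn2r _ 2)// ?nnegrE ?addr_ge0 ?khs_norm_ge0//.
rewrite sqrrD !khs_norm_sq khs_ipDl !khs_ipDr addrA lerD2r -addrA lerD2l.
have h : `|khs_ip u v| <= khs_norm u * khs_norm v.
  rewrite -(@ler_pXn2r _ 2)// ?nnegrE ?mulr_ge0 ?khs_norm_ge0//.
  by rewrite exprMn !khs_norm_sq khs_cs.
rewrite -(khs_ip_conj u v) (@le_trans _ _ (`|khs_ip u v| *+ 2))//; last by rewrite lerMn2r.
rewrite mulr2n -{2}(norm_conjC (khs_ip u v)); apply: le_trans _ (ler_normD _ _).
by rewrite real_ler_norm// CrealE rmorphD /= conjCK addrC.
Qed.

Lemma khs_normZ c u : khs_norm (c *: u) = `|c| * khs_norm u.
Proof.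
apply/eqP; rewrite -(@eqrXn2 _ 2)// ?mulr_ge0 ?khs_norm_ge0//.
by rewrite exprMn !khs_norm_sq khs_ipZl khs_ipZr mulrA -normCKC.
Qed.

Lemma khs_norm_eq0 u : khs_norm u = 0 -> u = 0.
Proof. by move=> u0; apply: khs_ip_eq0; rewrite -khs_norm_sq u0 expr0n. Qed.

HB.instance Definition _ :=
  Lmodule_isNormed.Build C khs khs_normD khs_normZ khs_norm_eq0.

Lemma khs_normE u : `|u| ^+ 2 = khs_ip u u.
Proof. exact: khs_norm_sq. Qed.

Lemma khs_complete (F : set_system khs) : ProperFilter F -> cauchy F -> cvg F.
Proof.
apply: seq_complete => u hu.
have feB (v w : khs) m : fe (khs_val (v - w)) m = fe (khs_val v) m - fe (khs_val w) m.
  by rewrite -[v - w]addrC -scaleN1r khs_linear mulN1r addrC.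
have pc m : exists z : C, (fun n => fe (khs_val (u n)) m) @ \oo --> z.
  apply: cplx_cauchy_cvg => e e0.
  have k1 : 0 < kform k m m + 1 by rewrite ltr_wpDl ?kform_ge0.
  have s0 : 0 < sqrtC (kform k m m + 1) by rewrite sqrtC_gt0.
  have [N hN] := hu _ (divr_gt0 e0 s0); exists N => p q Np Nq.
  rewrite -feB -(@ler_pXn2r _ 2)// ?nnegrE ?(ltW e0)//.
  apply: le_trans (fe_bound _ _) _; rewrite -khs_normE.
  have := hN _ _ Np Nq; rewrite -(@ler_pXn2r _ 2)// ?nnegrE ?divr_ge0 ?(ltW e0) ?(ltW s0)//.
  rewrite expr_div_n (sqrtCK (kform k m m + 1)) ler_pdivlMr// => /(le_trans _); apply.
  by rewrite ler_wpM2l ?exprn_ge0// lerDl ler01.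
pose f i := sval (cid (pc [:: (1, i)])).
have fP m : (fun n => fe (khs_val (u n)) m) @ \oo --> fe f m.
  elim: m => [|[c i] m IH].
    rewrite (_ : (fun n => _) = fun=> fe f [::]); first exact: cvg_cst.
    by apply/funext => n; rewrite /fe !big_nil.
  rewrite (_ : fe f _ = c^* * f i + fe f m); last by rewrite /fe big_cons.
  rewrite (_ : (fun n => _) = fun n => c^* * fe (khs_val (u n)) [:: (1, i)]
     + fe (khs_val (u n)) m).
    apply: cvgD => //; apply: cvgM; first exact: cvg_cst.
    by rewrite /f; case: cid.
  by apply/funext => n; rewrite /fe big_cons big_seq1 /= rmorph1 mul1r.
(* Letting p tend to infinity in the Cauchy estimate turns pointwise convergence into a bound
   uniform in m, which yields both approximability of the limit and convergence in norm. *)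
have fu (e : C) : 0 < e -> exists N, forall n m, (N <= n)%N ->
    `|fe f m - fe (khs_val (u n)) m| ^+ 2 <= e * kform k m m.
  move=> e0; have [|N hN] := hu (sqrtC e); first by rewrite sqrtC_gt0.
  exists N => n m Nn.
  have h1 : (fun p => `|fe (khs_val (u (p + N)%N)) m - fe (khs_val (u n)) m| ^+ 2)
      @ \oo --> `|fe f m - fe (khs_val (u n)) m| ^+ 2.
    have h2 : (fun p => fe (khs_val (u (p + N)%N)) m) @ \oo --> fe f m.
      by rewrite (cvg_shiftn N (fun p => fe (khs_val (u p)) m)).
    by rewrite [_ ^+ _]expr2; under eq_fun do rewrite expr2;
      apply: cvgM; apply: cvg_norm; apply: cvgB => //; exact: cvg_cst.
  apply: (le_limit _ h1 (cvg_cst _)) => p /=; rewrite -feB.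
  apply: le_trans (fe_bound _ _) _; rewrite ler_wpM2r ?kform_ge0// -khs_normE.
  rewrite -[leRHS]sqrtCK lerXn2r ?nnegrE ?normr_ge0 ?sqrtC_ge0 ?(ltW e0)//.
  by apply: hN => //; rewrite leq_addl.
have fA : f \in approximable.
  apply/asboolP => e e0; have e4 : 0 < e / 4 by rewrite divr_gt0.
  have [N hN] := fu _ e4.
  have [l hl] : exists l, appr (khs_val (u N)) l (e / 4).
    by case: (u N) => g /= /asboolP; apply.
  exists l => m; rewrite -[fe f m](subrK (fe (khs_val (u N)) m)) -addrA.
  rewrite (le_trans (norm2D _ _))// (@le_trans _ _ ((e / 4 * kform k m m *+ 2) *+ 2))//.
    by rewrite lerMn2r /= mulr2n lerD// hN.
  by rewrite le_eqVlt; apply/orP; left; apply/eqP; field.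
exists (Khs fA); apply/cvgn_le0P => e e0.
have [N hN] := fu _ (exprn_gt0 2 e0); exists N => n Nn.
rewrite -(@ler_pXn2r _ 2)// ?nnegrE ?(ltW e0)// khs_normE.
by apply: fe_le; rewrite ?exprn_ge0 ?(ltW e0)// => m; rewrite feB distrC hN.
Qed.

HB.instance Definition _ := Uniform_isComplete.Build khs khs_complete.

HB.instance Definition _ := isHilbert.Build R khs khs_ip_linear khs_ip_conj
  (fun u => esym (khs_normE u)).

Lemma section_approximable j : (fun i => k i j) \in approximable.
Proof.
apply/asboolP => e e0; exists [:: (1, j)] => m.
rewrite [X in `|X|](_ : _ = 0) ?normr0 ?expr0n /= ?mulr_ge0 ?kform_ge0 ?ltW//.
apply/eqP; rewrite subr_eq0; apply/eqP; apply: eq_bigr => p _.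
by rewrite big_seq1 mulr1.
Qed.

Definition khs_sec j : khs := Khs (section_approximable j).

Lemma khs_reproduce j u : hip (khs_sec j) u = khs_val u j.
Proof.
have [M M0 hM] := fe_bounded u.
apply: (clim_unique (@khs_ipP (khs_sec j) u)).
apply: (@cvg_sq_rate _ _ (fun n => (M *+ 2) * n.+1%:R^-1)); last first.
  by rewrite -[0](mulr0 (M *+ 2)); apply: cvgM; [exact: cvg_cst|exact: cvg_invS].
move=> n; rewrite -[khs_val u j]fe1 -fe_lsub (le_trans (hM _))//.
rewrite mulrnAl -mulrnAr ler_wpM2l// -[X in X *+ 2]addr0.
apply: (appr_close (f := khs_val (khs_sec j))) => //; rewrite ?invr_ge0 ?ler0n//.
  exact: ap_appr.
move=> m; rewrite [X in `|X|](_ : _ = 0) ?normr0 ?expr0n /= ?mul0r//.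
apply/eqP; rewrite subr_eq0; apply/eqP; apply: eq_bigr => p _.
by rewrite big_seq1 mulr1.
Qed.

End KernelSpace.

(** Density is stated through the orthogonal complement, a form that passes easily through adjoints;
    [total_dense] recovers approximating sequences. *)
Definition total_family (R : realType) (H : hilbertType R) I (t : I -> H) :=
  forall v, (forall i, hip v (t i) = 0) -> v = 0.

(** The Kolmogorov construction. Tensor products, amplifications, GNS spaces, direct sums and the
    space U are all instances of it. *)
Lemma kernel_space (R : realType) I (k : I -> I -> cplx R) : psd k ->
  exists (G : hilbertType R) (t : I -> G),
    (forall i j, hip (t i) (t j) = k i j) /\ total_family t.
Proof.
move=> pk; exists (khs pk : hilbertType R), (khs_sec pk).
split=> [i j|v h]; first by rewrite khs_reproduce.
have e u i : khs_val u i = hip (khs_sec pk i) u by rewrite khs_reproduce.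
apply: val_inj; apply/funext => i.
by rewrite [LHS]e [RHS]e hip0r -hip_conj h rmorph0.
Qed.

Lemma closure_seqP (R : realType) (E : normedModType (cplx R)) (A : set E) x :
  closure A x <-> exists2 u : nat -> E, (forall n, A (u n)) & u @ \oo --> x.
Proof.
split=> [Ax|[u Au ux] B xB].
  have /choice [u hu] n : exists y : E, A y /\ `|y - x| <= n.+1%:R^-1.
    have [|y [Ay By]] := Ax (ball x (n.+1%:R^-1 : cplx R)).
      by apply: nbhsx_ballx; rewrite invr_gt0 ltr0n.
    exists y; split=> //; move: By; rewrite -ball_normE /= distrC; exact: ltW.
  exists u => [n|]; first by case: (hu n).
  by apply: (cvg_rate (b := fun n => n.+1%:R^-1)) (@cvg_invS R) => n; case: (hu n).
have [N _ hN] := ux B xB.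
by exists (u N); split; [exact: Au|apply: hN => /=].
Qed.

(** * Riesz representation, adjoints and extension of operators *)

Section Riesz.
Variables (R : realType).
Local Notation C := (cplx R).

(** Approximate representing combinations for the Gram kernel form a Cauchy sequence. The last
    clause places the representing vector in the closed span of the family, so that it is orthogonal
    to whatever the family is orthogonal to. *)
Lemma family_riesz (H : hilbertType R) I (t : I -> H) (phi : I -> C) (M : C) :
  0 <= M -> (forall l, `|ev phi l| ^+ 2 <= M * `|lc t l| ^+ 2) ->
  exists g, [/\ forall i, hip g (t i) = phi i, `|g| ^+ 2 <= M &
    exists l, (fun n : nat => lc t (l n)) @ \oo --> g].
Proof.
move=> M0 hphi; have pk := psd_gram t; set k := fun i j => _ in pk.
have kE l m : kform k l m = hip (lc t l) (lc t m) by rewrite hip_lc.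
have i0 n : 0 < n.+1%:R^-1 :> C by rewrite invr_gt0 ltr0n.
have /choice [l hl] n : exists l, forall m,
    `|ev phi m - hip (lc t l) (lc t m)| ^+ 2 <= n.+1%:R^-1 * `|lc t m| ^+ 2.
  have [|l hl] := approx_riesz pk M0 (i0 n) (f := phi).
    by move=> m; rewrite kE hip_norm.
  by exists l => m; have := hl m; rewrite !kE hip_norm.
pose u n := lc t (l n).
have [g ug] : exists g : H, u @ \oo --> g.
  apply: cauchyseq_cvg => e e0.
  have [N hN] := small_inv (mulrn_wge0 2 (mulrn_wge0 2 (@ler01 C))) (exprn_gt0 2 e0).
  exists N => m n Nm Nn; rewrite -(@ler_pXn2r _ 2)// ?nnegrE ?(ltW e0)//.
  apply: le_trans (hN N (leqnn N)).
  have -> : u m - u n = lc t (lsub (l m) (l n)).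
    by rewrite lc_cat lc_scl scaleN1r.
  set d := lsub _ _; have [->|d0] := eqVneq (`|lc t d| ^+ 2) 0.
    by rewrite mulr_ge0 ?mulrn_wge0 ?ler01// ltW.
  have dp : 0 < `|lc t d| ^+ 2 by rewrite lt_def d0 exprn_ge0.
  rewrite -(ler_pM2r dp) -expr2 -{1}hip_norm -[X in X ^+ 2]ger0_norm ?hip_ge0//.
  rewrite [X in `|X|](_ : _ = - (ev phi d - hip (lc t (l m)) (lc t d))
      + (ev phi d - hip (lc t (l n)) (lc t d))); last first.
    rewrite {1}(_ : lc t d = u m - u n); first by rewrite hipBl; ring.
    by rewrite lc_cat lc_scl scaleN1r.
  rewrite (le_trans (norm2D _ _))// normrN.
  rewrite (@le_trans _ _ ((N.+1%:R^-1 * `|lc t d| ^+ 2 *+ 2) *+ 2))//.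
    rewrite lerMn2r /= mulr2n lerD// (le_trans (hl _ _))// ler_wpM2r ?exprn_ge0//;
    by rewrite lef_pV2 ?posrE ?ltr0n// ler_nat.
  by rewrite !mulrnAl mul1r.
have gphi i : hip g (t i) = phi i.
  apply: (@clim_unique _ (fun n => hip (u n) (t i))).
    by apply: cvg_hip => //; exact: cvg_cst.
  apply: (@cvg_sq_rate _ _ _ (fun n => n.+1%:R^-1 * `|t i| ^+ 2)).
    move=> n; have := hl n [:: (1, i)].
    by rewrite ev1 lc1 mul1r scale1r distrC.
  by rewrite -[0](mul0r (`|t i| ^+ 2)); apply: cvgM; [exact: cvg_invS|exact: cvg_cst].
exists g; split=> //; last by exists l.
have gl m : hip g (lc t m) = ev phi m.
  by rewrite hip_lcr; apply: eq_bigr => p _; rewrite gphi.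
have nu : (fun n => `|u n| ^+ 2) @ \oo --> `|g| ^+ 2.
  by rewrite [_ ^+ _]expr2; under eq_fun do rewrite expr2;
    apply: cvgM; exact: cvg_norm.
have h0 : (fun n => hip g (u n)) @ \oo --> hip g g.
  by apply: cvg_hip => //; exact: cvg_cst.
have h1 : (fun n => `|hip g (u n)| ^+ 2) @ \oo --> `|hip g g| ^+ 2.
  by rewrite [_ ^+ _]expr2; under eq_fun do rewrite expr2; apply: cvgM; exact: cvg_norm.
have h2 : (fun n => M * `|u n| ^+ 2) @ \oo --> M * `|g| ^+ 2.
  by apply: cvgM => //; exact: cvg_cst.
have h4 : `|g| ^+ 2 * `|g| ^+ 2 <= M * `|g| ^+ 2.
  have := le_limit _ h1 h2; rewrite hip_norm normrX normr_id expr2; apply.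
  by move=> n; rewrite gl.
have [->//|g0] := eqVneq (`|g| ^+ 2) 0.
by move: h4; rewrite ler_pM2r// lt_def g0 exprn_ge0.
Qed.

(** The vector of the closed span that represents <x, .> there is the orthogonal projection of x;
    the difference is orthogonal to B, hence zero. *)
Lemma total_closure (H : hilbertType R) (B : set H) :
  closure (lspan B) = setT <->
  forall v, (forall b, B b -> hip v b = 0) -> v = 0.
Proof.
have BE : range (fun b : {x | B x} => sval b) = B.
  by apply/seteqP; split=> [x [[y By] _ <-]//|x Bx]; exists (exist _ x Bx).
rewrite -{1}BE lspanE; split=> [h v vB|h].
  have : closure (range (lc (fun b : {x | B x} => sval b))) v by rewrite h.
  move=> /closure_seqP [u hu uv]; apply: hip_eq0.
  apply: (@clim_unique _ (fun n => hip v (u n))).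
    by apply: cvg_hip => //; exact: cvg_cst.
  rewrite (_ : (fun n => _) = fun=> 0); first exact: cvg_cst.
  apply/funext => n; have [l _ <-] := hu n.
  rewrite hip_lcr; apply: big1 => -[c [b Bb]] _ /=.
  by rewrite vB// mulr0.
apply/seteqP; split=> // x _; apply/closure_seqP.
have [|l|g [hg _ [l lg]]] := @family_riesz H _ (fun b : {x | B x} => sval b)
    (fun b => hip x (sval b)) (`|x| ^+ 2).
- by rewrite exprn_ge0.
- by rewrite -hip_lcr -exprMn lerXn2r ?nnegrE ?mulr_ge0// hip_cs.
exists (fun n => lc (fun b : {x | B x} => sval b) (l n)) => [n|]; first by exists (l n).
rewrite (_ : x = g)//; apply/esym/eqP; rewrite -subr_eq0; apply/eqP/h => b Bb.
by rewrite hipBl (hg (exist _ b Bb)) subrr.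
Qed.

Lemma riesz (H : hilbertType R) (f : H -> C) (M : C) : 0 <= M ->
  (forall c x y, f (c *: x + y) = c * f x + f y) ->
  (forall x, `|f x| <= M * `|x|) -> exists g, forall x, f x = hip g x.
Proof.
move=> M0 fl fM.
have f0 : f 0 = 0 by apply: (addrI (f 0)); rewrite -{1}(mul1r (f 0)) -fl scale1r !addr0.
have fE l : ev f l = f (lc id l).
  elim: l => [|[c x] l IH]; first by rewrite /ev /lc !big_nil.
  by rewrite /ev /lc !big_cons /= fl; congr (_ + _).
have [|l|g [hg _ _]] := @family_riesz H H id f (M ^+ 2).
- by rewrite exprn_ge0.
- by rewrite fE -exprMn lerXn2r ?nnegrE ?mulr_ge0.
by exists g => x; rewrite -hg.
Qed.

Lemma adjoint_ex (H K : hilbertType R) (f : bop H K) : exists g, adjoint f g.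
Proof.
have [M M0 fM] := bop_bounded f.
have /choice [g hg] y : exists g : H, forall x, hip y (f x) = hip g x.
  apply: (@riesz _ _ (`|y| * M)) => [|c x z|x]; first by rewrite mulr_ge0.
    by rewrite linearP hipDr hipZr.
  by rewrite (le_trans (hip_cs _ _))// -mulrA ler_wpM2l.
have [||g' hg'] := @bopP R K H g M.
- move=> c x y; apply: hip_injl => z.
  by rewrite -hg hipDl !hipZl hipDl hipZl -!hg.
- move=> y; have [->|g0] := eqVneq (g y) 0; first by rewrite normr0 mulr_ge0.
  have gp : 0 < `|g y| by rewrite normr_gt0.
  rewrite -(ler_pM2r gp) -expr2 -hip_norm -hg -[leLHS]ger0_norm; last first.
    by rewrite hg hip_ge0.
  by rewrite (le_trans (hip_cs _ _))// mulrAC mulrC ler_wpM2r// mulrC.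
by exists g' => x y; rewrite hg' -hip_conj hg hip_conj.
Qed.

Definition adj (H K : hilbertType R) (f : bop H K) : bop K H := sval (cid (adjoint_ex f)).

Lemma adjP (H K : hilbertType R) (f : bop H K) : adjoint f (adj f).
Proof. by rewrite /adj; case: cid. Qed.

Lemma adjE (H K : hilbertType R) (f : bop H K) x y : hip (f x) y = hip x (adj f y).
Proof. exact: adjP. Qed.

Lemma adjEr (H K : hilbertType R) (f : bop H K) x y : hip y (f x) = hip (adj f y) x.
Proof. by rewrite -hip_conj adjE hip_conj. Qed.

Lemma adj_norm (H K : hilbertType R) (f : bop H K) (M : C) : 0 <= M ->
  (forall x, `|f x| <= M * `|x|) -> forall y, `|adj f y| <= M * `|y|.
Proof.
move=> M0 fM y; have [->|g0] := eqVneq (adj f y) 0; first by rewrite normr0 mulr_ge0.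
have gp : 0 < `|adj f y| by rewrite normr_gt0.
rewrite -(ler_pM2r gp) -expr2 -hip_norm -adjEr -[leLHS]ger0_norm; last first.
  by rewrite adjEr hip_ge0.
by rewrite (le_trans (hip_cs _ _))// mulrAC mulrC ler_wpM2r// mulrC.
Qed.

(* The operator is defined through its adjoint, which is given by Riesz. *)
Lemma extension (G H : hilbertType R) I (t : I -> G) (f : I -> H) (M : C) :
  0 <= M -> (forall l, `|lc f l| <= M * `|lc t l|) ->
  exists L : bop G H, [/\ forall i, L (t i) = f i,
    forall x, `|L x| <= M * `|x| &
    forall v, (forall i, hip v (t i) = 0) -> L v = 0].
Proof.
move=> M0 fM.
have /choice [A hA] h : exists g, [/\ forall i, hip g (t i) = hip h (f i),
    `|g| ^+ 2 <= (`|h| * M) ^+ 2 & exists l, (fun n : nat => lc t (l n)) @ \oo --> g].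
  apply: family_riesz => [|l]; first by rewrite exprn_ge0// mulr_ge0.
  rewrite -hip_lcr -exprMn lerXn2r ?nnegrE ?mulr_ge0// (le_trans (hip_cs _ _))//.
  by rewrite -mulrA ler_wpM2l.
have orth v h : (forall i, hip v (t i) = 0) -> hip v (A h) = 0.
  move=> hv; have [_ _ [l lA]] := hA h.
  apply: (@clim_unique _ (fun n => hip v (lc t (l n)))).
    by apply: cvg_hip => //; exact: cvg_cst.
  rewrite (_ : (fun n => _) = fun=> 0); first exact: cvg_cst.
  by apply/funext => n; rewrite hip_lcr; apply: big1 => p _; rewrite hv mulr0.
have [||A' hA'] := @bopP R H G A M.
- move=> c x y; apply/eqP; rewrite -subr_eq0; apply/eqP/hip_eq0.
  set d := _ - _; have dt i : hip d (t i) = 0.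
    rewrite hipBl hipDl hipZl; have [-> _ _] := hA (c *: x + y).
    by have [-> _ _] := hA x; have [-> _ _] := hA y; rewrite hipDl hipZl subrr.
  by rewrite {2}/d hipBr hipDr hipZr !orth// mulr0 addr0 subrr.
- move=> h; have [_ + _] := hA h.
  by rewrite ler_pXn2r ?nnegrE ?mulr_ge0// mulrC.
exists (adj A'); split=> [i|x|v hv].
- apply: hip_injl => h; rewrite -adjEr hA'.
  by have [h1 _ _] := hA h; rewrite -hip_conj h1 hip_conj.
- apply: adj_norm => // h; rewrite hA'; have [_ + _] := hA h.
  by rewrite ler_pXn2r ?nnegrE ?mulr_ge0// mulrC.
- by apply: hip_injl => h; rewrite hip0l -adjEr hA' orth.
Qed.

End Riesz.

(** * Square roots of contractions *)

Section BopAlgebra.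
Variables (R : realType).
Local Notation C := (cplx R).
Implicit Types H K L : hilbertType R.

Lemma bcomp_subproof H K L (g : bop K L) (f : bop H K) :
  exists h : bop H L, forall x, h x = g (f x).
Proof.
have [M M0 fM] := bop_bounded f; have [N N0 gN] := bop_bounded g.
have [||h hE] := @bopP R H L (g \o f) (N * M); last by exists h.
- by move=> c x y /=; rewrite !linearP.
- by move=> x /=; rewrite (le_trans (gN _))// -mulrA ler_wpM2l.
Qed.

Definition bcomp H K L (g : bop K L) (f : bop H K) := sval (cid (bcomp_subproof g f)).

Lemma bcompE H K L (g : bop K L) (f : bop H K) x : bcomp g f x = g (f x).
Proof. by rewrite /bcomp; case: cid. Qed.

Lemma bcomb_subproof H K (c : C) (f g : bop H K) :
  exists h : bop H K, forall x, h x = c *: f x + g x.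
Proof.
have [M M0 fM] := bop_bounded f; have [N N0 gN] := bop_bounded g.
have [||h hE] := @bopP R H K (fun x => c *: f x + g x) (`|c| * M + N); last by exists h.
- move=> d x y; rewrite !linearP /= addrACA; congr (_ + _ + _).
  by rewrite !scalerA mulrC.
- move=> x /=; rewrite (le_trans (ler_normD _ _))// mulrDl lerD//.
  by rewrite normrZ -mulrA ler_wpM2l.
Qed.

Definition bcomb H K (c : C) (f g : bop H K) := sval (cid (bcomb_subproof c f g)).

Lemma bcombE H K c (f g : bop H K) x : bcomb c f g x = c *: f x + g x.
Proof. by rewrite /bcomb; case: cid. Qed.

Lemma bid_subproof H : exists h : bop H H, forall x, h x = x.
Proof. by have [|x|h hE] := @bopP R H H id 1; [|rewrite mul1r|exists h]. Qed.

Definition bid H : bop H H := sval (cid (bid_subproof H)).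

Lemma bidE H (x : H) : bid H x = x.
Proof. by rewrite /bid; case: cid. Qed.

Lemma adj_uniq H K (f : bop H K) (g : bop K H) : adjoint f g -> forall x, adj f x = g x.
Proof. by move=> fg x; apply: hip_injr => y; rewrite -adjE fg. Qed.

Lemma adjK H K (f : bop H K) x : adj (adj f) x = f x.
Proof. by apply: adj_uniq => y z; rewrite adjEr. Qed.

Lemma isometric_norm H K (f : bop H K) x : isometric_bop f -> `|f x| = `|x|.
Proof.
move=> ff; apply/eqP; rewrite -(@eqrXn2 _ 2)// -!hip_norm; exact/eqP.
Qed.

Lemma isometric_adj H K (f : bop H K) : isometric_bop f -> forall x, adj f (f x) = x.
Proof. by move=> ff x; apply: hip_injl => y; rewrite -adjEr ff. Qed.

Lemma total_dense H I (t : I -> H) : total_family t ->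
  forall x : H, exists l, (fun n : nat => lc t (l n)) @ \oo --> x.
Proof.
move=> tt x; have /total_closure h : forall v, (forall b, range t b -> hip v b = 0) -> v = 0.
  by move=> v hv; apply: tt => i; apply: hv; exists i.
have : closure (lspan (range t)) x by rewrite h.
rewrite lspanE => /closure_seqP [u hu ux].
have /choice [l hl] n : exists l, lc t l = u n by have [l _] := hu n; exists l.
by exists l; under eq_fun do rewrite hl.
Qed.

Lemma bop_total H K I (t : I -> H) (f g : bop H K) : total_family t ->
  (forall i, f (t i) = g (t i)) -> forall x, f x = g x.
Proof.
move=> tt fg x; apply: hip_injl => y; rewrite !adjE; apply/eqP.
rewrite -subr_eq0 -hipBr; apply/eqP.
rewrite (_ : _ - _ = 0) ?hip0r//; apply: tt => i.
by rewrite hipBl -!adjEr fg subrr.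
Qed.

Lemma hip_total H I (t : I -> H) x y : total_family t ->
  (forall i, hip x (t i) = hip y (t i)) -> x = y.
Proof.
move=> tt xy; apply/eqP; rewrite -subr_eq0; apply/eqP/tt => i.
by rewrite hipBl xy subrr.
Qed.

Lemma bop_limit H K (f : nat -> bop H K) (M : C) :
  (forall n x, `|f n x| <= M * `|x|) ->
  (forall x, exists y : K, (fun n => f n x) @ \oo --> y) ->
  exists F : bop H K, forall x, (fun n => f n x) @ \oo --> F x.
Proof.
move=> fM /choice [F hF]; have [||G hG] := @bopP R H K F M; last first.
- by exists G => x; rewrite hG.
- move=> x; apply: (le_limit (fun n => fM n x)) (cvg_cst _).
  by apply: cvg_norm; exact: hF.
- move=> c x y; apply: lim_unique (hF (c *: x + y)) _.
  under eq_fun do rewrite linearP; apply: cvgD => //.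
  by apply: cvgZ => //; exact: cvg_cst.
Qed.

End BopAlgebra.

Section PolynomialAction.
Variables (R : realType).
Local Notation C := (cplx R).

Definition lin (E F : lmodType C) (a : E -> F) :=
  forall c x y, a (c *: x + y) = c *: a x + a y.

(** Polynomial functional calculus, the value p(a) x, for maps whose linearity is a mere
    hypothesis. *)
Definition pact (E : lmodType C) (a : E -> E) (p : {poly C}) x : E :=
  \sum_(i < size p) p`_i *: iter i a x.

Section Lin.
Variables (E F : lmodType C) (a : E -> F).
Hypothesis la : lin a.

Lemma lin0 : a 0 = 0.
Proof. by apply: (addrI (a 0)); rewrite -{1}[a 0]scale1r -la scale1r !addr0. Qed.

Lemma linZ c x : a (c *: x) = c *: a x.
Proof. by rewrite -[_ *: x]addr0 la lin0 addr0. Qed.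

Lemma linD x y : a (x + y) = a x + a y.
Proof. by rewrite -[x in LHS]scale1r la scale1r. Qed.

Lemma linN x : a (- x) = - a x.
Proof. by rewrite -scaleN1r linZ scaleN1r. Qed.

Lemma linB x y : a (x - y) = a x - a y.
Proof. by rewrite linD linN. Qed.

Lemma lin_sum I (s : seq I) (P : pred I) G : a (\sum_(i <- s | P i) G i) = \sum_(i <- s | P i) a (G i).
Proof. by apply: (big_morph a); [exact: linD|exact: lin0]. Qed.

End Lin.

Section Pact.
Variables (E : lmodType C) (a : E -> E).
Hypothesis la : lin a.

Lemma lin_iter n : lin (iter n a).
Proof. by elim: n => [|n IH] c x y //=; rewrite IH la. Qed.

Lemma pactE (p : {poly C}) n x : (size p <= n)%N -> pact a p x = \sum_(i < n) p`_i *: iter i a x.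
Proof.
move=> pn; rewrite /pact (big_ord_widen n (fun i => p`_i *: iter i a x) pn).
rewrite big_mkcond /=; apply: eq_bigr => i _; case: ltnP => // /(nth_default 0) ->.
by rewrite scale0r.
Qed.

Lemma pact_lin p : lin (pact a p).
Proof.
move=> c x y; rewrite /pact scaler_sumr -big_split /=; apply: eq_bigr => i _.
by rewrite lin_iter scalerDr !scalerA mulrC.
Qed.

Lemma pactP c p q x : pact a (c *: p + q) x = c *: pact a p x + pact a q x.
Proof.
pose n := maxn (size (c *: p + q)) (maxn (size p) (size q)).
rewrite (@pactE _ n) ?leq_maxl// (@pactE p n) ?leq_max ?leqnn ?orbT//.
rewrite (@pactE q n) ?leq_max ?leqnn ?orbT// scaler_sumr -big_split /=.
by apply: eq_bigr => i _; rewrite coefD coefZ scalerDl scalerA.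
Qed.

Lemma pact0 x : pact a 0 x = 0.
Proof. by rewrite /pact size_poly0 big_ord0. Qed.

Lemma pactZ c p x : pact a (c *: p) x = c *: pact a p x.
Proof. by rewrite -[_ *: p]addr0 pactP pact0 addr0. Qed.

Lemma pactD p q x : pact a (p + q) x = pact a p x + pact a q x.
Proof. by rewrite -[p]scale1r pactP !scale1r. Qed.

Lemma pactB p q x : pact a (p - q) x = pact a p x - pact a q x.
Proof. by rewrite [p - q]addrC -[- q]scaleN1r pactP scaleN1r addrC. Qed.

Lemma pactC c x : pact a c%:P x = c *: x.
Proof.
by rewrite (@pactE _ 1) ?size_polyC ?leq_b1// big_ord1 coefC.
Qed.

Lemma pactMX p x : pact a (p * 'X) x = pact a p (a x).
Proof.
rewrite (@pactE _ (size p).+1) ?(leq_trans (size_polyMleq _ _))//; last first.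
  by rewrite size_polyX addn2.
rewrite big_ord_recl coefMX eqxx scale0r add0r /pact; apply: eq_bigr => i _.
by rewrite coefMX /= /bump -iterSr.
Qed.

Lemma pactM p q x : pact a (p * q) x = pact a p (pact a q x).
Proof.
elim/poly_ind: q x => [|q c IH] x.
  by rewrite mulr0 !pact0 (lin0 (pact_lin p)).
rewrite mulrDr mulrA !pactD pactMX IH pactMX pactC.
by rewrite (linD (pact_lin p)) (linZ (pact_lin p)) mulrC mul_polyC pactZ.
Qed.

Lemma pactX x : pact a 'X x = a x.
Proof. by rewrite -['X]mul1r pactMX -[1]/(1%:P) pactC scale1r. Qed.

Lemma pact_comm (F : lmodType C) (b : F -> F) (c : E -> F) : lin c ->
  (forall x, c (a x) = b (c x)) -> forall p x, c (pact a p x) = pact b p (c x).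
Proof.
move=> lc_ cab p x; rewrite /pact (lin_sum lc_); apply: eq_bigr => i _.
rewrite (linZ lc_); congr (_ *: _).
by elim: (i : nat) => //= n <-; rewrite cab.
Qed.

End Pact.

Definition ncoef (p : {poly C}) := forall i, 0 <= p`_i.

Lemma ncoefD p q : ncoef p -> ncoef q -> ncoef (p + q).
Proof. by move=> p0 q0 i; rewrite coefD addr_ge0. Qed.

Lemma ncoefM p q : ncoef p -> ncoef q -> ncoef (p * q).
Proof. by move=> p0 q0 i; rewrite coefM; apply: sumr_ge0 => j _; rewrite mulr_ge0. Qed.

Lemma ncoefZ c p : 0 <= c -> ncoef p -> ncoef (c *: p).
Proof. by move=> c0 p0 i; rewrite coefZ mulr_ge0. Qed.

Lemma ncoefX : ncoef 'X.
Proof. by move=> i; rewrite coefX; case: eqP. Qed.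

Lemma pact_bound (E : normedModType C) (a : E -> E) p x : ncoef p ->
  (forall y, `|a y| <= `|y|) -> `|pact a p x| <= p.[1] * `|x|.
Proof.
move=> p0 aN; rewrite horner_coef /pact mulr_suml.
rewrite (le_trans (ler_norm_sum _ _ _))//; apply: ler_sum => i _.
rewrite normrZ ger0_norm// expr1n mulr1 ler_wpM2l//.
by elim: (i : nat) => //= n; exact: le_trans.
Qed.

(** The iterates of y |-> (a + y^2)/2 from 0; a fixed point satisfies (1 - y)^2 = 1 - a. *)
Fixpoint sqrt_poly n : {poly C} :=
  if n is m.+1 then 2^-1 *: ('X + sqrt_poly m ^+ 2) else 0.

Lemma sqrt_poly_ncoef n : ncoef (sqrt_poly n).
Proof.
elim: n => [|n IH] /=; first by move=> i; rewrite coef0.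
by apply: ncoefZ; rewrite ?invr_ge0 ?ler0n//; apply: ncoefD; [exact: ncoefX|exact: ncoefM].
Qed.

(** By the recursion the next increment is half of (s_(n+1) - s_n)(s_(n+1) + s_n), a product of
    polynomials with nonnegative coefficients. *)
Lemma sqrt_poly_incr n : ncoef (sqrt_poly n.+1 - sqrt_poly n).
Proof.
elim: n => [|n IH].
  by rewrite /= subr0 expr0n addr0; apply: ncoefZ; rewrite ?invr_ge0 ?ler0n//; exact: ncoefX.
have E m : sqrt_poly m.+1 = 2^-1 *: ('X + sqrt_poly m ^+ 2) by [].
rewrite (E n.+1) [X in _ - X](E n) -scalerBr opprD addrACA subrr add0r.
apply: ncoefZ; rewrite ?invr_ge0 ?ler0n// subr_sqr; apply: ncoefM => //.
by apply: ncoefD; exact: sqrt_poly_ncoef.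
Qed.

Lemma sqrt_poly_incr_le m n : (m <= n)%N -> ncoef (sqrt_poly n - sqrt_poly m).
Proof.
move=> /subnK <-; elim: (n - m)%N => [|d IH]; first by move=> i; rewrite subrr coef0.
rewrite -[_ - _](subrKA (sqrt_poly (d + m))); apply: ncoefD => //.
exact: sqrt_poly_incr.
Qed.

Lemma ncoef1_ge0 p : ncoef p -> 0 <= p.[1].
Proof.
move=> p0; rewrite horner_coef; apply: sumr_ge0 => i _.
by rewrite expr1n mulr1.
Qed.

Lemma sqrt_poly_le1 n : (sqrt_poly n).[1] <= 1.
Proof.
elim: n => [|n IH] /=; first by rewrite horner0 ler01.
rewrite hornerZ hornerD hornerX horner_exp mulrC ler_pdivrMr ?ltr0n// mul1r.
rewrite -[leRHS]/(1 + 1) lerD2l expr_le1//.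
exact/ncoef1_ge0/sqrt_poly_ncoef.
Qed.

Lemma sqrt_poly_cauchy (e : C) : 0 < e -> exists N, forall m n,
  (N <= m)%N -> (m <= n)%N -> (sqrt_poly n - sqrt_poly m).[1] <= e.
Proof.
move=> e0; have [||i i0 [ile iex]] := @lower_bound R [set z | exists n, z = 1 - (sqrt_poly n).[1]].
- by exists (1 - (sqrt_poly 0).[1]), 0.
- by move=> _ [n ->]; rewrite subr_ge0 sqrt_poly_le1.
have [_ [N ->] hN] := iex e e0; exists N => m n Nm mn.
rewrite hornerD hornerN (_ : _ - _ = (1 - (sqrt_poly m).[1]) - (1 - (sqrt_poly n).[1])); last by ring.
rewrite lerBlDr (@le_trans _ _ (1 - (sqrt_poly N).[1]))//.
  rewrite lerD2l lerN2 -subr_ge0 -hornerN -hornerD; apply/ncoef1_ge0.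
  exact: sqrt_poly_incr_le.
by rewrite (le_trans (ltW hN))// addrC lerD2l; apply: ile; exists n.
Qed.

(* [1 - sqrt_poly n] are real polynomials converging to [sqrt (1 - a)] for
   every contraction [a], because the coefficients of their increments are
   nonnegative and sum up to at most 1. *)
Lemma banach_sqrt (E : completeNormedModType C) (a : E -> E) :
  lin a -> (forall x, `|a x| <= `|x|) ->
  exists y : E -> E, [/\ lin y, forall x, `|y x| <= `|x|,
    forall x, y (y x) = 2 *: y x - a x &
    forall x, (fun n => pact a (sqrt_poly n) x) @ \oo --> y x].
Proof.
move=> la aN.
have pB n x : `|pact a (sqrt_poly n) x| <= `|x|.
  apply: le_trans (pact_bound x (sqrt_poly_ncoef n) aN) _.
  by rewrite ler_piMl// sqrt_poly_le1.
have /choice [y hy] x : exists y : E, (fun n => pact a (sqrt_poly n) x) @ \oo --> y.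
  apply: cauchyseq_cvg => e e0.
  have x1 : 0 < `|x| + 1 by rewrite ltr_wpDl.
  have [N hN] := sqrt_poly_cauchy (divr_gt0 e0 x1).
  have hh m n : (N <= m)%N -> (m <= n)%N ->
      `|pact a (sqrt_poly n) x - pact a (sqrt_poly m) x| <= e.
    move=> Nm mn; rewrite -pactB.
    apply: le_trans (pact_bound x (sqrt_poly_incr_le mn) aN) _.
    rewrite (@le_trans _ _ (e / (`|x| + 1) * `|x|))// ?ler_wpM2r ?hN//.
    rewrite mulrAC ler_pdivrMr// ler_wpM2l ?(ltW e0)//.
    by rewrite lerDl.
  exists N => m n Nm Nn; have [mn|/ltnW nm] := leqP m n.
    by rewrite distrC hh.
  by rewrite hh.
have yl : lin y.
  move=> c x z; apply: lim_unique (hy (c *: x + z)) _.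
  under eq_fun do rewrite (pact_lin la); apply: cvgD => //.
  by apply: cvgZ => //; exact: cvg_cst.
have yB x : `|y x| <= `|x|.
  apply: (le_limit (fun n => pB n x)) (cvg_cst _); by apply: cvg_norm; exact: hy.
exists y; split=> // x.
have h1 : (fun n => pact a (sqrt_poly n ^+ 2) x) @ \oo --> y (y x).
  apply/cvgn_le0P => e e0.
  have [N hN] := (cvgn_le0P _ _).1 (hy x) _ (divr_gt0 e0 (ltr0n _ 2)).
  have [M hM] := (cvgn_le0P _ _).1 (hy (y x)) _ (divr_gt0 e0 (ltr0n _ 2)).
  exists (maxn M N) => n; rewrite geq_max => /andP[Mn Nn].
  rewrite expr2 (pactM la) -(subrKA (pact a (sqrt_poly n) (y x))).
  rewrite (le_trans (ler_normD _ _))// [leRHS]splitr lerD ?hM//.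
  by rewrite -(linB (pact_lin la _)) (le_trans (pB _ _))// hN.
have h2 : (fun n => pact a (sqrt_poly n.+1) x) @ \oo --> y x.
  by have := hy x; rewrite -(cvg_shiftS (fun n => pact a (sqrt_poly n) x)).
(* The recursion passes to the limit as 2 y = a + y^2. *)
have h3 : (fun n => pact a (sqrt_poly n.+1) x) @ \oo --> 2^-1 *: (a x + y (y x)).
  rewrite (_ : (fun n => _) = (fun n => 2^-1 *: (a x + pact a (sqrt_poly n ^+ 2) x))).
    by apply: cvgZ; [exact: cvg_cst|apply: cvgD => //; exact: cvg_cst].
  by apply/funext => n /=; rewrite pactZ// pactD// pactX.
rewrite {2}(lim_unique h2 h3) scalerA mulfV ?pnatr_eq0// scale1r.
by rewrite addrC addKr.
Qed.

End PolynomialAction.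

(** * Positivity in C*-algebras *)

Section RealBounds.
Variable R : realType.
Local Notation C := (cplx R).

Lemma bernoulli (d : C) n : 0 <= d -> 1 + n%:R * d <= (1 + d) ^+ n.
Proof.
move=> d0; elim: n => [|n IH]; first by rewrite mul0r addr0 expr0.
rewrite exprS; have h : 0 <= 1 + d by rewrite addr_ge0.
apply: le_trans (ler_wpM2l h IH).
apply: (@le_subE _ (n%:R * d ^+ 2)); first by rewrite mulr_ge0 ?exprn_ge0.
by rewrite -natr1; ring.
Qed.

(** If r = 1 + d with d > 0, Bernoulli gives r^(2^(n+1)) >= (2^n d)^2, quadratic in 2^n against a
    linear bound; as 2^n >= n, the numbers n d^2 would stay bounded. The exponents 2^n are those
    produced by repeated squaring. *)
Lemma power_le1 (r K : C) : 0 <= r -> 0 <= K ->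
  (forall n, r ^+ (2 ^ n) <= 1 + (2 ^ n)%:R * K) -> r <= 1.
Proof.
move=> r0 K0 h; case: (comparable_leP (real_comparable (ger0_real r0) (@real1 C))) => // r1.
pose d := r - 1; have d0 : 0 < d by rewrite subr_gt0.
have rd : r = 1 + d by rewrite /d addrC subrK.
have key n : n%:R * d ^+ 2 <= 1 + K *+ 2.
  have N0 : 0 < (2 ^ n)%:R :> C by rewrite ltr0n expn_gt0.
  rewrite -(ler_pM2l N0) (@le_trans _ _ (1 + (2 ^ n.+1)%:R * K))//; last first.
    rewrite expnS natrM mulrDr mulr1 -mulrA mulr_natl mulrnAr lerD2r.
    by rewrite ler1n expn_gt0.
  apply: le_trans (h n.+1); rewrite expnS mulnC exprM rd.
  have h1 : (2 ^ n)%:R * d <= (1 + d) ^+ (2 ^ n).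
    apply: le_trans (bernoulli _ (ltW d0)); by rewrite lerDr ler01.
  apply: (@le_trans _ _ (((2 ^ n)%:R * d) ^+ 2)).
    apply: (@le_subE _ ((2 ^ n)%:R * (((2 ^ n)%:R - n%:R) * d ^+ 2))); last by ring.
    rewrite mulr_ge0 ?ler0n// mulr_ge0 ?exprn_ge0 ?(ltW d0)// subr_ge0 ler_nat.
    by rewrite ltnW// ltn_expl.
  rewrite lerXn2r// nnegrE; first by rewrite mulr_ge0 ?ler0n ?(ltW d0).
  by rewrite exprn_ge0// addr_ge0 ?(ltW d0).
have d2 : 0 < d ^+ 2 / (1 + K *+ 2).
  by rewrite divr_gt0 ?exprn_gt0// ltr_pwDl// mulrn_wge0.
have [n hn] := cplx_archi d2.
have K1 : 0 < 1 + K *+ 2 by rewrite ltr_pwDl// mulrn_wge0.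
move: hn; rewrite ltr_pdivlMr// mulrC ltr_pdivrMr ?ltr0n// mulrC => /lt_le_trans/(_ (key n.+1)).
by rewrite ltxx.
Qed.

Lemma le_addeps (x y : C) : (forall e, 0 < e -> x <= y + e) -> x <= y.
Proof.
move=> h; apply: (@le_limit _ (fun=> x) (fun n : nat => y + n.+1%:R^-1)).
- by move=> n; apply: h; rewrite invr_gt0 ltr0n.
- exact: cvg_cst.
- by rewrite -[y in X in _ --> X]addr0; apply: cvgD; [exact: cvg_cst|exact: cvg_invS].
Qed.

End RealBounds.

Section CStarBasics.
Variables (R : realType) (A : cstarType R).
Local Notation C := (cplx R).
Local Notation "a ** b" := (amul a b) (at level 40, left associativity).
Implicit Types a b c x y z : A.

Lemma amul0r a : a ** 0 = 0.
Proof. by apply: (addrI (a ** 0)); rewrite -amulDr !addr0. Qed.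

Lemma amul0l a : 0 ** a = 0.
Proof. by apply: (addrI (0 ** a)); rewrite -amulDl !addr0. Qed.

Lemma amulNr a b : a ** (- b) = - (a ** b).
Proof. by rewrite -scaleN1r amulZr scaleN1r. Qed.

Lemma amulNl a b : (- a) ** b = - (a ** b).
Proof. by rewrite -scaleN1r amulZl scaleN1r. Qed.

Lemma amulBr a b c : a ** (b - c) = a ** b - a ** c.
Proof. by rewrite amulDr amulNr. Qed.

Lemma amulBl a b c : (a - b) ** c = a ** c - b ** c.
Proof. by rewrite amulDl amulNl. Qed.

Lemma amul_suml I (s : seq I) (P : pred I) F a :
  (\sum_(i <- s | P i) F i) ** a = \sum_(i <- s | P i) (F i ** a).
Proof. by apply: (big_morph (fun x => x ** a)) => [x y|]; rewrite (amulDl, amul0l). Qed.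

Lemma amul_sumr I (s : seq I) (P : pred I) F a :
  a ** (\sum_(i <- s | P i) F i) = \sum_(i <- s | P i) (a ** F i).
Proof. by apply: (big_morph (amul a)) => [x y|]; rewrite (amulDr, amul0r). Qed.

Lemma astar0 : astar 0 = 0 :> A.
Proof. by rewrite -(scale0r (0 : A)) astarZ rmorph0 !scale0r. Qed.

Lemma astarN a : astar (- a) = - astar a.
Proof. by rewrite -scaleN1r astarZ rmorphN1 scaleN1r. Qed.

Lemma astarB a b : astar (a - b) = astar a - astar b.
Proof. by rewrite astarD astarN. Qed.

Lemma astar_sum I (s : seq I) (P : pred I) (F : I -> A) :
  astar (\sum_(i <- s | P i) F i) = \sum_(i <- s | P i) astar (F i).
Proof. by apply: (big_morph (@astar R A)); [exact: astarD|exact: astar0]. Qed.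

Lemma norm_astar a : `|astar a| = `|a|.
Proof.
have h b : `|b| <= `|astar b|.
  have [->|b0] := eqVneq b 0; first by rewrite normr0.
  have bp : 0 < `|b| by rewrite normr_gt0.
  by rewrite -(ler_pM2r bp) -expr2 -anorm_star anorm_mul.
by apply/eqP; rewrite eq_le h andbT; have := h (astar a); rewrite astarK.
Qed.

Lemma cvg_amul (u v : nat -> A) a b :
  u @ \oo --> a -> v @ \oo --> b -> (fun n => u n ** v n) @ \oo --> a ** b.
Proof.
move=> ux vy.
have d0 (w : nat -> A) z : w @ \oo --> z -> (fun n => `|w n - z|) @ \oo --> (0 : C).
  move=> wz; rewrite -(normr0 A) -(subrr z); apply: cvg_norm.
  by apply: cvgB => //; exact: cvg_cst.
have h0 : (fun n => `|u n - a| * `|v n| + `|a| * `|v n - b|) @ \oo --> (0 : C).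
  rewrite -[0 : C]addr0 -{1}[0 : C](mul0r `|b|) -[X in _ + X](mulr0 `|a|).
  apply: cvgD; first by apply: cvgM; [exact: d0|exact: cvg_norm].
  by apply: cvgM; [exact: cvg_cst|exact: d0].
apply: cvg_rate h0 => n.
rewrite (_ : _ - _ = (u n - a) ** (v n) + a ** (v n - b)).
  by rewrite (le_trans (ler_normD _ _))// lerD// anorm_mul.
by rewrite amulBl amulBr addrA subrK.
Qed.

Lemma cvg_astar (u : nat -> A) a : u @ \oo --> a -> (fun n => astar (u n)) @ \oo --> astar a.
Proof.
move=> /cvgn_le0P h; apply/cvgn_le0P => e /h [N hN]; exists N => n /hN.
by rewrite -astarB norm_astar.
Qed.

(* The operators on A which are self-adjoint for the A-valued inner product
   [x^* y] play the role of the self-adjoint elements of the multiplier algebra. *)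
Record sop (f : A -> A) : Prop := Sop {
  sop_lin : lin f;
  sop_sa : forall x y, astar (f x) ** y = astar x ** f y;
  sop_bnd : exists2 M : C, 0 <= M & forall x, `|f x| <= M * `|x| }.

(** For self-adjoint f this says that the spectrum lies in [0, 2t], without mention of a spectrum or
    of a unit of A. *)
Definition opos (f : A -> A) := exists2 t : C, 0 < t & forall x, `|t *: x - f x| <= t * `|x|.

Lemma sop_amul a : astar a = a -> sop (amul a).
Proof.
move=> sa; split; first by move=> c x y; rewrite amulDr amulZr.
- by move=> x y; rewrite astarM sa amulA.
- by exists `|a| => // x; exact: anorm_mul.
Qed.

Lemma sop_id : sop id.
Proof. by split=> //; exists 1 => // x; rewrite mul1r. Qed.

Lemma sop_scale (c : C) f : c \is Num.real -> sop f -> sop (fun x => c *: f x).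
Proof.
move=> cr [fl fs [M M0 fM]]; split.
- by move=> d x y; rewrite fl scalerDr !scalerA mulrC.
- by move=> x y; rewrite astarZ (conj_Creal cr) amulZl amulZr fs.
- exists (`|c| * M); rewrite ?mulr_ge0// => x.
  by rewrite normrZ -mulrA ler_wpM2l.
Qed.

Lemma sop_add f g : sop f -> sop g -> sop (fun x => f x + g x).
Proof.
move=> [fl fs [M M0 fM]] [gl gs [N N0 gN]]; split.
- by move=> d x y; rewrite fl gl scalerDr addrACA.
- by move=> x y; rewrite astarD amulDl amulDr fs gs.
- exists (M + N); rewrite ?addr_ge0// => x.
  by rewrite (le_trans (ler_normD _ _))// mulrDl lerD.
Qed.

Lemma sop_comp f g : sop f -> sop g -> (forall x, f (g x) = g (f x)) -> sop (f \o g).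
Proof.
move=> [fl fs [M M0 fM]] [gl gs [N N0 gN]] fg; split.
- by move=> d x y /=; rewrite gl fl.
- by move=> x y /=; rewrite fs gs fg.
- exists (M * N); rewrite ?mulr_ge0// => x /=.
  by rewrite (le_trans (fM _))// -mulrA ler_wpM2l.
Qed.

Lemma eq_sop f g : f =1 g -> sop f -> sop g.
Proof. by move=> /funext ->. Qed.

Lemma sop_sub f g : sop f -> sop g -> sop (fun x => f x - g x).
Proof.
move=> sf sg; apply: (@eq_sop (fun x => f x + (-1) *: g x)).
  by move=> x; rewrite scaleN1r.
by apply: sop_add => //; apply: sop_scale => //; rewrite rpredN real1.
Qed.

Lemma sop_sq f x : sop f -> `|f x| ^+ 2 <= `|x| * `|f (f x)|.
Proof.
move=> [_ fs _]; rewrite -anorm_star fs.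
by rewrite (le_trans (anorm_mul _ _))// norm_astar.
Qed.

(** Iterated use of |f x|^2 <= |x| |f(f x)|, a spectral radius estimate at a single vector. *)
Lemma sop_power f x n : sop f ->
  `|x| * `|f x| ^+ (2 ^ n) <= `|x| ^+ (2 ^ n) * `|iter (2 ^ n) f x|.
Proof.
move=> sf; elim: n => [|n IH]; first by rewrite !expr1.
have [->|x0] := eqVneq x 0.
  by rewrite normr0 mul0r mulr_ge0 ?exprn_ge0.
have xp : 0 < `|x| by rewrite normr_gt0.
have sit m : sop (iter m f).
  elim: m => [|m IHm]; first exact: sop_id.
  apply: (@eq_sop (f \o iter m f)) => //.
  by apply: sop_comp => // z; rewrite -iterS iterSr.
rewrite -(ler_pM2l xp) expnS mul2n -addnn iterD !exprD.
apply: (@le_trans _ _ ((`|x| * `|f x| ^+ (2 ^ n)) ^+ 2)).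
  by rewrite le_eqVlt; apply/orP; left; apply/eqP; ring.
apply: (@le_trans _ _ ((`|x| ^+ (2 ^ n) * `|iter (2 ^ n) f x|) ^+ 2)).
  by rewrite lerXn2r ?nnegrE ?mulr_ge0 ?exprn_ge0.
rewrite exprMn (le_trans (ler_wpM2l _ (sop_sq _ (sit _))))// ?exprn_ge0//.
by rewrite le_eqVlt; apply/orP; left; apply/eqP; ring.
Qed.

(** The norm of a self-adjoint operator is its spectral radius: the linear factor 1 + n Q is removed
    by [power_le1] applied to |f x| / (t |x|). *)
Lemma sop_growth f (t Q : C) : sop f -> 0 < t -> 0 <= Q ->
  (forall n x, `|iter n f x| <= t ^+ n * (1 + n%:R * Q) * `|x|) ->
  forall x, `|f x| <= t * `|x|.
Proof.
move=> sf t0 Q0 h x; have [->|x0] := eqVneq x 0.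
  by rewrite (lin0 (sop_lin sf)) normr0 mulr0.
have xp : 0 < `|x| by rewrite normr_gt0.
have tx : 0 < t * `|x| by rewrite mulr_gt0.
rewrite -[leRHS]mul1r -ler_pdivrMr//; apply: (@power_le1 _ _ Q) => //.
  by rewrite divr_ge0// ltW.
move=> n; rewrite expr_div_n ler_pdivrMr ?exprn_gt0//.
rewrite -(ler_pM2l xp) (le_trans (sop_power x n sf))//.
apply: le_trans (ler_wpM2l _ (h _ x)) _; first by rewrite exprn_ge0.
by rewrite exprMn le_eqVlt; apply/orP; left; apply/eqP; ring.
Qed.

(** As (t - b)^(n+1) = t (t - b)^n - (t - b)^n b, the hypothesis bounds (t - b)^n by t^n (1 + n
    Q/t). It serves when (t - b)^n b can be rewritten with the powers of another operator already
    known to be positive. *)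
Lemma opos_power (b : A -> A) (t Q : C) : sop b -> 0 < t -> 0 <= Q ->
  (forall n x, `|iter n (fun y => t *: y - b y) (b x)| <= Q * t ^+ n * `|x|) ->
  opos b.
Proof.
move=> sb t0 Q0 h; exists t => //; pose f y := t *: y - b y.
have sf : sop f.
  by apply: sop_sub => //; apply: sop_scale (gtr0_real t0) sop_id.
apply: (@sop_growth f t (Q / t)) => //; first by rewrite divr_ge0 ?(ltW t0).
elim=> [|n IH] x; first by rewrite /= expr0 mul0r addr0 !mul1r.
rewrite iterSr {2}/f (linB (lin_iter (sop_lin sf) n)) (linZ (lin_iter (sop_lin sf) n)).
rewrite (le_trans (ler_normB _ _))// normrZ gtr0_norm//.
rewrite (le_trans (lerD (ler_wpM2l (ltW t0) (IH x)) (h n x)))//.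
rewrite le_eqVlt; apply/orP; left; apply/eqP; rewrite -natr1 exprS.
by field; rewrite gt_eqF.
Qed.

(** By positivity a = 1 - f/t is a contraction; the root is sqrt t (1 - y) with (1 - y)^2 = 1 - a.
    The last clause holds for polynomials in a and passes to the limit. *)
Lemma opos_sqrt f : sop f -> opos f -> exists g, [/\ sop g, opos g,
  forall x, g (g x) = f x &
  forall b : A -> A, lin b -> (exists2 M : C, 0 <= M & forall x, `|b x| <= M * `|x|) ->
    (forall x, b (f x) = f (b x)) -> forall x, b (g x) = g (b x)].
Proof.
move=> sf [t t0 ft]; pose a x := x - t^-1 *: f x.
have la : lin a by move=> c x y; rewrite /a (sop_lin sf) scalerBr scalerDr !scalerA
  [c * _]mulrC opprD addrACA.
have sa_ : sop a.
  apply: sop_sub sop_id _; apply: sop_scale => //.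
  by rewrite rpredV gtr0_real.
have aN x : `|a x| <= `|x|.
  rewrite -(ler_pM2l t0) -{1}(gtr0_norm t0) -normrZ scalerBr scalerA mulfV ?gt_eqF//.
  by rewrite scale1r.
have [y [yl yN yy yc]] := banach_sqrt la aN.
have ys : sop y.
  split=> //; last by exists 1 => // x; rewrite mul1r.
  move=> x z; have h1 : (fun n => astar (pact a (sqrt_poly R n) x) ** z) @ \oo -->
      astar (y x) ** z.
    by apply: cvg_amul; [exact: cvg_astar|exact: cvg_cst].
  apply: lim_unique h1 _.
  rewrite (_ : (fun n => _) = (fun n => astar x ** pact a (sqrt_poly R n) z)).
    by apply: cvg_amul => //; exact: cvg_cst.
  apply/funext => n; rewrite /pact astar_sum amul_suml amul_sumr.
  apply: eq_bigr => i _; rewrite astarZ amulZl amulZr.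
  rewrite (conj_Creal (ger0_real (sqrt_poly_ncoef _ _ _))); congr (_ *: _).
  elim: (i : nat) x z => //= m IH x z.
  by rewrite (sop_sa sa_) IH -iterSr iterS.
have t20 : 0 <= sqrtC t by rewrite sqrtC_ge0 ltW.
have t2p : 0 < sqrtC t by rewrite sqrtC_gt0.
exists (fun x => sqrtC t *: (x - y x)); split.
- apply: sop_scale; first exact: ger0_real.
  exact: sop_sub sop_id ys.
- exists (sqrtC t) => // x.
  by rewrite scalerBr opprB addrC subrK normrZ ger0_norm// ler_wpM2l.
- move=> x; rewrite (linZ yl) -scalerBr scalerA -expr2 sqrtCK (linB yl) yy.
  rewrite (_ : _ - _ = t^-1 *: f x).
    by rewrite scalerA mulfV ?gt_eqF// scale1r.
  rewrite /a scaler_nat mulr2n opprB opprB !addrA.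
  by rewrite subrK -addrA -opprD [x + y x + _]addrC addrK.
- move=> b bl [M M0 bM] bf x; rewrite (linZ bl) (linB bl); congr (_ *: (_ - _)).
  have h1 : (fun n => b (pact a (sqrt_poly R n) x)) @ \oo --> b (y x).
    apply: (@cvg_rate _ _ _ _ (fun n => M * `|pact a (sqrt_poly R n) x - y x|)).
      by move=> n; rewrite -(linB bl).
    rewrite -(mulr0 M) -(normr0 A) -(subrr (y x)); apply: cvgM; first exact: cvg_cst.
    by apply: cvg_norm; apply: cvgB => //; exact: cvg_cst.
  have e p z : b (pact a p z) = pact a p (b z).
    by apply: pact_comm => // w; rewrite /a (linB bl) (linZ bl) bf.
  by apply: lim_unique h1 _; under eq_fun do rewrite e; exact: yc.
Qed.

End CStarBasics.

(** * Positivity of c^*c in a C*-algebra *)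

Section Fukamiya.
Variables (R : realType) (A : cstarType R).
Local Notation C := (cplx R).
Local Notation "a ** b" := (amul a b) (at level 40, left associativity).
Implicit Types (f g h : A -> A).

Lemma bnd_comp (f g : A -> A) : (exists2 M : C, 0 <= M & forall x, `|f x| <= M * `|x|) ->
  (exists2 M : C, 0 <= M & forall x, `|g x| <= M * `|x|) ->
  exists2 M : C, 0 <= M & forall x, `|f (g x)| <= M * `|x|.
Proof.
move=> [M M0 fM] [N N0 gN]; exists (M * N); rewrite ?mulr_ge0// => x.
by rewrite (le_trans (fM _))// -mulrA ler_wpM2l.
Qed.

Lemma sop_unit f g (s : C) x : sop f -> sop g -> (forall x, f (g x) = g (f x)) ->
  (forall x, f (f x) + g (g x) = s *: x) -> 0 <= s ->
  `|f x + 'i *: g x| ^+ 2 = s * `|x| ^+ 2.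
Proof.
move=> sf sg fg fgs s0; set u := _ + _.
have ii : 'i^* * 'i = 1 :> C by rewrite -normCKC normCi expr1n.
have -> : s * `|x| ^+ 2 = `|astar x ** (s *: x)|.
  by rewrite amulZr normrZ ger0_norm// anorm_star.
rewrite -anorm_star {1}/u astarD astarZ amulDl amulZl (sop_sa sf) (sop_sa sg).
rewrite -amulZr -amulDr; congr `|astar x ** _|.
rewrite /u (linD (sop_lin sf)) (linD (sop_lin sg)) (linZ (sop_lin sf)).
rewrite (linZ (sop_lin sg)) scalerDr scalerA ii scale1r fg -fgs conjCi scaleNr.
by rewrite addrA addrK.
Qed.

(** The operator f is the mean of f + i g and f - i g, and each of these multiplies norms by exactly
    sqrt s. *)
Lemma sop_pair f g (s : C) x : sop f -> sop g -> (forall x, f (g x) = g (f x)) ->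
  (forall x, f (f x) + g (g x) = s *: x) -> 0 <= s ->
  `|f x| <= sqrtC s * `|x|.
Proof.
move=> sf sg fg fgs s0.
pose g' x := (-1) *: g x.
have sg' : sop g' by apply: sop_scale => //; rewrite rpredN real1.
have s00 : 0 <= sqrtC s by rewrite sqrtC_ge0.
have root (v : A) : `|v| ^+ 2 = s * `|x| ^+ 2 -> `|v| = sqrtC s * `|x|.
  move=> h; apply/eqP; rewrite -(@eqrXn2 _ 2)// ?mulr_ge0//.
  by rewrite h exprMn sqrtCK.
have h1 := root _ (sop_unit x sf sg fg fgs s0).
have h2 : `|f x + 'i *: g' x| = sqrtC s * `|x|.
  apply: root; apply: sop_unit => // y; first by rewrite /g' (linZ (sop_lin sf)) fg.
  by rewrite /g' (linZ (sop_lin sg)) !scalerA mulrNN mul1r scale1r.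
rewrite -(@ler_pM2l _ 2)// -{1}(@ger0_norm _ 2)// -normrZ.
rewrite (_ : 2 *: f x = (f x + 'i *: g x) + (f x + 'i *: g' x)).
  by rewrite (le_trans (ler_normD _ _))// h1 h2 -mulr2n mulr_natl.
rewrite /g' scaleN1r scalerN addrACA subrr addr0.
by rewrite scaler_nat mulr2n.
Qed.

(** For c >= |h| the operator c^2 - h^2 is positive, with root w. From w^2 + h^2 = c^2 one gets |w|
    <= c, hence |c^2 - h^2| <= c^2. *)
Lemma opos_sqr h : sop h -> opos (h \o h).
Proof.
move=> sh; have [hl hs [M M0 hM]] := sh; pose c := M + 1.
have c0 : 0 < c by rewrite ltr_wpDl.
have hc x : `|h x| <= c * `|x|.
  by rewrite (le_trans (hM x))// ler_wpM2r// lerDl.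
have c20 : 0 < c ^+ 2 by rewrite exprn_gt0.
have shh : sop (h \o h) by exact: sop_comp.
pose f x := c ^+ 2 *: x - h (h x).
have sf : sop f.
  by apply: sop_sub shh; apply: sop_scale (gtr0_real c20) (sop_id A).
have [|w [sw _ ww wc]] := opos_sqrt sf.
  exists (c ^+ 2) => // x; rewrite /f opprB addrC subrK expr2 -mulrA.
  by rewrite (le_trans (hc _))// ler_wpM2l ?(ltW c0).
have hw x : h (w x) = w (h x).
  apply: wc => //; first by exists M.
  by move=> y; rewrite /f (linB hl) (linZ hl).
have wN x : `|w x| <= c * `|x|.
  rewrite -[c]sqrCK ?(ltW c0)//; apply: (sop_pair x sw sh) => [y|y|].
  - by rewrite hw.
  - by rewrite ww subrK.
  - by rewrite exprn_ge0 ?(ltW c0).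
exists (c ^+ 2) => // x /=.
rewrite -[_ - _]/(f x) -ww expr2 -mulrA (le_trans (wN _))// ler_wpM2l ?(ltW c0)//.
Qed.

Lemma opos_add f g : opos f -> opos g -> opos (fun x => f x + g x).
Proof.
move=> [t t0 ft] [s s0 gs]; exists (t + s) => [|x]; first by rewrite addr_gt0.
rewrite scalerDl opprD addrACA (le_trans (ler_normD _ _))// mulrDl lerD//.
Qed.

Lemma opos_scale f (c : C) : 0 < c -> opos f -> opos (fun x => c *: f x).
Proof.
move=> c0 [t t0 ft]; exists (c * t) => [|x]; first by rewrite mulr_gt0.
by rewrite -scalerA -scalerBr normrZ gtr0_norm// -mulrA ler_wpM2l// ltW.
Qed.

Lemma eq_opos f g : f =1 g -> opos f -> opos g.
Proof. by move=> /funext ->. Qed.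

(** Apart from 0, d d' and d' d have the same spectrum. In terms of powers, (t - d' d)^n d' d = d'
    (t - d d')^n d, to which [opos_power] applies. *)
Lemma opos_swap (d d' : A -> A) : lin d -> lin d' ->
  (exists2 M : C, 0 <= M & forall x, `|d x| <= M * `|x|) ->
  (exists2 M : C, 0 <= M & forall x, `|d' x| <= M * `|x|) ->
  (forall x y, astar (d x) ** y = astar x ** d' y) ->
  opos (d \o d') -> opos (d' \o d).
Proof.
move=> dl dl' db db' dd [t t0 ht].
have dd' x y : astar (d' x) ** y = astar x ** d y.
  by rewrite -[LHS]astarK astarM astarK -dd astarM astarK.
have sb : sop (d' \o d).
  split; [by move=> c x y /=; rewrite dl dl'|by move=> x y /=; rewrite dd' dd|].
  exact: (bnd_comp db' db).
have [M M0 dM] := db; have [N N0 dN] := db'.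
apply: (@opos_power _ _ (d' \o d) t (N * M)); rewrite ?mulr_ge0// => n x.
have -> : iter n (fun y => t *: y - (d' \o d) y) ((d' \o d) x) =
    d' (iter n (fun y => t *: y - d (d' y)) (d x)).
  by elim: n => //= n ->; rewrite (linB dl') (linZ dl').
rewrite -2!mulrA (le_trans (dN _))// ler_wpM2l//.
apply: (@le_trans _ _ (t ^+ n * `|d x|)); last first.
  by rewrite mulrCA ler_wpM2l ?exprn_ge0 ?(ltW t0).
elim: n => [|n IH]; first by rewrite mul1r.
by rewrite exprS -mulrA (le_trans (ht _))// ler_wpM2l ?(ltW t0).
Qed.

(** Here k is the absolute value of h, the root of h^2, and q = (k - h)/2 its negative part.
    Positivity of q follows from q^2 = q k: it gives (t - q)^n q = q (t - k)^n. *)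
Lemma neg_part h : sop h -> exists q k, [/\ sop q, opos q, opos k,
  forall x, h x = k x - 2 *: q x & forall x, h (q x) = - q (q x)].
Proof.
move=> sh; have hl := sop_lin sh.
have [|k [sk pk kk kc]] := opos_sqrt (sop_comp sh sh (fun=> erefl)).
  exact: opos_sqr.
have kl := sop_lin sk.
have hk x : h (k x) = k (h x) by apply: kc => //; case: sh.
pose q x := 2^-1 *: (k x - h x).
have sq : sop q.
  by apply: sop_scale (sop_sub sk sh); rewrite rpredV ger0_real// ler0n.
have qk x : q (k x) = 2^-1 *: (k (k x) - h (k x)) by [].
have hq x : h (q x) = - q (k x).
  by rewrite qk /q (linZ hl) (linB hl) -scalerN opprB kk.
have kq x : k (q x) = q (k x).
  by rewrite qk /q (linZ kl) (linB kl) -hk.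
have qq x : q (q x) = q (k x).
  rewrite {1}/q kq hq opprK -[X in _ *: (X + _)]scale1r -[X in _ *: (_ + X)]scale1r.
  by rewrite -scalerDl scalerA mulVf ?scale1r// pnatr_eq0.
exists q, k; split=> //.
- have [t t0 ht] := pk; have [M M0 qM] := sop_bnd sq.
  apply: (@opos_power _ _ q t M) => // n x.
  have -> : iter n (fun y => t *: y - q y) (q x) = q (iter n (fun y => t *: y - k y) x).
    by elim: n => //= n ->; rewrite qq (linB (sop_lin sq)) (linZ (sop_lin sq)).
  rewrite -mulrA (le_trans (qM _))// ler_wpM2l//.
  elim: n => [|n IH]; first by rewrite mul1r.
  by rewrite exprS -mulrA (le_trans (ht _))// ler_wpM2l ?(ltW t0).
- move=> x; rewrite /q scalerA mulfV ?pnatr_eq0// scale1r opprB addrC subrK//.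
- by move=> x; rewrite qq hq.
Qed.

(** The roots u of f and v of -f commute and u^2 + v^2 = 0, so [sop_pair] with s = 0 gives u = 0. *)
Lemma opos_neg0 f : sop f -> opos f -> opos (fun x => - f x) -> forall x, f x = 0.
Proof.
move=> sf pf nf.
have snf : sop (fun x => - f x).
  apply: (@eq_sop _ _ (fun x => (-1) *: f x)); first by move=> x; rewrite scaleN1r.
  by apply: sop_scale => //; rewrite rpredN real1.
have [u [su _ uu uc]] := opos_sqrt sf pf; have [v [sv _ vv vc]] := opos_sqrt snf nf.
have ul := sop_lin su.
have uv x : u (v x) = v (u x).
  apply: vc => //; first by case: su.
  by move=> y; rewrite (linN ul) -!uu.
move=> x; have := sop_pair (u x) su sv uv (s := 0).
rewrite sqrtC0 mul0r uu => /(_ _ _)/= h; apply/eqP; rewrite -normr_le0; apply: h => //.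
by move=> y; rewrite uu vv subrr scale0r.
Qed.

Lemma sop_sq0 f : sop f -> (forall x, f (f x) = 0) -> forall x, f x = 0.
Proof.
move=> sf h x; have := sop_sq x sf; rewrite h normr0 mulr0 => h1.
by apply/eqP; rewrite -normr_eq0 -sqrf_eq0 eq_le h1 exprn_ge0.
Qed.

(** Let q be the negative part of c^*c and d = c q, so that d^*d = - q^3. Then d d^* = (h1^2 +
    h2^2)/2 + q^3 >= 0, where h1 and h2 are, up to a factor, the real and imaginary parts of d.
    Exchanging the factors makes - q^3 positive too, whence q = 0. *)
Theorem fukamiya (c : A) : opos (amul (astar c ** c)).
Proof.
set h := amul _; have sh : sop h by apply: sop_amul; rewrite astarM astarK.
have [q [k [sq pq pk hk hq]]] := neg_part sh.
have ql := sop_lin sq; have qb := sop_bnd sq.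
pose d x := c ** q x; pose d' x := q (astar c ** x).
have cb (b : A) : exists2 M : C, 0 <= M & forall x, `|b ** x| <= M * `|x|.
  by exists `|b| => // x; exact: anorm_mul.
have dl : lin d by move=> e x y; rewrite /d ql amulDr amulZr.
have dl' : lin d' by move=> e x y; rewrite /d' amulDr amulZr ql.
have db := bnd_comp (cb c) qb; have db' := bnd_comp qb (cb (astar c)).
have dd x y : astar (d x) ** y = astar x ** d' y.
  by rewrite /d astarM -amulA (sop_sa sq).
have dd' x y : astar (d' x) ** y = astar x ** d y.
  by rewrite -[LHS]astarK astarM astarK -dd astarM astarK.
have d'd x : d' (d x) = - q (q (q x)).
  by rewrite /d' /d amulA -[_ ** q x]/(h (q x)) hq (linN ql).
have sqq : sop (q \o q) by exact: sop_comp.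
have q3s : sop (fun x => q (q (q x))) by exact: (sop_comp sq sqq).
have q3p : opos (fun x => q (q (q x))).
  have [r [sr _ rr rc]] := opos_sqrt sq pq.
  have rq x : r (q x) = q (r x) by rewrite -!rr.
  have := opos_sqr (sop_comp sr sq rq); apply: eq_opos => x /=.
  by rewrite -rq rr.
pose h1 x := d x + d' x; pose h2 x := 'i *: (d x - d' x).
have h1s : sop h1.
  split.
  - by move=> e x y; rewrite /h1 dl dl' scalerDr addrACA.
  - by move=> x y; rewrite /h1 astarD amulDl amulDr dd dd' addrC.
  - have [M M0 hM] := db; have [N N0 hN] := db'; exists (M + N); rewrite ?addr_ge0// => x.
    by rewrite (le_trans (ler_normD _ _))// mulrDl; apply: lerD; [exact: hM|exact: hN].
have h2s : sop h2.
  split.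
  - by move=> e x y; rewrite /h2 dl dl' opprD addrACA -scalerBr scalerDr !scalerA mulrC.
  - move=> x y; rewrite /h2 astarZ astarB amulZl amulBl amulZr amulBr dd dd'.
    by rewrite conjCi scaleNr -scalerN opprB.
  - have [M M0 hM] := db; have [N N0 hN] := db'; exists (M + N); rewrite ?addr_ge0// => x.
    by rewrite normrZ normCi mul1r (le_trans (ler_normB _ _))// mulrDl; apply: lerD; [exact: hM|exact: hN].
have key x : h1 (h1 x) + h2 (h2 x) = 2 *: (d (d' x) + d' (d x)).
  rewrite /h1 /h2 !(linZ dl) !(linZ dl') -scalerBr scalerA -expr2 sqrCi scaleN1r.
  rewrite !(linD dl) !(linD dl') !(linN dl) !(linN dl').
  rewrite !opprD !opprK !addrA [LHS](ACl (1*5*4*8*2*3*6*7))/= subrr add0r subrr add0r.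
  by rewrite scaler_nat mulr2n !addrA.
have ddp : opos (d \o d').
  have : opos (fun x => 2^-1 *: (h1 (h1 x) + h2 (h2 x)) + q (q (q x))).
    apply: opos_add => //; apply: opos_scale; first by rewrite invr_gt0 ltr0n.
    by apply: opos_add; exact: opos_sqr.
  apply: eq_opos => x /=; rewrite key scalerA mulVf ?pnatr_eq0// scale1r d'd.
  by rewrite subrK.
have := opos_swap dl dl' db db' dd ddp; move=> np.
have q0 : forall x, q x = 0.
  have q30 : forall x, q (q (q x)) = 0.
    by apply: opos_neg0 => //; apply: eq_opos np => x /=; rewrite d'd.
  apply: sop_sq0 => //; apply: (@sop_sq0 (q \o q)) => // x /=.
  by rewrite q30.
by apply: eq_opos pk => x; rewrite hk q0 scaler0 subr0.
Qed.

End Fukamiya.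

(** * Hilbert modules *)

Section Positivity.
Variables (R : realType) (A : cstarType R).
Local Notation C := (cplx R).
Local Notation "a ** b" := (amul a b) (at level 40, left associativity).
Implicit Types (a b c d : A).

Definition cpos a := astar a = a /\ opos (amul a).

Lemma cpos_sq c : cpos (astar c ** c).
Proof. by split; [rewrite astarM astarK|exact: fukamiya]. Qed.

Lemma cposD a b : cpos a -> cpos b -> cpos (a + b).
Proof.
move=> [sa pa] [sb pb]; split; first by rewrite astarD sa sb.
by apply: eq_opos (opos_add pa pb) => x; rewrite amulDl.
Qed.

Lemma cpos0 : cpos 0.
Proof. by rewrite -(amul0r (astar 0)); exact: cpos_sq. Qed.

Lemma cpos_sum I (s : seq I) (P : pred I) (F : I -> A) :
  (forall i, P i -> cpos (F i)) -> cpos (\sum_(i <- s | P i) F i).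
Proof. by move=> h; apply: big_ind => //; [exact: cpos0|exact: cposD]. Qed.

Lemma norm_bound_op a (s : C) : 0 <= s -> (forall z, `|a ** z| <= s * `|z|) -> `|a| <= s.
Proof.
move=> s0 h; have [->|a0] := eqVneq a 0; first by rewrite normr0.
have ap : 0 < `|a| by rewrite normr_gt0.
rewrite -(ler_pM2r ap) -{3}(norm_astar a) (le_trans _ (h _))//.
by have := anorm_star (astar a); rewrite astarK norm_astar expr2 => <-.
Qed.

(** For s > |a + d| the element s - a = (s - (a + d)) + d is positive. The roots u of a and v of s -
    a satisfy u^2 + v^2 = s, so |u|^2 <= s and |a| <= s. *)
Lemma norm_le_cpos a d : cpos a -> cpos d -> `|a| <= `|a + d|.
Proof.
move=> [sa pa] [sd pd]; apply: le_addeps => e e0; set s := `|a + d| + e.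
have s0 : 0 < s by rewrite ltr_wpDl.
have san := sop_amul sa.
pose g x := s *: x - a ** x.
have sg : sop g by apply: sop_sub san; apply: sop_scale (gtr0_real s0) (sop_id A).
have pg : opos g.
  have : opos (fun x => (s *: x - (a + d) ** x) + d ** x).
    apply: opos_add => //; exists s => // x.
    rewrite opprB addrC subrK (le_trans (anorm_mul _ _))// ler_wpM2r//.
    by rewrite lerDl ltW.
  by apply: eq_opos => x; rewrite amulDl opprD addrA subrK.
have [u [su _ uu uc]] := opos_sqrt san pa; have [v [sv _ vv vc]] := opos_sqrt sg pg.
have uv x : u (v x) = v (u x).
  apply: vc; [by case: su|by case: su|] => y.
  by rewrite /g (linB (sop_lin su)) (linZ (sop_lin su)) -!uu.
have hu x : `|u x| <= sqrtC s * `|x|.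
  apply: (sop_pair x su sv) => // [y|]; last exact: ltW.
  by rewrite uu vv /g addrC subrK.
have q0 : 0 <= sqrtC s by rewrite sqrtC_ge0 ltW.
apply: norm_bound_op => [|z]; first exact: ltW.
rewrite -uu (le_trans (hu _))// (le_trans (ler_wpM2l q0 (hu _)))//.
by rewrite mulrA -expr2 sqrtCK.
Qed.

(* [c] is [sqrt (s - a) b], computed in the multiplier algebra. *)
Lemma sub_square a (s : C) b : astar a = a -> `|a| <= s -> 0 < s ->
  exists c, astar c ** c = s *: (astar b ** b) - astar b ** a ** b.
Proof.
move=> sa as_ s0; pose f x := s *: x - a ** x.
have sf : sop f.
  by apply: sop_sub (sop_amul sa); apply: sop_scale (gtr0_real s0) (sop_id A).
have pf : opos f.
  exists s => // x; rewrite /f opprB addrC subrK (le_trans (anorm_mul _ _))//.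
  by rewrite ler_wpM2r.
have [g [sg _ gg _]] := opos_sqrt sf pf.
exists (g b); rewrite (sop_sa sg) gg /f amulBr amulZr amulA//.
Qed.

End Positivity.

Section HilbertModules.
Variables (R : realType) (A : cstarType R) (F : hilbmodType A).
Local Notation C := (cplx R).
Local Notation "a ** b" := (amul a b) (at level 40, left associativity).
Implicit Types (x y z : F) (a b : A).

Local Notation mip := (@mip R A F).

Lemma mipDr x y z : mip x (y + z) = mip x y + mip x z.
Proof. by rewrite -[y]scale1r mip_linear !scale1r. Qed.

Lemma mip0r x : mip x 0 = 0.
Proof. by apply: (addrI (mip x 0)); rewrite -mipDr !addr0. Qed.

Lemma mipZr (c : C) x y : mip x (c *: y) = c *: mip x y.
Proof. by rewrite -[_ *: y]addr0 mip_linear mip0r addr0. Qed.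

Lemma mipNr x y : mip x (- y) = - mip x y.
Proof. by rewrite -scaleN1r mipZr scaleN1r. Qed.

Lemma mipBr x y z : mip x (y - z) = mip x y - mip x z.
Proof. by rewrite mipDr mipNr. Qed.

Lemma mipDl x y z : mip (x + y) z = mip x z + mip y z.
Proof. by rewrite -[LHS]mip_star mipDr astarD !mip_star. Qed.

Lemma mip0l x : mip 0 x = 0.
Proof. by rewrite -mip_star mip0r astar0. Qed.

Lemma mipZl (c : C) x y : mip (c *: x) y = c^* *: mip x y.
Proof. by rewrite -[LHS]mip_star mipZr astarZ !mip_star. Qed.

Lemma mip_sumr I (s : seq I) (P : pred I) x (G : I -> F) :
  mip x (\sum_(i <- s | P i) G i) = \sum_(i <- s | P i) mip x (G i).
Proof. by apply: (big_morph (mip x)); [exact: mipDr|exact: mip0r]. Qed.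

Lemma mip_suml I (s : seq I) (P : pred I) x (G : I -> F) :
  mip (\sum_(i <- s | P i) G i) x = \sum_(i <- s | P i) mip (G i) x.
Proof. by apply: (big_morph (fun y => mip y x)) => [y z|]; rewrite (mipDl, mip0l). Qed.

Lemma mip_ractl x y a : mip (ract x a) y = astar a ** mip x y.
Proof. by rewrite -[LHS]mip_star mip_ract astarM mip_star. Qed.

Lemma mip_eq0 x : mip x x = 0 -> x = 0.
Proof.
by move=> h; apply/eqP; rewrite -normr_eq0 -sqrf_eq0 -mip_norm h normr0.
Qed.

Lemma mip_injr x y : (forall z, mip z x = mip z y) -> x = y.
Proof.
move=> h; apply/eqP; rewrite -subr_eq0; apply/eqP/mip_eq0.
by rewrite mipBr h subrr.
Qed.

Lemma cpos_mip x : cpos (mip x x).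
Proof. by have [b ->] := mip_ge0 x; exact: cpos_sq. Qed.

(** The inner product of F^k, in which the matrix norms of [linking_norm_le] are computed. *)
Definition fip k (x y : 'I_k -> F) : A := \sum_i mip (x i) (y i).

Lemma fip_cpos k (x : 'I_k -> F) : cpos (fip x x).
Proof. by apply: cpos_sum => i _; exact: cpos_mip. Qed.

Lemma fip_star k (x y : 'I_k -> F) : astar (fip x y) = fip y x.
Proof. by rewrite astar_sum; apply: eq_bigr => i _; rewrite mip_star. Qed.

Lemma fip_linr k (c : C) (x y w : 'I_k -> F) :
  fip x (fun i => c *: y i - w i) = c *: fip x y - fip x w.
Proof.
rewrite /fip scaler_sumr -sumrB; apply: eq_bigr => i _.
by rewrite mipBr mipZr.
Qed.

Lemma fip_linl k (c : C) (x y w : 'I_k -> F) :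
  fip (fun i => c *: y i - w i) x = c^* *: fip y x - fip w x.
Proof. by rewrite -fip_star fip_linr astarB astarZ !fip_star. Qed.

Lemma fip_ractr k (x y : 'I_k -> F) a : fip x (fun i => ract (y i) a) = fip x y ** a.
Proof. by rewrite /fip amul_suml; apply: eq_bigr => i _; rewrite mip_ract. Qed.

Lemma fip_ractl k (x y : 'I_k -> F) a : fip (fun i => ract (x i) a) y = astar a ** fip x y.
Proof. by rewrite -fip_star fip_ractr astarM fip_star. Qed.

(** Let a = <y,x>, P = <y,y>, s >= |P| and z = s x - y a. Then s^2 <x,x> = s a^*a + <z,z> + c^*c,
    where c^*c = s a^*a - a^*P a by [sub_square]. Norms are monotone on positive elements, so |a|^2
    <= s |x|^2; finally s decreases to |P|. *)
Lemma fip_cs k (x y : 'I_k -> F) : `|fip x y| ^+ 2 <= `|fip x x| * `|fip y y|.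
Proof.
set P := fip y y; set a := fip y x.
have -> : `|fip x y| = `|a| by rewrite /a -fip_star norm_astar.
have key (s : C) : 0 < s -> `|P| <= s -> `|a| ^+ 2 <= s * `|fip x x|.
  move=> s0 Ps; have [c hc] := sub_square a (proj1 (fip_cpos y)) Ps s0.
  pose z i := s *: x i - ract (y i) a.
  have zz : fip z z = s *: (s *: fip x x - astar a ** a)
      - (s *: (astar a ** a) - astar a ** P ** a).
    rewrite /z fip_linl !fip_linr !fip_ractr !fip_ractl -/P -/a -(fip_star y x) -/a.
    by rewrite (conj_Creal (gtr0_real s0)).
  have e : s ^+ 2 *: fip x x = s *: (astar a ** a) + (fip z z + astar c ** c).
    rewrite zz hc scalerBr scalerA expr2 !opprD !opprK.
    set u := (s * s) *: _; set v := s *: _; set w := astar a ** P ** a.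
    by rewrite !addrA [RHS](ACl (1*3*4*6*5*7*2))/= subrr add0r addNr add0r subrr add0r.
  have : `|s *: (astar a ** a)| <= `|s ^+ 2 *: fip x x|.
    rewrite e; apply: norm_le_cpos.
      by rewrite -[s]sqrtCK expr2 -scalerA -amulZr -amulZl -{1}[sqrtC s]conj_Creal
        ?ger0_real ?sqrtC_ge0 ?(ltW s0)// -astarZ; exact: cpos_sq.
    by apply: cposD; [exact: fip_cpos|exact: cpos_sq].
  rewrite normrZ (normrZ (s ^+ 2)) normrX (gtr0_norm s0) anorm_star.
  by rewrite expr2 -mulrA ler_pM2l.
rewrite mulrC; apply: le_addeps => e e0; have x1 : 0 < `|fip x x| + 1 by rewrite ltr_wpDl.
have d0 : 0 < e / (`|fip x x| + 1) by rewrite divr_gt0.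
apply: le_trans (key (`|P| + e / (`|fip x x| + 1)) _ _) _.
- by rewrite ltr_wpDl.
- by rewrite lerDl ltW.
rewrite mulrDl lerD2l mulrAC ler_pdivrMr// ler_wpM2l ?(ltW e0)//.
by rewrite lerDl.
Qed.

End HilbertModules.

Lemma le_factor_eps (R : realType) (u v w : cplx R) : 0 <= v -> 0 <= w ->
  (forall r, v < r -> u <= r * w) -> u <= v * w.
Proof.
move=> v0 w0 h; apply: le_addeps => e e0.
have w1 : 0 < w + 1 by rewrite ltr_wpDl.
apply: le_trans (h (v + e / (w + 1)) _) _; first by rewrite ltrDl divr_gt0.
rewrite mulrDl lerD2l mulrAC ler_pdivrMr// ler_wpM2l ?(ltW e0)//.
by rewrite lerDl.
Qed.

Section Modules.
Variables (R : realType) (A : cstarType R).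
Local Notation C := (cplx R).
Local Notation "a ** b" := (amul a b) (at level 40, left associativity).

Lemma norm_mip (F : hilbmodType A) (x y : F) : `|mip x y : A| <= `|x| * `|y|.
Proof.
rewrite -(@ler_pXn2r _ 2)// ?nnegrE ?mulr_ge0// exprMn -!mip_norm.
by have := fip_cs (fun _ : 'I_1 => x) (fun=> y); rewrite /fip !big_ord1.
Qed.

Lemma norm_ract (F : hilbmodType A) (x : F) (a : A) : `|ract x a| <= `|x| * `|a|.
Proof.
rewrite -(@ler_pXn2r _ 2)// ?nnegrE ?mulr_ge0// exprMn -!mip_norm.
have [b hb] := mip_ge0 x; rewrite mip_ract mip_ractl hb.
have -> : astar a ** (astar b ** b) ** a = astar (b ** a) ** (b ** a).
  by rewrite astarM !amulA.
by rewrite !anorm_star -exprMn lerXn2r ?nnegrE ?mulr_ge0// anorm_mul.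
Qed.

Section Correspondences.
Variable F : corrType A.
Implicit Types (x y : F) (a b : A).

Lemma mip_lactr x y a : mip x (lact a y) = mip (lact (astar a) x) y.
Proof. by rewrite lact_adj astarK. Qed.

Lemma lact_linl x : lin (fun a => lact a x : F).
Proof. by move=> c a b; exact: lact_linear. Qed.

End Correspondences.

Section StarReps.
Variables (H : hilbertType R) (s : A -> bop H H).
Hypothesis ss : star_rep s.
Implicit Types (a b : A) (x y : H).

Lemma srep_linl x : lin (fun a => s a x).
Proof. by case: ss => h _ _ c a b; exact: h. Qed.

Lemma srepM a b x : s (a ** b) x = s a (s b x).
Proof. by case: ss. Qed.

Lemma srep_adj a x y : hip (s a x) y = hip x (s (astar a) y).
Proof. by case: ss => _ _; apply. Qed.

Lemma srep_adjr a x y : hip x (s a y) = hip (s (astar a) x) y.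
Proof. by rewrite srep_adj astarK. Qed.

Lemma srep_norm a x : `|s a x| <= `|a| * `|x|.
Proof.
have key (b : A) (r : C) y : `|b| < r -> 0 < r ->
    `|s b (s (astar b) y)| <= r * `|s (astar b) y|.
  move=> br r0; have r20 : 0 < r ^+ 2 by rewrite exprn_gt0.
  have [||c hc] := @sub_square _ _ (astar b ** b) (r ^+ 2) (astar b) _ _ r20.
  - by rewrite astarM astarK.
  - by rewrite anorm_star lerXn2r ?nnegrE ?(ltW r0)// ltW.
  rewrite -(@ler_pXn2r _ 2)// ?nnegrE ?mulr_ge0 ?(ltW r0)// exprMn -!hip_norm.
  rewrite -subr_ge0; apply: le_trans (hip_ge0 (s c y)) _.
  rewrite !srep_adj -!srepM hc (linB (srep_linl y)) (linZ (srep_linl y)).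
  by rewrite hipBr hipZr astarK !amulA.
apply: le_factor_eps => // r ar; have r0 : 0 < r by apply: le_lt_trans ar.
have [->|ax] := eqVneq (s a x) 0; first by rewrite normr0 mulr_ge0 ?(ltW r0).
have axp : 0 < `|s a x| by rewrite normr_gt0.
rewrite -(ler_pM2r axp) -expr2 -hip_norm srep_adj -[leLHS]ger0_norm; last first.
  by rewrite -srep_adj hip_ge0.
rewrite (le_trans (hip_cs _ _))//.
have h : `|s (astar a) (s a x)| <= r * `|s a x|.
  by have := key (astar a) r x; rewrite astarK norm_astar; exact.
apply: le_trans (ler_wpM2l (normr_ge0 x) h) _.
by rewrite mulrCA mulrA.
Qed.

End StarReps.

End Modules.

(** * Interior tensor products with Hilbert spaces *)

Section OperatorRoot.
Variables (R : realType) (H : hilbertType R).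
Local Notation C := (cplx R).

Lemma positive_cs (T : H -> H) x y : lin T -> (forall x y, hip (T x) y = hip x (T y)) ->
  (forall x, 0 <= hip x (T x)) ->
  `|hip x (T y)| ^+ 2 <= hip x (T x) * hip y (T y).
Proof.
move=> lT sT pT; apply: quadratic_ineq => // c.
have := pT (x + c *: y); rewrite (linD lT) (linZ lT) hipDl !hipDr !hipZl !hipZr.
rewrite rmorphM /= hip_conj sT => h; apply: le_trans h _.
by rewrite normCK le_eqVlt; apply/orP; left; apply/eqP; ring.
Qed.

(** Cauchy-Schwarz for the form <., T .> at the vectors x and T x, using T <= 1 at T x. *)
Lemma positive_contraction (T : H -> H) : lin T -> (forall x y, hip (T x) y = hip x (T y)) ->
  (forall x, 0 <= hip x (T x)) -> (forall x, hip x (T x) <= `|x| ^+ 2) ->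
  forall x, `|T x| ^+ 2 <= hip x (T x).
Proof.
move=> lT sT pT bT x; have h := positive_cs x (T x) lT sT pT.
rewrite -sT hip_norm normrX normr_id in h.
have [->|Tx] := eqVneq (T x) 0; first by rewrite normr0 expr0n hip0r.
have Tp : 0 < `|T x| ^+ 2 by rewrite exprn_gt0// normr_gt0.
rewrite -(ler_pM2r Tp) -expr2 (le_trans h)// ler_wpM2l//.
Qed.

(** The construction of [opos_sqrt] with a = 1 - T/M, where 0 <= a <= 1 as a form makes a
    contractive. The constant M exceeds a norm bound by 1 so as to be invertible. *)
Lemma bop_sqrt (T : bop H H) : (forall x y, hip (T x) y = hip x (T y)) ->
  (forall x, 0 <= hip x (T x)) ->
  exists S : bop H H, [/\ forall x y, hip (S x) y = hip x (S y),
    forall x, 0 <= hip x (S x), forall x, S (S x) = T x &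
    forall B : bop H H, (forall x, B (T x) = T (B x)) -> forall x, B (S x) = S (B x)].
Proof.
move=> sT pT; have [M0 M00 TM0] := bop_bounded T; pose M := M0 + 1.
have Mp : 0 < M by rewrite ltr_wpDl.
have TM x : `|T x| <= M * `|x|.
  by rewrite (le_trans (TM0 x))// ler_wpM2r// lerDl.
have lT : lin T by move=> c x y; rewrite linearP.
have Mr : (M^-1)^* = M^-1 by rewrite conj_Creal// rpredV gtr0_real.
pose a x := x - M^-1 *: T x.
have la : lin a by move=> c x y; rewrite /a lT scalerBr scalerDr !scalerA
  [c * _]mulrC opprD addrACA.
have sa x y : hip (a x) y = hip x (a y).
  by rewrite /a hipBl hipBr hipZl hipZr sT Mr.
have ha x : hip x (a x) = `|x| ^+ 2 - M^-1 * hip x (T x).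
  by rewrite /a hipBr hipZr hip_norm.
have pa x : 0 <= hip x (a x).
  rewrite ha subr_ge0 mulrC ler_pdivrMr// -[leLHS]ger0_norm//.
  rewrite (le_trans (hip_cs _ _))// expr2 -mulrA ler_wpM2l// mulrC//.
have aN x : `|a x| <= `|x|.
  rewrite -(@ler_pXn2r _ 2)// ?nnegrE// (le_trans (positive_contraction la sa pa _ x))//.
    by move=> z; rewrite ha gerBl mulr_ge0// invr_ge0 ltW.
  by rewrite ha gerBl mulr_ge0// invr_ge0 ltW.
have [y [yl yN yy yc]] := banach_sqrt la aN.
have [||S hS] := @bopP R H H (fun x => sqrtC M *: (x - y x)) (sqrtC M * 2).
- move=> c x z; rewrite yl opprD addrACA -scalerBr scalerDr !scalerA mulrC//.
- move=> x; rewrite normrZ ger0_norm ?sqrtC_ge0 ?(ltW Mp)// -mulrA ler_wpM2l//.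
    by rewrite sqrtC_ge0 ltW.
  by rewrite (le_trans (ler_normB _ _))// mulr_natl mulr2n lerD.
have sMr : (sqrtC M)^* = sqrtC M by rewrite conj_Creal// ger0_real// sqrtC_ge0 ltW.
have sS x z : hip (S x) z = hip x (S z).
  rewrite !hS hipZl hipZr sMr; congr (_ * _); rewrite hipBl hipBr; congr (_ - _).
  have h1 : (fun n => hip (pact a (sqrt_poly R n) x) z) @ \oo --> hip (y x) z.
    by apply: cvg_hip => //; exact: cvg_cst.
  apply: clim_unique h1 _.
  rewrite (_ : (fun n => _) = (fun n => hip x (pact a (sqrt_poly R n) z))).
    by apply: cvg_hip => //; exact: cvg_cst.
  apply/funext => n; rewrite /pact hip_suml hip_sumr.
  apply: eq_bigr => i _; rewrite hipZl hipZr.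
  rewrite (conj_Creal (ger0_real (sqrt_poly_ncoef _ _ _))); congr (_ * _).
  elim: (i : nat) x z => //= m IH x z.
  by rewrite sa IH -iterSr iterS.
exists S; split=> //.
- move=> x; have yr : hip x (y x) \is Num.real.
    have -> : hip x (y x) = `|x| ^+ 2 - (sqrtC M)^-1 * hip x (S x).
      by rewrite hS hipZr mulKf ?sqrtC_eq0 ?gt_eqF// hipBr hip_norm opprB addrC subrK.
    apply: rpredB; first by rewrite ger0_real ?exprn_ge0.
    apply: rpredM; first by rewrite ger0_real ?invr_ge0 ?sqrtC_ge0 ?(ltW Mp).
    by rewrite CrealE hip_conj sS.
  rewrite hS hipZr mulr_ge0 ?sqrtC_ge0 ?(ltW Mp)// hipBr hip_norm subr_ge0.
  apply: le_trans (real_ler_norm yr) _; apply: le_trans (hip_cs _ _) _.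
  by rewrite expr2 ler_wpM2l.
- move=> x; rewrite !hS (linZ yl) -scalerBr scalerA -expr2 sqrtCK (linB yl) yy.
  rewrite (_ : _ - _ = M^-1 *: T x).
    by rewrite scalerA mulfV ?gt_eqF// scale1r.
  rewrite /a scaler_nat mulr2n opprB opprB !addrA.
  by rewrite subrK -addrA -opprD [x + y x + _]addrC addrK.
- move=> B BT x; rewrite !hS linearZ linearB /=; congr (_ *: (_ - _)).
  have h1 : (fun n => B (pact a (sqrt_poly R n) x)) @ \oo --> B (y x) by exact: bop_cvg.
  have Bl : lin B by move=> c u v; rewrite linearP.
  have e p z : B (pact a p z) = pact a p (B z).
    by apply: pact_comm => // w; rewrite /a (linB Bl) (linZ Bl) BT.
  by apply: lim_unique h1 _; under eq_fun do rewrite e; exact: yc.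
Qed.

End OperatorRoot.

Section IsometricExtension.
Variables (R : realType).
Local Notation C := (cplx R).

Lemma iso_extension (G H : hilbertType R) I (t : I -> G) (f : I -> H) :
  total_family t -> (forall i j, hip (f i) (f j) = hip (t i) (t j)) ->
  exists J : bop G H, isometric_bop J /\ forall i, J (t i) = f i.
Proof.
move=> tt ft; have [l|J [Jt _ _]] := @extension R G H I t f 1 ler01.
  rewrite mul1r -(@ler_pXn2r _ 2)// ?nnegrE// -!hip_norm !hip_lc.
  by rewrite (_ : (fun i j => hip (f i) (f j)) = fun i j => hip (t i) (t j))//;
    apply/funext => i; apply/funext => j.
exists J; split=> // x y; rewrite adjEr -[adj J (J x)]bcompE.
rewrite (@bop_total R _ _ _ t (bcomp (adj J) J) (bid G)) ?bidE// => i.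
rewrite bcompE bidE; apply: hip_total tt _ => j.
by rewrite -adjEr !Jt ft.
Qed.

Lemma cvg_bigsum I (s : seq I) (F : I -> nat -> C) (l : I -> C) :
  (forall i, F i @ \oo --> l i) -> (fun n => \sum_(i <- s) F i n) @ \oo --> \sum_(i <- s) l i.
Proof.
move=> h; elim: s => [|i s IH].
  rewrite big_nil (_ : (fun n => _) = fun=> 0); first exact: cvg_cst.
  by apply/funext => n; rewrite big_nil.
rewrite big_cons (_ : (fun n => _) = fun n => F i n + \sum_(j <- s) F j n).
  by apply: cvgD.
by apply/funext => n; rewrite big_cons.
Qed.

End IsometricExtension.

(** * Positivity of the form defining F (x) H *)

Section TensorPositivity.
Variables (R : realType) (A : cstarType R) (F : hilbmodType A) (H : hilbertType R).
Local Notation C := (cplx R).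
Variable s : A -> bop H H.
Hypothesis ss : star_rep s.

Definition tform (w : seq (F * H)) : C :=
  \sum_(p <- w) \sum_(q <- w) hip p.2 (s (mip p.1 q.1) q.2).

Let s_lc h l : lc (fun a => s a h) l = s (lc id l) h.
Proof.
elim: l => [|[c a] l IH].
  by rewrite /lc !big_nil (lin0 (srep_linl ss h)).
by rewrite /lc !big_cons /= [RHS](srep_linl ss h); congr (_ + _); exact: IH.
Qed.

(** When all vectors lie in the orbit of one h, the form is <h, s(<y,y>) h> with y = sum x_i a_i. *)
Lemma tform_cyclic h (w : seq (F * A)) :
  0 <= tform [seq (p.1, s p.2 h) | p <- w].
Proof.
pose y := \sum_(p <- w) ract p.1 p.2.
have [b hb] := mip_ge0 y.
rewrite (_ : tform _ = hip h (s (mip y y) h)); last first.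
  rewrite /tform big_map /y mip_suml.
  rewrite (lin_sum (srep_linl ss h)) hip_sumr; apply: eq_bigr => p _.
  rewrite big_map mip_sumr (lin_sum (srep_linl ss h)) hip_sumr; apply: eq_bigr => q _ /=.
  by rewrite mip_ract mip_ractl !(srepM ss) (srep_adj ss).
by rewrite hb (srepM ss) (srep_adjr ss) astarK hip_ge0.
Qed.

(** Induction on the number of terms. Each vector is split along the closure of s(A) h1 and its
    complement, both invariant. The first parts are limits of the cyclic case; on the complement the
    first term drops out because s(a) annihilates the complementary part of h1. *)
Lemma tform_ge0 w : 0 <= tform w.
Proof.
elim: {w}(size w) {-2}w (erefl (size w)) => [|n IH] [|[x1 h1] w]//=.
  by move=> _; rewrite /tform big_nil.
move=> [wn]; have [W WE] : exists W, W = (x1, h1) :: w by exists ((x1, h1) :: w).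
rewrite -WE.
have /choice [g hg] h : exists gv : H * (nat -> A),
    (forall a, hip (h - gv.1) (s a h1) = 0) /\ (fun n => s (gv.2 n) h1) @ \oo --> gv.1.
  have [||g [g1 _ [l lg]]] := @family_riesz R H A (fun a => s a h1)
      (fun a => hip h (s a h1)) (`|h| ^+ 2).
  - by rewrite exprn_ge0.
  - by move=> l; rewrite -hip_lcr -exprMn lerXn2r ?nnegrE ?mulr_ge0// hip_cs.
  exists (g, fun n => lc id (l n)); split=> /= [a|]; first by rewrite hipBl g1 subrr.
  by under eq_fun do rewrite -s_lc.
pose gg h := (g h).1; pose vv h := h - gg h.
have vs h a : hip (vv h) (s a h1) = 0 by have [+ _] := hg h; exact.
have vsg h h' a : hip (vv h) (s a (gg h')) = 0.
  have [_ lg] := hg h'.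
  apply: (@clim_unique _ (fun n => hip (vv h) (s a (s ((g h').2 n) h1)))).
    by apply: cvg_hip; [exact: cvg_cst|apply: bop_cvg].
  rewrite (_ : (fun n => _) = fun=> 0); first exact: cvg_cst.
  by apply/funext => m; rewrite -(srepM ss) vs.
have gsv h h' a : hip (gg h) (s a (vv h')) = 0.
  by rewrite (srep_adjr ss) -hip_conj vsg rmorph0.
have v10 a : s a (vv h1) = 0.
  apply: hip_eq0; rewrite (srep_adj ss) -(srepM ss) {2}/vv linearB hipBr vsg subr0.
  exact: vs.
have -> : tform W = tform [seq (p.1, gg p.2) | p <- W] + tform [seq (p.1, vv p.2) | p <- W].
  rewrite /tform !big_map -big_split; apply: eq_bigr => p _ /=.
  rewrite !big_map -big_split; apply: eq_bigr => q _ /=.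
  have e h : h = gg h + vv h by rewrite /vv addrC subrK.
  by rewrite {1}(e p.2) {1}(e q.2) linearD hipDl !hipDr vsg gsv addr0 add0r.
rewrite addr_ge0//.
  have h1_ : (fun n => tform [seq (p.1, s ((g p.2).2 n) h1) | p <- W]) @ \oo -->
      tform [seq (p.1, gg p.2) | p <- W].
    rewrite /tform; under eq_fun do rewrite big_map; rewrite big_map.
    apply: cvg_bigsum => p /=; under eq_fun do rewrite big_map; rewrite big_map.
    apply: cvg_bigsum => q /=; apply: cvg_hip; first by have [_] := hg p.2.
    by apply: bop_cvg; have [_] := hg q.2.
  apply: ge0_limit h1_ => m.
  have := tform_cyclic h1 [seq (p.1, (g p.2).2 m) | p <- W].
  by rewrite -map_comp.
have -> : tform [seq (p.1, vv p.2) | p <- W] = tform [seq (p.1, vv p.2) | p <- w].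
  rewrite /tform WE /= !big_cons /=.
  rewrite v10 hip0r add0r big1 ?add0r.
    apply: eq_bigr => p _; rewrite big_cons /= v10 hip0r add0r//.
  by move=> p _; rewrite (srep_adjr ss) v10 hip0l.
by apply: IH; rewrite size_map.
Qed.

Lemma tensor_psd : psd (fun p q : F * H => hip p.2 (s (mip p.1 q.1) q.2)).
Proof.
split=> [p q|l]; first by rewrite hip_conj (srep_adj ss) mip_star.
have := tform_ge0 [seq (p.1 *: p.2.1, p.2.2) | p <- l].
rewrite /tform big_map (_ : \sum_(_ <- _) _ = kform (fun p q : F * H => hip p.2 (s (mip p.1 q.1) q.2)) l l)//.
apply: eq_bigr => p _; rewrite big_map; apply: eq_bigr => q _ /=.
rewrite mipZl mipZr (linZ (srep_linl ss _)) (linZ (srep_linl ss _)) !hipZr.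
by rewrite mulrA.
Qed.

End TensorPositivity.

Section Tensors.
Variables (R : realType) (A : cstarType R).
Local Notation C := (cplx R).
Local Notation "a ** b" := (amul a b) (at level 40, left associativity).

Definition uncur (F : hilbmodType A) (H G : hilbertType R) (t : F -> H -> G) (p : F * H) : G :=
  t p.1 p.2.

Definition htensor (F : hilbmodType A) (H G : hilbertType R)
    (s : A -> bop H H) (t : F -> H -> G) :=
  (forall x y h k, hip (t x h) (t y k) = hip h (s (mip x y) k)) /\ total_family (uncur t).

Lemma hilbert_tensorP (F : hilbmodType A) (H G : hilbertType R)
    (s : A -> bop H H) (t : F -> H -> G) : hilbert_tensor s t <-> htensor s t.
Proof.
split=> -[h1 h2]; split=> //.
  move=> v vt; have /total_closure := h2; apply => b [x [h ->]].
  exact: (vt (x, h)).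
apply/total_closure => v vt; apply: h2 => -[x h].
by apply: vt; exists x, h.
Qed.

Lemma tensor_ex (F : hilbmodType A) (H : hilbertType R) (s : A -> bop H H) :
  star_rep s -> exists (G : hilbertType R) (t : F -> H -> G), htensor s t.
Proof.
move=> ss; have [G [t [tt tot]]] := kernel_space (@tensor_psd R A F H s ss).
exists G, (fun x h => t (x, h)); split=> [x y h k|v hv]; first by rewrite tt.
by apply: tot => -[x h]; exact: (hv (x, h)).
Qed.

Section One.
Variables (F : hilbmodType A) (H G : hilbertType R) (s : A -> bop H H) (t : F -> H -> G).
Hypotheses (ss : star_rep s) (ht : htensor s t).

Lemma ht_ip x y h k : hip (t x h) (t y k) = hip h (s (mip x y) k).
Proof. by case: ht. Qed.

Lemma ht_total v : (forall x h, hip v (t x h) = 0) -> v = 0.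
Proof. by move=> h; case: ht => _; apply => -[x k]; exact: h. Qed.

Lemma ht_inj v w : (forall x h, hip v (t x h) = hip w (t x h)) -> v = w.
Proof.
move=> h; apply/eqP; rewrite -subr_eq0; apply/eqP/ht_total => x k.
by rewrite hipBl h subrr.
Qed.

Lemma ht_linr x : lin (t x).
Proof.
move=> c h k; apply: ht_inj => y l.
by rewrite hipDl hipZl !ht_ip hipDl hipZl.
Qed.

Lemma ht_linl h : lin (fun x => t x h).
Proof.
move=> c x y; apply: ht_inj => z k.
rewrite hipDl hipZl !ht_ip mipDl mipZl (linD (srep_linl ss k)) (linZ (srep_linl ss k)).
by rewrite hipDr hipZr.
Qed.

Lemma ht_ract x a h : t (ract x a) h = t x (s a h).
Proof.
apply: ht_inj => y k.
by rewrite !ht_ip mip_ractl (srepM ss) (srep_adjr ss) astarK.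
Qed.

Lemma ht_norm x h : `|t x h| <= `|x| * `|h|.
Proof.
rewrite -(@ler_pXn2r _ 2)// ?nnegrE ?mulr_ge0// -hip_norm ht_ip.
rewrite -[leLHS]ger0_norm; last by rewrite -ht_ip hip_ge0.
have b : `|s (mip x x) h| <= `|x| ^+ 2 * `|h|.
  by rewrite -mip_norm (srep_norm ss).
apply: le_trans (hip_cs _ _) (le_trans (ler_wpM2l (normr_ge0 h) b) _).
by rewrite le_eqVlt; apply/orP; left; apply/eqP; ring.
Qed.

Lemma bop_ht (K : hilbertType R) (f g : bop G K) :
  (forall x h, f (t x h) = g (t x h)) -> forall v, f v = g v.
Proof.
by move=> fg; apply: (bop_total (t := uncur t)) => [|[x h]]; [case: ht|exact: fg].
Qed.

Lemma ht_extension (K : hilbertType R) (f : F -> H -> K) (M : C) : 0 <= M ->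
  (forall l, `|lc (uncur f) l| <= M * `|lc (uncur t) l|) ->
  exists L : bop G K, (forall x h, L (t x h) = f x h) /\ forall v, `|L v| <= M * `|v|.
Proof.
move=> M0 h; have [L [L1 L2 _]] := extension M0 h.
by exists L; split=> // x k; exact: (L1 (x, k)).
Qed.

Lemma ht_iso (K : hilbertType R) (f : F -> H -> K) :
  (forall x y h k, hip (f x h) (f y k) = hip h (s (mip x y) k)) ->
  exists J : bop G K, isometric_bop J /\ forall x h, J (t x h) = f x h.
Proof.
move=> hf; have [||J [J1 J2]] := @iso_extension R G K _ (uncur t) (uncur f).
- by case: ht.
- by move=> [x h] [y k]; rewrite hf ht_ip.
by exists J; split=> // x h; exact: (J2 (x, h)).
Qed.

End One.

(** The operator S = (M^2 - B^*B)^(1/2) commutes with s, so M^2 |sum x_i (x) h_i|^2 - |sum x_i (x) B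
    h_i|^2 = |sum x_i (x) S h_i|^2. *)
Lemma ht_map (F : hilbmodType A) (H H' G G' : hilbertType R)
    (s : A -> bop H H) (s' : A -> bop H' H') (t : F -> H -> G) (t' : F -> H' -> G')
    (B : bop H H') (M : C) :
  star_rep s -> star_rep s' -> htensor s t -> htensor s' t' ->
  (forall a h, B (s a h) = s' a (B h)) ->
  0 <= M -> (forall h, `|B h| <= M * `|h|) ->
  exists L : bop G G', (forall x h, L (t x h) = t' x (B h)) /\
    forall v, `|L v| <= M * `|v|.
Proof.
move=> ss ss' ht ht' Bs M0 BM.
have Bs' a h : adj B (s' a h) = s a (adj B h).
  apply: hip_injl => k; rewrite -adjEr (srep_adj ss') -Bs (srep_adj ss).
  by rewrite -adjEr.
(* The innermost combination is the zero operator. *)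
pose Z := bcomb (-1) (bcomp (adj B) B) (bcomb (M ^+ 2) (bid H) (bcomb (-1) (bid H) (bid H))).
have ZE h : Z h = M ^+ 2 *: h - adj B (B h).
  by rewrite !bcombE bcompE !bidE !scaleN1r addNr addr0 addrC.
have [h k|h|S [sS _ SS Sc]] := @bop_sqrt R H Z.
- rewrite !ZE hipBl hipBr hipZl hipZr -adjE adjEr.
  by rewrite conj_Creal// ger0_real// exprn_ge0.
- rewrite ZE hipBr hipZr -adjE !hip_norm subr_ge0 -exprMn.
  by rewrite lerXn2r ?nnegrE ?mulr_ge0.
have sSa a h : s a (S h) = S (s a h).
  by apply: Sc => k; rewrite !ZE linearB linearZ /= Bs Bs'.
apply: ht_extension => // l.
rewrite -(@ler_pXn2r _ 2)// ?nnegrE ?mulr_ge0// exprMn -!hip_norm.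
rewrite -subr_ge0; apply: le_trans (hip_ge0 (lc (fun p => t p.1 (S p.2)) l)) _.
rewrite !hip_lc le_eqVlt; apply/orP; left; apply/eqP.
rewrite /kform mulr_sumr -sumrB; apply: eq_bigr => p _.
rewrite mulr_sumr -sumrB; apply: eq_bigr => q _.
rewrite mulrCA -mulrBr; congr (_ * _); rewrite /uncur !(ht_ip ht) (ht_ip ht').
by rewrite sSa sS SS ZE hipBr hipZr -adjE Bs.
Qed.

Section LeftAction.
Variables (F : corrType A) (H G : hilbertType R) (s : A -> bop H H) (t : F -> H -> G).
Hypotheses (ss : star_rep s) (ht : htensor s t).

Let w (a : A) l : G := lc (fun p : F * H => t (lact a p.1) p.2) l.

Let w_ip a b l m : hip (w a l) (w b m) = hip (lc (uncur t) l) (w (astar a ** b) m).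
Proof.
rewrite !hip_lcl; apply: eq_bigr => p _; congr (_ * _).
rewrite !hip_lcr; apply: eq_bigr => q _; congr (_ * _).
by rewrite !(ht_ip ht) lactM lact_adj.
Qed.

Let w_lin l : lin (fun a => w a l).
Proof.
move=> c a b; rewrite /w /lc scaler_sumr -big_split; apply: eq_bigr => p _ /=.
rewrite (lact_linl p.2.1 c a b) (ht_linl ss ht p.2.2) scalerDr.
by rewrite !scalerA mulrC.
Qed.

(** The square used in [srep_norm], here on combinations of tensors, since the operator of left
    multiplication is only obtained from this bound. *)
Let w_bound a l : `|w a l| <= `|a| * `|lc (uncur t) l|.
Proof.
have key (b : A) (r : C) : `|b| < r -> 0 < r ->
    `|w (b ** astar b) l| <= r * `|w (astar b) l|.
  move=> br r0; have r20 : 0 < r ^+ 2 by rewrite exprn_gt0.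
  have [||c hc] := @sub_square _ _ (astar b ** b) (r ^+ 2) (astar b) _ _ r20.
  - by rewrite astarM astarK.
  - by rewrite anorm_star lerXn2r ?nnegrE ?(ltW r0)// ltW.
  rewrite -(@ler_pXn2r _ 2)// ?nnegrE ?mulr_ge0 ?(ltW r0)// exprMn -!hip_norm.
  rewrite -subr_ge0; apply: le_trans (hip_ge0 (w c l)) _.
  rewrite !w_ip hc (linB (w_lin l)) (linZ (w_lin l)) hipBr hipZr astarM !astarK.
  by rewrite !amulA.
apply: le_factor_eps => // r ar; have r0 : 0 < r by apply: le_lt_trans ar.
have [->|ax] := eqVneq (w a l) 0; first by rewrite normr0 mulr_ge0 ?(ltW r0).
have axp : 0 < `|w a l| by rewrite normr_gt0.
rewrite -(ler_pM2r axp) -expr2 -hip_norm w_ip -[leLHS]ger0_norm; last first.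
  by rewrite -w_ip hip_ge0.
rewrite (le_trans (hip_cs _ _))//.
have h : `|w (astar a ** a) l| <= r * `|w a l|.
  by have := key (astar a) r; rewrite astarK norm_astar; exact.
apply: le_trans (ler_wpM2l (normr_ge0 _) h) _.
by rewrite mulrCA mulrA.
Qed.

Lemma ht_lact : exists lam : A -> bop G G, star_rep lam /\
  forall a x h, lam a (t x h) = t (lact a x) h.
Proof.
have /choice [lam hlam] a : exists L : bop G G, (forall x h, L (t x h) = t (lact a x) h) /\
    forall v, `|L v| <= `|a| * `|v|.
  by apply: (ht_extension (f := fun x h => t (lact a x) h)) => // l; exact: w_bound.
have lamE a x h : lam a (t x h) = t (lact a x) h by case: (hlam a).
have lama a : adjoint (lam a) (lam (astar a)).
  move=> u v; rewrite adjE; congr (hip _ _); move: v; apply: (bop_ht ht) => x h.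
  apply: (ht_inj ht) => y k.
  by rewrite -adjEr !lamE !(ht_ip ht) lact_adj astarK.
exists lam; split=> //; split=> //.
- move=> c a b v.
  rewrite -[RHS](bcombE c (lam a) (lam b)); move: v; apply: (bop_ht ht) => x h.
  by rewrite bcombE !lamE (lact_linl x) (ht_linl ss ht).
- move=> a b v; rewrite -bcompE; move: v; apply: (bop_ht ht) => x h.
  by rewrite bcompE !lamE lactM.
Qed.

End LeftAction.

Lemma ht_incl (F F' : hilbmodType A) (H G G' : hilbertType R) (s : A -> bop H H)
    (t : F -> H -> G) (t' : F' -> H -> G') (f : F -> F') :
  htensor s t -> htensor s t' -> (forall x y, mip (f x) (f y) = mip x y :> A) ->
  exists J : bop G G', [/\ isometric_bop J, forall x h, J (t x h) = t' (f x) h &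
    forall g, (forall x w, mip (f x) w = mip x (g w) :> A) ->
      forall w h, adj J (t' w h) = t (g w) h].
Proof.
move=> ht ht' ff; have [J [J1 J2]] : exists J : bop G G', isometric_bop J /\
    forall x h, J (t x h) = t' (f x) h.
  by apply: (ht_iso ht) => x y h k; rewrite (ht_ip ht') ff.
exists J; split=> // g fg w h; apply: (ht_inj ht) => x k.
by rewrite -adjEr J2 -hip_conj (ht_ip ht') fg -(ht_ip ht) hip_conj.
Qed.

End Tensors.

(** * Complete contractivity *)

Section CompleteContractivity.
Variables (R : realType) (A : cstarType R) (F : hilbmodType A) (H : hilbertType R).
Local Notation C := (cplx R).
Local Notation "a ** b" := (amul a b) (at level 40, left associativity).

Section MatrixBound.
Variables (s : A -> bop H H) (k : nat) (zeta : 'M[F]_k) (c : C).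
Hypotheses (ss : star_rep s) (c0 : 0 < c) (hz : linking_norm_le zeta c).

Let zb (b : 'I_k -> A) i : F := \sum_j ract (zeta i j) (b j).
Let m i j : A := \sum_l mip (zeta l i) (zeta l j).
Let mb (b : 'I_k -> A) i : A := \sum_j m i j ** b j.
Let nb (b : 'I_k -> A) : C := `|\sum_j astar (b j) ** b j|.

Let zb_bound b : `|fip (zb b) (zb b)| <= c ^+ 2 * nb b.
Proof.
have [_ h] := hz; apply: le_trans (h (fun=> 0) b) _; rewrite ler_wpM2l ?exprn_ge0 ?(ltW c0)//.
by rewrite /nb; under eq_bigr do rewrite mip0r add0r.
Qed.

Let mbE b i : mb b i = \sum_l mip (zeta l i) (zb b l).
Proof.
rewrite /mb /m; under eq_bigr do rewrite amul_suml; rewrite exchange_big /=.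
apply: eq_bigr => l _; rewrite mip_sumr; apply: eq_bigr => j _.
by rewrite mip_ract.
Qed.

(** [nb] is the square of the norm of A^k. Since <m b, m b> = <zeta (m b), zeta b>, Cauchy-Schwarz
    and the bound on zeta cancel one factor [nb (mb b)]. *)
Let mb_bound b : nb (mb b) <= c ^+ 4 * nb b.
Proof.
have e : nb (mb b) = `|fip (zb (mb b)) (zb b)|.
  rewrite /nb /fip; congr (`|_|).
  under eq_bigr do rewrite {2}mbE amul_sumr.
  rewrite exchange_big /=; apply: eq_bigr => l _.
  by rewrite mip_suml; apply: eq_bigr => j _; rewrite mip_ractl.
have nb0 : 0 <= nb (mb b) by exact: normr_ge0.
have [->|n0] := eqVneq (nb (mb b)) 0.
  by rewrite mulr_ge0 ?exprn_ge0 ?(ltW c0)// normr_ge0.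
have np : 0 < nb (mb b) by rewrite lt_def n0.
have h1 := fip_cs (zb (mb b)) (zb b); rewrite -e in h1.
rewrite -(ler_pM2l np) -expr2 (le_trans h1)//.
have h2 := ler_pM (normr_ge0 _) (normr_ge0 _) (zb_bound (mb b)) (zb_bound b).
by apply: le_trans h2 _; rewrite le_eqVlt; apply/orP; left; apply/eqP; ring.
Qed.

Let iter_bound n b : nb (iter n mb b) <= c ^+ 4 ^+ n * nb b.
Proof.
elim: n => [|n IH]; first by rewrite expr0 mul1r.
rewrite iterS (le_trans (mb_bound _))// [_ ^+ n.+1]exprS -mulrA ler_wpM2l// exprn_ge0//.
exact: ltW.
Qed.

Let entry_bound b i : `|b i| ^+ 2 <= nb b.
Proof.
rewrite -anorm_star /nb (bigD1 i)//=; apply: norm_le_cpos; first exact: cpos_sq.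
by apply: cpos_sum => j _; exact: cpos_sq.
Qed.

Let Mu (u : 'I_k -> H) i : H := \sum_j s (m i j) (u j).
Let hk (u v : 'I_k -> H) : C := \sum_i hip (u i) (v i).
Let nu (u : 'I_k -> H) : C := hk u u.

Let Mu_sym u v : hk (Mu u) v = hk u (Mu v).
Proof.
rewrite /hk; under eq_bigr do rewrite hip_suml.
rewrite exchange_big /=; apply: eq_bigr => j _; rewrite hip_sumr.
apply: eq_bigr => i _; rewrite (srep_adj ss); congr (hip _ (s _ _)).
by rewrite /m astar_sum; apply: eq_bigr => l _; rewrite mip_star.
Qed.

Let nu_ge0 u : 0 <= nu u.
Proof. by apply: sumr_ge0 => i _; exact: hip_ge0. Qed.

Let hk_cs u v : `|hk u v| ^+ 2 <= nu u * nu v.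
Proof.
apply: quadratic_ineq => // d.
rewrite (_ : _ + _ = nu (fun i => u i + d *: v i)); first exact: nu_ge0.
rewrite /nu /hk; under [RHS]eq_bigr do rewrite hipDl !hipDr !hipZl !hipZr.
rewrite !big_split /= -!mulr_sumr normCK.
rewrite [X in _ * X + _](_ : _ = hk u v)// [(_ * hk u v)^*]rmorphM /=.
rewrite [(hk u v)^*](_ : _ = \sum_i hip (v i) (u i)).
  by rewrite !addrA; congr (_ + _ + _ + _); ring.
by rewrite /hk rmorph_sum; apply: eq_bigr => i _ /=; rewrite hip_conj.
Qed.

Let iter_sym n u v : hk (iter n Mu u) v = hk u (iter n Mu v).
Proof. by elim: n u v => //= n IH u v; rewrite Mu_sym IH -iterSr iterS. Qed.

Let power u n : nu u * nu (Mu u) ^+ (2 ^ n) <= nu u ^+ (2 ^ n) * nu (iter (2 ^ n) Mu u).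
Proof.
elim: n => [|n IH]; first by rewrite !expr1.
have [->|u0] := eqVneq (nu u) 0.
  by rewrite mul0r mulr_ge0 ?exprn_ge0// nu_ge0.
have up : 0 < nu u by rewrite lt_def u0 nu_ge0.
rewrite -(ler_pM2l up) expnS mul2n -addnn iterD !exprD.
apply: (@le_trans _ _ ((nu u * nu (Mu u) ^+ (2 ^ n)) ^+ 2)).
  by rewrite le_eqVlt; apply/orP; left; apply/eqP; ring.
apply: (@le_trans _ _ ((nu u ^+ (2 ^ n) * nu (iter (2 ^ n) Mu u)) ^+ 2)).
  by rewrite lerXn2r ?nnegrE ?mulr_ge0 ?exprn_ge0 ?nu_ge0.
have h : nu (iter (2 ^ n) Mu u) ^+ 2 <= nu u * nu (iter (2 ^ n) Mu (iter (2 ^ n) Mu u)).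
  have := hk_cs u (iter (2 ^ n) Mu (iter (2 ^ n) Mu u)).
  by rewrite -iter_sym ger0_norm ?nu_ge0.
rewrite exprMn (le_trans (ler_wpM2l _ h))// ?exprn_ge0 ?nu_ge0//.
by rewrite le_eqVlt; apply/orP; left; apply/eqP; ring.
Qed.

(** The j-th column of the power m^(n+1). *)
Let col n j : 'I_k -> A := iter n mb (fun i => m i j).

Let iter_col n u i : iter n.+1 Mu u i = \sum_j s (col n j i) (u j).
Proof.
elim: n i => [|n IH] i; first by [].
rewrite -[LHS]/(Mu (iter n.+1 Mu u) i) {1}/Mu; under eq_bigr do rewrite IH linear_sum.
rewrite exchange_big /=; apply: eq_bigr => j _.
rewrite -/(mb (col n j)) {1}/mb (lin_sum (srep_linl ss _)); apply: eq_bigr => l _.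
by rewrite (srepM ss).
Qed.

Let growth u : exists2 D : C, 0 <= D & forall n, nu (iter n.+1 Mu u) <= c ^+ 4 ^+ n * D.
Proof.
pose B := \sum_j (nb (fun i => m i j) + 1).
have B0 : 0 <= B by apply: sumr_ge0 => j _; rewrite addr_ge0// normr_ge0.
pose U := \sum_j `|u j|; have U0 : 0 <= U by apply: sumr_ge0.
exists (k%:R * (B * U ^+ 2)); first by rewrite mulr_ge0 ?ler0n// mulr_ge0 ?exprn_ge0.
move=> n; have c4 : 0 <= c ^+ 4 ^+ n by rewrite !exprn_ge0// ltW.
have cb j i : `|col n j i| ^+ 2 <= c ^+ 4 ^+ n * B.
  apply: le_trans (entry_bound _ i) (le_trans (iter_bound n _) _).
  rewrite ler_wpM2l// /B (bigD1 j)//= -addrA lerDl addr_ge0 ?ler01//.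
  by apply: sumr_ge0 => l _; rewrite addr_ge0// normr_ge0.
have q0 : 0 <= c ^+ 4 ^+ n * B by rewrite mulr_ge0.
have cb' j i : `|col n j i| <= sqrtC (c ^+ 4 ^+ n * B).
  by rewrite -(@ler_pXn2r _ 2)// ?nnegrE ?sqrtC_ge0// sqrtCK.
have hi i : hip (iter n.+1 Mu u i) (iter n.+1 Mu u i) <= c ^+ 4 ^+ n * B * U ^+ 2.
  rewrite hip_norm -[c ^+ 4 ^+ n * B]sqrtCK -exprMn.
  rewrite lerXn2r ?nnegrE ?mulr_ge0 ?sqrtC_ge0// iter_col.
  rewrite (le_trans (ler_norm_sum _ _ _))// mulr_sumr; apply: ler_sum => j _.
  by rewrite (le_trans (srep_norm ss _ _))// ler_wpM2r.
rewrite /nu /hk (le_trans (ler_sum _ (fun i _ => hi i)))//.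
rewrite sumr_const card_ord -mulr_natl le_eqVlt; apply/orP; left; apply/eqP; ring.
Qed.

(** The Gram matrix m = zeta^* zeta acts on A^k by [mb] and on H^k by [Mu]. The hypothesis bounds
    its powers on A^k, hence their entries, hence the growth of the iterates of [Mu]; as [Mu] is
    self-adjoint, its norm is at most c^2. *)
Lemma gram_bound u : \sum_i hip (u i) (\sum_j s (m i j) (u j)) <= c ^+ 2 * \sum_i hip (u i) (u i).
Proof.
suff : hk u (Mu u) <= c ^+ 2 * nu u by [].
have [un0|u0] := eqVneq (nu u) 0.
  have h := hk_cs u (Mu u); rewrite un0 mul0r in h; rewrite un0 mulr0.
  suff -> : hk u (Mu u) = 0 by [].
  by apply/eqP; rewrite -normr_eq0 -sqrf_eq0 eq_le h exprn_ge0.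
have up : 0 < nu u by rewrite lt_def u0 nu_ge0.
have [D D0 hD] := growth u.
have c4 : 0 < c ^+ 4 by rewrite exprn_gt0.
have r1 : nu (Mu u) / (c ^+ 4 * nu u) <= 1.
  apply: (@power_le1 _ _ (D / (c ^+ 4 * nu u))).
  - by rewrite divr_ge0 ?nu_ge0// mulr_ge0 ?nu_ge0// ltW.
  - by rewrite divr_ge0// mulr_ge0 ?nu_ge0// ltW.
  move=> n; have N0 : (0 < 2 ^ n)%N by rewrite expn_gt0.
  (* The index is shifted because vectors of H^k have no coordinates in A: only after one
     application of [Mu] are the coefficients columns of a power of m. *)
  have h := power u n; have h2 := hD (2 ^ n).-1; rewrite prednK// in h2.
  rewrite expr_div_n ler_pdivrMr ?exprn_gt0 ?mulr_gt0//.
  rewrite -(ler_pM2l up) (le_trans h)//.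
  have h3 : nu u ^+ (2 ^ n) * nu (iter (2 ^ n) Mu u) <=
      nu u ^+ (2 ^ n) * (c ^+ 4 ^+ (2 ^ n).-1 * D).
    by rewrite ler_wpM2l// exprn_ge0// nu_ge0.
  apply: le_trans h3 _; rewrite mulrDl mul1r mulrDr.
  have -> : nu u * ((2 ^ n)%:R * (D / (c ^+ 4 * nu u)) * (c ^+ 4 * nu u) ^+ (2 ^ n)) =
      (2 ^ n)%:R * (nu u ^+ (2 ^ n) * (c ^+ 4 ^+ (2 ^ n).-1 * D)).
    have -> : (c ^+ 4 * nu u) ^+ (2 ^ n) =
        c ^+ 4 * c ^+ 4 ^+ (2 ^ n).-1 * nu u ^+ (2 ^ n).
      by rewrite exprMn -exprS prednK.
    move: (c ^+ 4 ^+ (2 ^ n).-1) (nu u ^+ (2 ^ n)) ((2 ^ n)%:R : C) => X Y Z.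
    by field; rewrite !gt_eqF.
  have q0 : 0 <= nu u ^+ (2 ^ n) * (c ^+ 4 ^+ (2 ^ n).-1 * D).
    by rewrite !mulr_ge0 ?exprn_ge0 ?nu_ge0 ?(ltW c0).
  apply: (@le_trans _ _ ((2 ^ n)%:R * (nu u ^+ (2 ^ n) * (c ^+ 4 ^+ (2 ^ n).-1 * D)))).
    by rewrite ler_peMl// ler1n.
  by rewrite lerDr mulr_ge0 ?nu_ge0// exprn_ge0// mulr_ge0 ?nu_ge0// ltW.
rewrite ler_pdivrMr ?mulr_gt0// mul1r in r1.
have : `|hk u (Mu u)| ^+ 2 <= (c ^+ 2 * nu u) ^+ 2.
  apply: le_trans (hk_cs _ _) (le_trans (ler_wpM2l (nu_ge0 u) r1) _).
  by rewrite le_eqVlt; apply/orP; left; apply/eqP; ring.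
rewrite ler_pXn2r ?nnegrE ?mulr_ge0 ?exprn_ge0 ?nu_ge0 ?(ltW c0)//.
apply: le_trans; rewrite real_ler_norm//.
rewrite CrealE -{2}Mu_sym /hk rmorph_sum; apply/eqP; apply: eq_bigr => i _ /=.
by rewrite hip_conj.
Qed.

End MatrixBound.

(** The hypothesis is applied to each row of zeta; summed over the rows it produces the quadratic
    form of the Gram matrix. Replacing c by sqrt r with r > c^2 provides the strict positivity
    required by [gram_bound]. *)
Lemma tilde_bound_cc (s : A -> bop H H) (V : F -> bop H H) : star_rep s ->
  (forall k (x : 'I_k -> F) (u : 'I_k -> H),
     `|\sum_i V (x i) (u i)| ^+ 2 <=
     \sum_i \sum_j hip (u i) (s (mip (x i) (x j)) (u j))) ->
  completely_contractive V.
Proof.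
move=> ss hV k zeta c hz; have [c0 hz'] := hz; split=> // u.
have h1 : \sum_i `|\sum_j V (zeta i j) (u j)| ^+ 2 <=
    \sum_j hip (u j) (\sum_l s (\sum_i mip (zeta i j) (zeta i l)) (u l)).
  apply: (@le_trans _ _ (\sum_i \sum_j \sum_l
      hip (u j) (s (mip (zeta i j) (zeta i l)) (u l)))).
    by apply: ler_sum => i _; exact: (hV k (fun j => zeta i j) u).
  rewrite exchange_big le_eqVlt; apply/orP; left; apply/eqP; apply: eq_bigr => j _ /=.
  rewrite exchange_big hip_sumr; apply: eq_bigr => l _ /=.
  by rewrite (lin_sum (srep_linl ss _)) hip_sumr.
apply: le_trans h1 _; apply: le_factor_eps.
- exact: exprn_ge0.
- by apply: sumr_ge0 => i _; rewrite exprn_ge0.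
move=> r cr; have r0 : 0 < r by apply: le_lt_trans cr; rewrite exprn_ge0.
have sr0 : 0 < sqrtC r by rewrite sqrtC_gt0.
have hz2 : linking_norm_le zeta (sqrtC r).
  split; first exact: ltW.
  move=> y b /=; apply: le_trans (hz' y b) _.
  by rewrite ler_wpM2r// sqrtCK ltW.
have := gram_bound ss sr0 hz2 u; rewrite sqrtCK => /le_trans; apply.
by rewrite ler_wpM2l ?(ltW r0)//; apply: ler_sum => i _; rewrite hip_norm.
Qed.

End CompleteContractivity.

Lemma cc_norm (R : realType) (A : cstarType R) (F : hilbmodType A) (H : hilbertType R)
    (V : F -> bop H H) : completely_contractive V -> forall x h, `|V x h| <= `|x| * `|h|.
Proof.
move=> cV x h; have [|_ /(_ (fun=> h))] := cV 1%N (const_mx x) `|x|.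
  split=> // y b /=; rewrite !big_ord1 !mxE mip_norm.
  apply: (@le_trans _ _ ((`|x| * `|b 0|) ^+ 2)).
    by rewrite lerXn2r ?nnegrE ?mulr_ge0// norm_ract.
  rewrite exprMn ler_wpM2l ?exprn_ge0// -anorm_star addrC.
  by apply: norm_le_cpos; [exact: cpos_sq|exact: cpos_mip].
by rewrite !big_ord1 mxE -exprMn ler_pXn2r ?nnegrE ?mulr_ge0.
Qed.

(** * The predual of a von Neumann algebra *)

Section Sums.
Variable R : realType.
Local Notation C := (cplx R).

Lemma nondecreasing_cvg (u : nat -> C) (M : C) : (forall n, 0 <= u n) ->
  (forall n, u n <= u n.+1) -> (forall n, u n <= M) -> exists l : C, u @ \oo --> l.
Proof.
move=> u0 uS uM; apply: cplx_cauchy_cvg => e e0.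
have um m n : (m <= n)%N -> u m <= u n.
  by move=> /subnK <-; elim: (n - m)%N => // d IH; exact: le_trans IH (uS _).
have [||i i0 [ile iex]] := @lower_bound R [set z | exists n, z = M - u n].
- by exists (M - u 0), 0.
- by move=> _ [n ->]; rewrite subr_ge0.
have [_ [N ->] hN] := iex e e0; exists N.
have key m n : (N <= m)%N -> (m <= n)%N -> `|u n - u m| <= e.
  move=> Nm mn; rewrite ger0_norm ?subr_ge0 ?um//.
  rewrite (_ : _ - _ = (M - u m) - (M - u n)); last by ring.
  rewrite lerBlDr (@le_trans _ _ (M - u N))// ?lerD2l ?lerN2 ?um//.
  by rewrite (le_trans (ltW hN))// addrC lerD2l; apply: ile; exists n.
move=> m n Nm Nn; have [mn|/ltnW nm] := leqP m n; last exact: key.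
by rewrite distrC key.
Qed.

Lemma series_bounded_cvg (u : nat -> C) (M : C) : (forall n, 0 <= u n) ->
  (forall n, \sum_(i < n) u i <= M) -> exists l : C, series u @ \oo --> l.
Proof.
move=> u0 uM; apply: (@nondecreasing_cvg _ M) => n; rewrite /series /=.
- by apply: sumr_ge0 => i _.
- by rewrite big_nat_recr//= lerDl.
- by rewrite big_mkord.
Qed.

Lemma sum_hip_cs (H : hilbertType R) n (h k : nat -> H) :
  `|\sum_(i < n) hip (h i) (k i)| ^+ 2 <=
  (\sum_(i < n) `|h i| ^+ 2) * (\sum_(i < n) `|k i| ^+ 2).
Proof.
apply: quadratic_ineq => [||c]; try by apply: sumr_ge0 => i _; rewrite exprn_ge0.
have : 0 <= \sum_(i < n) hip (h i + c *: k i) (h i + c *: k i).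
  by apply: sumr_ge0 => i _; exact: hip_ge0.
move=> h0; apply: le_trans h0 _; rewrite rmorphM rmorph_sum !mulr_sumr -!big_split /=.
rewrite le_eqVlt; apply/orP; left; apply/eqP; apply: eq_bigr => i _.
rewrite hipDl !hipDr !hipZl !hipZr -!hip_norm normCK hip_conj.
by ring.
Qed.

Lemma orth_series_cvg (H : hilbertType R) (v : nat -> H) (M : C) :
  (forall i j, i != j -> hip (v i) (v j) = 0) ->
  (forall n, \sum_(i < n) `|v i| ^+ 2 <= M) ->
  exists l : H, (fun n => \sum_(i < n) v i) @ \oo --> l.
Proof.
move=> vo vM; have sq0 i : 0 <= `|v i| ^+ 2 by rewrite exprn_ge0.
have [s hs] := series_bounded_cvg sq0 vM.
apply: cauchyseq_cvg => e e0.
have [B hB] := (cvgn_le0P _ _).1 hs _ (divr_gt0 (exprn_gt0 2 e0) (ltr0n _ 2)).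
have key m n : (B <= m)%N -> (m <= n)%N ->
    `|\sum_(i < n) v i - \sum_(i < m) v i| <= e.
  move=> Bm mn; rewrite -(@ler_pXn2r _ 2)// ?nnegrE ?(ltW e0)//.
  have -> : \sum_(i < n) v i - \sum_(i < m) v i = \sum_(m <= i < n) v i.
    by rewrite -!(big_mkord xpredT v) (big_cat_nat (leq0n m) mn)/= addrAC subrr add0r.
  have -> : `|\sum_(m <= i < n) v i| ^+ 2 = \sum_(m <= i < n) `|v i| ^+ 2.
    rewrite -hip_norm hip_suml; apply: eq_big_nat => i imn.
    rewrite hip_sumr (bigD1_seq i) ?mem_index_iota ?iota_uniq//=.
    by rewrite hip_norm big1 ?addr0// => j ji; rewrite vo// eq_sym.
  have -> : \sum_(m <= i < n) `|v i| ^+ 2 =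
      (series (fun i => `|v i| ^+ 2) n - s) - (series (fun i => `|v i| ^+ 2) m - s).
    by rewrite /series /= (big_cat_nat (leq0n m) mn)/=; ring.
  rewrite -[leLHS]ger0_norm; last first.
    rewrite /series /= (big_cat_nat (leq0n m) mn)/= (_ : _ - _ = \sum_(m <= i < n) `|v i| ^+ 2).
      by apply: sumr_ge0 => i _; rewrite exprn_ge0.
    by ring.
  rewrite (le_trans (ler_normB _ _))// [leRHS]splitr lerD ?hB//.
  exact: leq_trans Bm mn.
exists B => m n Bm Bn; have [mn|/ltnW nm] := leqP m n; last exact: key.
by rewrite distrC key.
Qed.

Lemma square_summable_bounded (H : hilbertType R) (h : nat -> H) : square_summable h ->
  exists M : C, forall n, \sum_(i < n) `|h i| ^+ 2 <= M.
Proof.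
move=> /cvg_ex[s hs]; exists s => n.
have hs' : (fun m => series (fun i => `|h i| ^+ 2) (m + n)%N) @ \oo --> s.
  by rewrite (cvg_shiftn n (series (fun i => `|h i| ^+ 2))).
apply: (le_limit _ (cvg_cst (\sum_(i < n) `|h i| ^+ 2)) hs') => m.
rewrite /series /= addnC -[leLHS](big_mkord xpredT (fun i => `|h i| ^+ 2)).
rewrite (big_cat_nat (leq0n n) (leq_addr m n))/= lerDl.
by apply: sumr_ge0 => i _; rewrite exprn_ge0.
Qed.

Lemma cvg_total (H K : hilbertType R) I (t : I -> H) (f : nat -> H -> K) (F : bop H K) (M : C) :
  total_family t -> 0 <= M -> (forall n, lin (f n)) -> (forall n x, `|f n x| <= M * `|x|) ->
  (forall i, (fun n => f n (t i)) @ \oo --> F (t i)) -> forall x, (fun n => f n x) @ \oo --> F x.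
Proof.
move=> tt M0 fl fM ft x; have [N N0 FN] := bop_bounded F.
have Fl : lin F by move=> c u v; rewrite linearP.
have [l lx] := total_dense tt x.
have flc m : (fun n => f n (lc t m)) @ \oo --> F (lc t m).
  elim: m => [|[c i] m IH].
    rewrite /lc big_nil (lin0 Fl) (_ : (fun n => _) = fun=> 0); first exact: cvg_cst.
    by apply/funext => n; rewrite (lin0 (fl n)).
  rewrite (_ : lc t _ = c *: t i + lc t m); last by rewrite /lc big_cons.
  rewrite Fl (_ : (fun n => _) = fun n => c *: f n (t i) + f n (lc t m)).
    by apply: cvgD => //; apply: cvgZ => //; exact: cvg_cst.
  by apply/funext => n; rewrite fl.
apply/cvgn_le0P => e e0; pose B := M + N + 1.
have B0 : 0 < B by rewrite ltr_wpDl// addr_ge0.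
have [p hp] := (cvgn_le0P _ _).1 lx _ (divr_gt0 (divr_gt0 e0 (ltr0n _ 2)) B0).
set y := lc t (l p); have yx : `|y - x| <= e / 2 / B by exact: hp.
have [q hq] := (cvgn_le0P _ _).1 (flc (l p)) _ (divr_gt0 e0 (ltr0n _ 2)).
exists q => n qn.
have -> : f n x - F x = (f n y - F y) + (F (y - x) - f n (y - x)).
  rewrite (linB Fl) (linB (fl n)) opprB.
  by rewrite !addrA subrK [RHS](ACl (1*4*3*2))/= subrr add0r.
rewrite (le_trans (ler_normD _ _))// [leRHS]splitr lerD ?hq//.
rewrite (le_trans (ler_normB _ _))// (le_trans (lerD (FN _) (fM _ _)))//.
rewrite -mulrDl (@le_trans _ _ (B * (e / 2 / B)))//.
  by rewrite ler_pM ?addr_ge0// /B [N + M]addrC lerDl ler01.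
by rewrite mulrCA mulfV ?mulr1// gt_eqF.
Qed.

End Sums.

(** * Infinite amplification and vector functionals *)

Section Amplification.
Variables (R : realType) (N : hilbertType R).
Local Notation C := (cplx R).

Let kern (p q : nat * N) : C := if p.1 == q.1 then hip p.2 q.2 else 0.

Let comp (l : seq (C * (nat * N))) i : N := \sum_(p <- l | p.2.1 == i) p.1 *: p.2.2.

Let bnd (l : seq (C * (nat * N))) := (\sum_(p <- l) p.2.1).+1.

Let kernE l m n : (bnd l <= n)%N ->
  kform kern l m = \sum_(i < n) hip (comp l i) (comp m i).
Proof.
elim: l => [|p l IH] ln.
  by rewrite /kform big_nil big1// => i _; rewrite /comp big_nil hip0l.
have pn : (p.2.1 < n)%N.
  by apply: leq_trans ln; rewrite ltnS big_cons leq_addr.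
have ln' : (bnd l <= n)%N.
  by apply: leq_trans ln; rewrite ltnS big_cons leq_addl.
rewrite /kform big_cons -/(kform kern l m) (IH ln').
have cE (i : 'I_n) : hip (comp (p :: l) i) (comp m i) =
    (if p.2.1 == i then hip (p.1 *: p.2.2) (comp m i) else 0) + hip (comp l i) (comp m i).
  by rewrite {1}/comp big_cons; case: ifP => _; rewrite ?add0r// hipDl.
under [RHS]eq_bigr do rewrite cE; rewrite big_split; congr (_ + _).
rewrite (bigD1 (Ordinal pn))//= eqxx [X in _ + X]big1 ?addr0; last first.
  move=> i /eqP ip; case: eqP => // pi; case: ip; exact: val_inj.
rewrite /comp [in RHS]big_mkcond hip_sumr; apply: eq_bigr => q _.
rewrite /kern eq_sym; case: eqP => _; first by rewrite hipZl hipZr mulrA.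
by rewrite mulr0 hip0r.
Qed.

Let kern_psd : psd kern.
Proof.
split=> [p q|l]; last first.
  by rewrite (kernE l (leqnn _)); apply: sumr_ge0 => i _; exact: hip_ge0.
by rewrite /kern eq_sym; case: eqP => _; rewrite ?hip_conj// rmorph0.
Qed.

(** K is a sum of copies of N indexed by the naturals. [J n] moves copy i to copy [pickle (n, i)]:
    injectivity of the pairing makes the ranges orthogonal, and moving copies commutes with T acting
    alike on each of them. *)
Lemma amplification : exists (K : hilbertType R) (t : nat -> N -> K)
    (amp : bop N N -> bop K K) (J : nat -> bop K K),
  [/\ [/\ forall i j h k, hip (t i h) (t j k) = (if i == j then hip h k else 0) &
        total_family (fun p => t p.1 p.2)],
      forall (T : bop N N) i h, amp T (t i h) = t i (T h) &
      [/\ forall n, isometric_bop (J n),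
          forall n m x y, n != m -> hip (J n x) (J m y) = 0 &
          forall n T x, J n (amp T x) = amp T (J n x)]].
Proof.
have [K [t [tE tt]]] := kernel_space kern_psd.
suff [[amp hamp] [J hJ]] : (exists amp : bop N N -> bop K K, forall T p,
      amp T (t p) = t (p.1, T p.2)) /\ (exists J : nat -> bop K K, forall n,
      isometric_bop (J n) /\ forall p, J n (t p) = t (pickle (n, p.1), p.2)).
  exists K, (fun i h => t (i, h)), amp, J; split.
  - split=> [i j h k|]; first by rewrite tE.
    by move=> v hv; apply: tt => -[i h]; exact: (hv (i, h)).
  - by move=> T i h; rewrite hamp.
  split=> [n|n m x y nm|n T x]; first by case: (hJ n).
  - rewrite adjE (_ : adj _ _ = 0) ?hip0r//; apply: (tt) => -[i h].
    rewrite -adjEr; have [_ ->] := hJ n; rewrite adjE.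
    rewrite (_ : adj _ _ = 0) ?hip0r//; apply: (tt) => -[j k].
    rewrite -adjEr; have [_ ->] := hJ m; rewrite tE /kern /= (inj_eq (pcan_inj pickleK)).
    by rewrite xpair_eqE (negbTE nm).
  - rewrite -!bcompE; move: x; apply: (bop_total tt) => p.
    by have [_ hj] := hJ n; rewrite !bcompE hamp !hj hamp.
split; last first.
  have hc (n : nat) : exists L : bop K K, isometric_bop L /\
      forall p, L (t p) = t (pickle (n, p.1), p.2).
    apply: iso_extension => // p q; rewrite !tE /kern /= (inj_eq (pcan_inj pickleK)).
    by rewrite xpair_eqE eqxx.
  by have [J hJ] := choice hc; exists J.
suff hc : forall T : bop N N, exists L : bop K K, forall p, L (t p) = t (p.1, T p.2).
  by have [amp hamp] := choice hc; exists amp.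
move=> T; have [M M0 TM] := bop_bounded T.
have [|L [hL _ _]] := @extension R K K _ t (fun p => t (p.1, T p.2)) M M0; last by exists L => p; rewrite hL.
  move=> l; rewrite -(@ler_pXn2r _ 2)// ?nnegrE ?mulr_ge0// exprMn -!hip_norm.
  pose l' := [seq (p.1, (p.2.1, T p.2.2)) | p <- l].
  have -> : lc (fun p : nat * N => t (p.1, T p.2)) l = lc t l'.
    by rewrite /lc big_map.
  have kE m : hip (lc t m) (lc t m) = kform kern m m.
    rewrite hip_lc; apply: eq_bigr => p _; apply: eq_bigr => q _; by rewrite tE.
  have cT i : comp l' i = T (comp l i).
    rewrite /comp big_map linear_sum; apply: eq_bigr => p _ /=; by rewrite linearZ.
  have bl : bnd l' = bnd l by rewrite /bnd big_map.
  rewrite !kE !(kernE _ (leqnn _)) bl mulr_sumr; apply: ler_sum => i _.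
  by rewrite cT !hip_norm -exprMn lerXn2r ?nnegrE ?mulr_ge0.
Qed.

End Amplification.

Section Model.
Variables (R : realType) (A : cstarType R) (N : von_neumann A).
Local Notation C := (cplx R).
Local Notation "a ** b" := (amul a b) (at level 40, left associativity).
Local Notation rho := (vn_rep N).

(* The infinite amplification: there every ultraweakly continuous functional is a
   single vector functional. *)
Definition vn_model (K : hilbertType R) (pi : A -> bop K K) (J : nat -> bop K K) :=
  [/\ star_rep pi,
      forall f, predual N f <-> exists h k, forall a, f a = hip h (pi a k),
      forall e, (forall h, rho e h = h) -> forall k, pi e k = k &
      [/\ forall n, isometric_bop (J n),
          forall n m x y, n != m -> hip (J n x) (J m y) = 0 &
          forall n a x, J n (pi a x) = pi a (J n x)]].

(** A functional sum <h_i, T k_i> is <h, amp(T) k> with h and k the orthogonal sums of the h_i and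
    k_i; conversely the components of h and k are square summable by Bessel. *)
Lemma vn_model_ex : exists K pi J, @vn_model K pi J.
Proof.
have [K [t [amp [J [[tE tt] ampE [J1 J2 J3]]]]]] := @amplification R (vn_space N).
have rs := vn_star_rep N.
have tl i : lin (t i).
  move=> c x y; apply: hip_total (tt) _ => -[j k] /=.
  by rewrite hipDl hipZl !tE; case: eqP => _; rewrite ?hipDl ?hipZl// mulr0 addr0.
exists K, (fun a => amp (rho a)), J; split=> //.
- split=> [c a b k|a b k|a].
  + rewrite -[RHS]bcombE; move: k; apply: (bop_total (tt)) => -[i h] /=.
    by rewrite bcombE !ampE (srep_linl rs h c a b) tl.
  + rewrite -[RHS]bcompE; move: k; apply: (bop_total (tt)) => -[i h] /=.
    by rewrite bcompE !ampE (srepM rs).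
  + move=> x y; rewrite adjE; congr (hip _ _); move: y; apply: (bop_total (tt)) => -[i h] /=.
    apply: hip_total (tt) _ => -[j k] /=; rewrite -adjEr !ampE !tE.
    by case: eqP => // _; rewrite (srep_adjr rs).
- have tb i : exists L : bop (vn_space N) K, forall h, L h = t i h.
    have [||L hL] := @bopP R (vn_space N) K (t i) 1; last by exists L.
      exact: tl.
    by move=> x; rewrite mul1r -(@ler_pXn2r _ 2)// ?nnegrE// -!hip_norm tE eqxx.
  have [I hI] := choice tb.
  move=> f; split.
    move=> [w [h [k [hs ks hw]]] ->].
    have partial (g : nat -> vn_space N) : square_summable g ->
        exists G : K, (fun n => \sum_(i < n) t i (g i)) @ \oo --> G.
      move=> /square_summable_bounded [M hM].
      apply: (orth_series_cvg (v := fun i => t i (g i)) (M := M)) => [i j ij|n].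
        by rewrite tE (negbTE ij).
      by under eq_bigr do rewrite -hip_norm tE eqxx hip_norm; exact: hM.
    have [G hG] := partial _ hs; have [G' hG'] := partial _ ks.
    exists G, G' => a /=; apply: clim_unique (hw (rho a)) _.
    have := cvg_hip hG (bop_cvg (f := amp (rho a)) hG').
    rewrite (_ : (fun n => hip _ _) = series (fun i => hip (h i) (rho a (k i))))//.
    apply/funext => n; rewrite /series /= linear_sum big_mkord hip_suml.
    apply: eq_bigr => i _; rewrite hip_sumr (bigD1 i)//= ampE tE eqxx big1 ?addr0// => j ji.
    by rewrite ampE tE (inj_eq val_inj) eq_sym (negbTE ji).
  move=> [h [k hf]].
  pose p (x : K) i := adj (I i) x.
  have It i j x : p (t j x) i = if i == j then x else 0.
    apply: hip_injr => y; rewrite -adjE hI tE; case: eqP => _//.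
    by rewrite hip0r.
  have e2 x n : `|\sum_(i < n) I i (p x i)| ^+ 2 = \sum_(i < n) `|p x i| ^+ 2.
    rewrite -hip_norm hip_suml; apply: eq_bigr => i _.
    rewrite hip_sumr (bigD1 i)//= !hI tE eqxx hip_norm big1 ?addr0// => j ji.
    by rewrite !hI tE (inj_eq val_inj) eq_sym (negbTE ji).
  have bess x n : \sum_(i < n) `|p x i| ^+ 2 <= `|x| ^+ 2.
    have h0 : 0 <= `|x - \sum_(i < n) I i (p x i)| ^+ 2 by rewrite exprn_ge0.
    rewrite norm_subE in h0.
    have e1 : hip x (\sum_(i < n) I i (p x i)) = \sum_(i < n) `|p x i| ^+ 2.
      by rewrite hip_sumr; apply: eq_bigr => i _; rewrite adjEr hip_norm.
    have s0 : 0 <= \sum_(i < n) `|p x i| ^+ 2 by apply: sumr_ge0 => i _; rewrite exprn_ge0.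
    rewrite e2 -[hip (\sum_(i < n) _) x]hip_conj e1 (conj_Creal (ger0_real s0)) in h0.
    by apply: le_subE h0 _; ring.
  have pT T x i : p (amp T x) i = T (p x i).
    rewrite /p -!bcompE; move: x; apply: (bop_total (tt)) => -[j y] /=.
    rewrite !bcompE ampE -!/(p _ _) !It; case: eqP => // _; by rewrite linear0.
  have Pcvg x : (fun n => \sum_(i < n) I i (p x i)) @ \oo --> x.
    rewrite -[X in _ --> X]bidE.
    apply: (cvg_total (t := fun q => t q.1 q.2) (M := 1)
      (f := fun n x => \sum_(i < n) I i (p x i))) => //.
    - move=> n c y z; rewrite scaler_sumr -big_split; apply: eq_bigr => i _ /=.
      by rewrite /p !linearP.
    - move=> n y; rewrite mul1r -(@ler_pXn2r _ 2)// ?nnegrE// e2.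
      exact: bess.
    - move=> -[j y] /=; rewrite bidE; apply/cvgn_le0P => e e0; exists j.+1 => n jn.
      rewrite (bigD1 (Ordinal jn))//= It eqxx hI big1 ?addr0 ?subrr ?normr0 ?(ltW e0)//.
      by move=> i ij; rewrite It (_ : (i : nat) == j = false) ?linear0//;
        apply/eqP => ij'; case/eqP: ij; exact: val_inj.
  exists (fun T => hip h (amp T k)); last by apply/funext => a /=; rewrite hf.
  have sq x : square_summable (p x).
    have [|z hz] := series_bounded_cvg _ (bess x) (u := fun i => `|p x i| ^+ 2).
      by move=> i; rewrite exprn_ge0.
    by apply/cvg_ex; exists z.
  exists (p h), (p k); split=> //.
  move=> T; rewrite (_ : series _ = fun n => hip (\sum_(i < n) I i (p h i)) (amp T k)).
    by apply: cvg_hip => //; exact: cvg_cst.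
  apply/funext => n; rewrite /series /= big_mkord hip_suml.
  by apply: eq_bigr => i _; rewrite adjE -/(p _ _) pT.
- move=> e he k; rewrite -[RHS]bidE; move: k; apply: (bop_total (tt)) => -[i h] /=.
  by rewrite ampE he bidE.
Qed.

End Model.

Lemma hermitian_of_real (R : realType) (x y : cplx R) :
  x + y \is Num.real -> 'i * (x - y) \is Num.real -> y = x^*.
Proof.
rewrite !CrealE rmorphD rmorphM rmorphB /= conjCi => /eqP h1 /eqP h2.
have i0 : 'i != 0 :> cplx R by exact: neq0Ci.
have h3 : x^* - y^* = y - x.
  by apply: (mulfI i0); apply: oppr_inj; rewrite -mulNr h2; ring.
have h : 2 * y = 2 * x^*.
  rewrite (_ : 2 * x^* = (x^* + y^*) + (x^* - y^*)); last by ring.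
  by rewrite h1 h3; ring.
by apply: (mulfI _ h); rewrite pnatr_eq0.
Qed.

Section Predual.
Variables (R : realType) (A : cstarType R) (N : von_neumann A).
Local Notation C := (cplx R).
Local Notation "a ** b" := (amul a b) (at level 40, left associativity).
Local Notation rho := (vn_rep N).
Variables (K : hilbertType R) (pi : A -> bop K K) (J : nat -> bop K K).
Hypothesis hM : vn_model N pi J.

Let pis : star_rep pi. Proof. by case: hM. Qed.
Let predualE f : predual N f <-> exists h k, forall a, f a = hip h (pi a k).
Proof. by case: hM. Qed.

(** The identity operator lies in the bicommutant. The norm is only bounded by 1, since A may be
    zero. *)
Lemma vn_unit_ex : exists e : A, [/\ forall h, rho e h = h, forall a, e ** a = a,
  forall a, a ** e = a, astar e = e & `|e| <= 1].
Proof.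
have rs := vn_star_rep N.
have [|e he] := @vn_bicommutant _ _ N (bid _).
  by move=> s _ x; rewrite !bidE.
have he' h : rho e h = h by rewrite -he bidE.
have el a : e ** a = a.
  by apply: (@vn_inj _ _ N) => h; rewrite (srepM rs) he'.
have er a : a ** e = a.
  by apply: (@vn_inj _ _ N) => h; rewrite (srepM rs) he'.
have se : astar e = e by rewrite -[LHS]er -{2}[e]astarK -astarM er astarK.
exists e; split=> //; have h := anorm_star e; rewrite se el in h.
have [->|e0] := eqVneq `|e| 0; first exact: ler01.
by move/eqP: h; rewrite expr2 -{1}[`|e|]mulr1 (inj_eq (mulfI e0)) => /eqP <-.
Qed.

Lemma pi_unit e : (forall h, rho e h = h) -> forall k, pi e k = k.
Proof. by case: hM => _ _ h _; exact: h. Qed.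

Lemma lin_lc_id (f : A -> C) : (forall c a b, f (c *: a + b) = c * f a + f b) ->
  forall l, ev f l = f (lc id l).
Proof.
move=> fl; have f0 : f 0 = 0.
  by apply: (addrI (f 0)); rewrite -{1}(mul1r (f 0)) -fl scale1r !addr0.
elim=> [|[c a] l IH]; first by rewrite /ev /lc !big_nil.
by rewrite /ev /lc !big_cons /= fl; congr (_ + _); exact: IH.
Qed.

Lemma srep_lc (H : hilbertType R) (s : A -> bop H H) h l : star_rep s ->
  lc (fun a => s a h) l = s (lc id l) h.
Proof.
move=> ss; elim: l => [|[c a] l IH].
  by rewrite /lc !big_nil (lin0 (srep_linl ss h)).
by rewrite /lc !big_cons /= [RHS](srep_linl ss h); congr (_ + _); exact: IH.
Qed.

Lemma predual_dominated (f : A -> C) (M : C) k : 0 <= M ->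
  (forall c a b, f (c *: a + b) = c * f a + f b) ->
  (forall a, `|f a| ^+ 2 <= M * `|pi a k| ^+ 2) -> predual N f.
Proof.
move=> M0 fl fM; apply/predualE.
have [|h [hf _ _]] := @family_riesz R K A (fun a => pi a k) f M M0.
  by move=> l; rewrite lin_lc_id// (srep_lc _ _ pis).
by exists h, k => a; rewrite hf.
Qed.

(** L = sum J_i l_i: the J_i commute with pi and have orthogonal ranges, so the vector functionals
    of the l_i add up to that of L. *)
Lemma isometries_sum (l : nat -> K) (M : C) : (forall n, \sum_(i < n) `|l i| ^+ 2 <= M) ->
  exists L : K, forall a, series (fun i => hip (l i) (pi a (l i))) @ \oo --> hip L (pi a L).
Proof.
have [_ _ _ [J1 J2 J3]] := hM.
move=> lM; have [i j ij||L hL] := @orth_series_cvg R K (fun i => J i (l i)) M.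
- exact: J2.
- by move=> n; under eq_bigr do rewrite isometric_norm//; exact: lM.
exists L => a; have := cvg_hip hL (bop_cvg (f := pi a) hL).
rewrite (_ : (fun n => hip _ _) = series (fun i => hip (l i) (pi a (l i))))//.
apply/funext => n; rewrite /series /= big_mkord linear_sum hip_suml.
apply: eq_bigr => i _; rewrite hip_sumr (bigD1 i)//= -J3 J1.
rewrite big1 ?addr0// => j ji; rewrite -!J3 J2// eq_sym.
by rewrite -(inj_eq val_inj) in ji.
Qed.

Lemma srep_sq (H : hilbertType R) (s : A -> bop H H) a h : star_rep s ->
  hip h (s (astar a ** a) h) = `|s a h| ^+ 2.
Proof. by move=> ss; rewrite (srepM ss) (srep_adjr ss) astarK hip_norm. Qed.

Lemma partial_sum_le (u : nat -> C) (s : C) n : (forall n, 0 <= u n) ->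
  series u @ \oo --> s -> \sum_(i < n) u i <= s.
Proof.
move=> u0 us.
have us' : (fun m => series u (m + n)%N) @ \oo --> s.
  by rewrite (cvg_shiftn n (series u)).
apply: (le_limit _ (cvg_cst (\sum_(i < n) u i)) us') => m.
rewrite /series /= (big_cat_nat (leq0n n) (leq_addl m n))/= big_mkord lerDl.
by rewrite sumr_ge0.
Qed.

(* The basic neighbourhoods of 0 form a filter; continuity along it bounds [g]
   by finitely many vector functionals, and these are merged by the [J n]. *)
Lemma predual_continuous (g : A -> C) :
  (forall c a b, g (c *: a + b) = c * g a + g b) ->
  (forall (F : set_system A) x, ProperFilter F ->
     (forall f, predual N f -> f @ F --> f x) -> g @ F --> g x) ->
  predual N g.
Proof.
move=> gl gc; have [_ _ _ [J1 J2 J3]] := hM.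
have g0 : g 0 = 0 by apply: (addrI (g 0)); rewrite -{1}(mul1r (g 0)) -gl scale1r !addr0.
have gZ c a : g (c *: a) = c * g a by rewrite -[c *: a]addr0 gl g0 addr0.
pose V (l : seq (K * K)) : set A := [set a | forall p, p \in l -> `|hip p.1 (pi a p.2)| < 1].
pose F : set_system A := [set B | exists l, V l `<=` B].
have FF : ProperFilter F.
  split; first by move=> [l /(_ 0)]; apply => p _; rewrite (lin0 (srep_linl pis _)) hip0r normr0 ltr01.
  split; first by exists [::].
    move=> P Q [l lP] [m mQ]; exists (l ++ m) => a ha; split; [apply: lP|apply: mQ] => p pl;
    by apply: ha; rewrite mem_cat pl ?orbT.
  by move=> P Q PQ [l lP]; exists l => a /lP /PQ.
have Fg : g @ F --> (0 : C).
  rewrite -g0; apply: gc => f /predualE [h [k hf]].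
  have -> : f 0 = 0 by rewrite hf (lin0 (srep_linl pis _)) hip0r.
  apply/cvgrPdist_lt => e e0; exists [:: (e^-1 *: h, k)] => a /(_ _ (mem_head _ _)) /=.
  rewrite hipZl normrM norm_conjC sub0r normrN hf normfV (gtr0_norm e0).
  by rewrite mulrC ltr_pdivrMr// mul1r.
have /cvgrPdist_lt/(_ 1 ltr01) [l hl] := Fg.
pose k i := (nth (0, 0) l i).2; pose h i := (nth (0, 0) l i).1.
(* A single vector L with |pi(a) k_i| <= |pi(a) L| for each of the finitely many i; the family is
   padded with zeros. *)
have [|L hL] := @isometries_sum (fun i => if (i < size l)%N then k i else 0)
    (\sum_(i < size l) `|k i| ^+ 2).
  move=> n; elim: n {-2}n (leqnn n) => [|n IH] m mn.
    by move: mn; rewrite leqn0 => /eqP ->; rewrite big_ord0 sumr_ge0// => i _; rewrite exprn_ge0.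
  have [ml|lm] := leqP m (size l).
    rewrite -!(big_mkord xpredT (fun i => `|k i| ^+ 2)) (big_cat_nat (leq0n m) ml)/=.
    rewrite -[leLHS](big_mkord xpredT (fun i => `|if (i < size l)%N then k i else 0| ^+ 2)).
    rewrite (eq_big_nat _ _ (F2 := fun i => `|k i| ^+ 2)).
      by rewrite lerDl sumr_ge0// => i _; rewrite exprn_ge0.
    by move=> i /andP[_ im]; rewrite (leq_trans im ml).
  case: m mn lm => // m mn lm; rewrite big_ord_recr/= [(m < size l)%N]ltnNge -ltnS lm /= normr0 expr0n addr0.
  exact: IH.
have kL i a : (i < size l)%N -> `|pi a (k i)| <= `|pi a L|.
  move=> il; rewrite -(@ler_pXn2r _ 2)// ?nnegrE//.
  have := hL (astar a ** a); rewrite srep_sq// => La.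
  have := partial_sum_le i.+1 _ La; rewrite big_ord_recr/= il srep_sq// => h1.
  apply: le_trans (h1 _) => [|n]; last by rewrite srep_sq// exprn_ge0.
  by rewrite lerDr sumr_ge0// => j _; rewrite srep_sq// exprn_ge0.
pose D := \sum_(i < size l) `|h i| + 1.
have D0 : 0 < D by rewrite ltr_wpDl// sumr_ge0.
apply: (@predual_dominated _ (D ^+ 2) L) => //; first by rewrite exprn_ge0// ltW.
move=> a; rewrite -exprMn lerXn2r ?nnegrE ?mulr_ge0 ?(ltW D0)//.
rewrite -[leRHS]mulr1; apply: le_factor_eps; rewrite ?mulr_ge0 ?(ltW D0)// => r ar.
have r0 : 0 < r by apply: le_lt_trans ar; rewrite mulr_ge0 ?(ltW D0).
(* Homogeneity: for every r > D |pi(a) L| the element a/r lies in the neighbourhood, so |g(a)| <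
   r. *)
have : V l (r^-1 *: a).
  move=> p /(nthP (0, 0)) [i il <-]; rewrite (linZ (srep_linl pis _)) hipZr normrM normfV.
  rewrite (gtr0_norm r0) mulrC ltr_pdivrMr// mul1r.
  apply: le_lt_trans (hip_cs _ _) _; apply: le_lt_trans ar.
  rewrite ler_pM//; last exact: kL.
  rewrite -/(h i) /D (bigD1 (Ordinal il))//= -addrA lerDl addr_ge0 ?ler01//.
  by rewrite sumr_ge0.
move=> /hl /=; rewrite sub0r normrN gZ normrM normfV (gtr0_norm r0) mulrC ltr_pdivrMr// mul1r.
by rewrite mulr1; exact: ltW.
Qed.

(* Radon-Nikodym: the functional is dominated by the vector [l0], hence equals
   [<R l0, R pi(a) l0>] for an operator R into its GNS space; then polar decomposition. *)
Lemma predual_positive (w : A -> C) : predual N w -> (forall a, 0 <= w (astar a ** a)) ->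
  exists l, forall a, w a = hip l (pi a l).
Proof.
move=> /predualE [h [k wE]] wp; have [e [re el er es _]] := vn_unit_ex.
pose l0 := 2^-1 *: (h + k); pose t a := pi a l0.
have wl : lin w.
  by move=> c a b; rewrite !wE (srep_linl pis) hipDr hipZr.
(* As <pi(a) h, pi(a) k> is real, it equals |pi(a)(h + k)/2|^2 - |pi(a)(h - k)/2|^2. *)
have wdom a : w (astar a ** a) <= `|pi a l0| ^+ 2.
  have e1 : w (astar a ** a) = hip (pi a h) (pi a k).
    by rewrite wE (srepM pis) (srep_adjr pis) astarK.
  have e2 : hip (pi a k) (pi a h) = hip (pi a h) (pi a k).
    by rewrite -[LHS]hip_conj -e1 conj_Creal// ger0_real.
  rewrite /l0 linearZ linearD normrZ exprMn norm_addE e2 -e1 /= ger0_norm//.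
  apply: (@le_subE _ ((2^-1) ^+ 2 * `|pi a h - pi a k| ^+ 2)).
    by rewrite mulr_ge0 ?exprn_ge0.
  by rewrite norm_subE e2 -e1; field.
have wk l m : w (astar (lc id l) ** lc id m) = kform (fun a b => w (astar a ** b)) l m.
  rewrite /lc /kform astar_sum amul_suml (lin_sum wl); apply: eq_bigr => p _.
  rewrite amul_sumr (lin_sum wl); apply: eq_bigr => q _.
  by rewrite astarZ amulZl amulZr !(linZ wl) /GRing.scale /= mulrA.
have wpsd : psd (fun a b => w (astar a ** b)).
  split=> [a b|l]; last by rewrite -wk.
  have q c : w (astar (a + c *: b) ** (a + c *: b)) \is Num.real by rewrite ger0_real.
  have r a' : w (astar a' ** a') \is Num.real by rewrite ger0_real.
  have qE c : w (astar (a + c *: b) ** (a + c *: b)) = w (astar a ** a) +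
      (c * w (astar a ** b) + c^* * w (astar b ** a)) + c^* * c * w (astar b ** b).
    rewrite astarD astarZ amulDl !amulDr !amulZl !amulZr !(linD wl) !(linZ wl) /GRing.scale /=.
    by ring.
  symmetry; apply: hermitian_of_real.
    have := q 1; rewrite qE rmorph1 !mul1r => h1.
    have := rpredB h1 (rpredD (r b) (r a)).
    by rewrite [X in X \in _](_ : _ = w (astar a ** b) + w (astar b ** a))//; ring.
  have ii : - 'i * 'i = 1 :> C by rewrite mulNr -expr2 sqrCi opprK.
  have := q 'i; rewrite qE conjCi ii => h1.
  have := rpredB h1 (rpredD (r a) (r b)).
  rewrite [X in X \in _](_ : _ = 'i * (w (astar a ** b) - w (astar b ** a)))//.
  by ring.
have [G [eta [etaE etat]]] := kernel_space wpsd.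
have [|Q [Qt QN Q0]] := @extension R K G A t eta 1 ler01.
  move=> l; rewrite mul1r -(@ler_pXn2r _ 2)// ?nnegrE// -!hip_norm.
  have -> : hip (lc eta l) (lc eta l) = w (astar (lc id l) ** lc id l).
    by rewrite wk hip_lc; apply: eq_bigr => p _; apply: eq_bigr => q _; rewrite etaE.
  by rewrite (srep_lc l0 l pis) hip_norm wdom.
have orth a v : (forall b, hip v (t b) = 0) -> forall b, hip (pi a v) (t b) = 0.
  by move=> hv b; rewrite (srep_adj pis) /t -(srepM pis) hv.
pose T := bcomp (adj Q) Q.
have TE x : T x = adj Q (Q x) by rewrite bcompE.
(* Operators are compared on the orbit of [l0] and on its orthogonal complement, where [Q] vanishes.
   This is how T = Q^*Q is seen to commute with [pi]. *)
have vanish (f g : bop K K) : (forall a, f (t a) = g (t a)) ->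
    (forall v, (forall b, hip v (t b) = 0) -> f v = g v) -> forall x, f x = g x.
  move=> ft fv x; apply: hip_injl => y; rewrite !adjE; apply/eqP; rewrite -subr_eq0 -hipBr.
  set d := _ - _; have dt b : hip d (t b) = 0 by rewrite hipBl -!adjEr ft subrr.
  have d0 : d = 0.
    by apply: hip_eq0; rewrite {2}/d hipBr -!adjE fv// subrr.
  by rewrite d0 hip0r.
have Tc a x : pi a (T x) = T (pi a x).
  rewrite -!bcompE; move: x; apply: vanish => [c|v hv]; last first.
    by rewrite !bcompE Q0// (Q0 _ (orth a _ hv)) !linear0.
  rewrite !bcompE Qt /t -(srepM pis) -/(t _) Qt.
  set d1 := pi a _; set d2 := adj Q _.
  have e1 z : hip d1 z = hip (eta c) (Q (pi (astar a) z)).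
    by rewrite /d1 (srep_adj pis) -adjEr.
  have e2 z : hip d2 z = hip (eta (a ** c)) (Q z) by rewrite /d2 -adjEr.
  apply/eqP; rewrite -subr_eq0; apply/eqP/hip_eq0; set d := d1 - d2.
  have dt b : hip d (t b) = 0.
    rewrite hipBl e1 e2 /t -(srepM pis) -!/(t _) !Qt !etaE astarM !amulA subrr//.
  by rewrite {1}/d hipBl e1 e2 Q0 ?(Q0 d)// ?hip0r ?subrr//; exact: orth.
have [||S [sS _ SS Sc]] := @bop_sqrt R K T.
- by move=> x y; rewrite !TE -adjEr adjE.
- by move=> x; rewrite TE -adjE hip_ge0.
(* w(a) = <eta(e), eta(a)> = <l0, T pi(a) l0> = <S l0, pi(a) S l0>, as S = T^(1/2) commutes with
   pi(a). *)
exists (S l0) => a.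
rewrite (Sc (pi a)); last by move=> x; rewrite Tc.
rewrite sS SS TE -adjE -[l0 in X in hip X](pi_unit re) -!/(t _) !Qt etaE es el//.
Qed.

End Predual.

Section Normality.
Variables (R : realType) (A : cstarType R) (N : von_neumann A).
Local Notation C := (cplx R).
Local Notation "a ** b" := (amul a b) (at level 40, left associativity).
Local Notation rho := (vn_rep N).

Definition vec_normal (H : hilbertType R) (s : A -> bop H H) :=
  forall h k, predual N (fun a => hip h (s a k)).

Variables (K : hilbertType R) (pi : A -> bop K K) (J : nat -> bop K K).
Hypothesis hM : vn_model N pi J.

Let pis : star_rep pi. Proof. by case: hM. Qed.
Let predualE f : predual N f <-> exists h k, forall a, f a = hip h (pi a k).
Proof. by case: hM. Qed.

Lemma predual_lin f : predual N f -> forall c a b, f (c *: a + b) = c * f a + f b.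
Proof.
by move=> /predualE [h [k fE]] c a b; rewrite !fE (srep_linl pis) hipDr hipZr.
Qed.

Lemma predual_bounded f : predual N f -> exists c, forall a, `|f a| <= c * `|a|.
Proof.
move=> /predualE [h [k fE]]; exists (`|h| * `|k|) => a; rewrite fE.
apply: le_trans (hip_cs _ _) _; rewrite -mulrA ler_wpM2l// mulrC.
exact: (srep_norm pis).
Qed.

Lemma series_single (E : normedModType C) (u : nat -> E) : (forall i, u i.+1 = 0) ->
  series u @ \oo --> u 0%N.
Proof.
move=> u0; rewrite -(cvg_shiftS (series u)); apply/cvgrPdist_lt => e e0; near=> n.
by rewrite /series /= big_nat_recl// big1_seq ?addr0 ?subrr ?normr0// => i _; exact: u0.
Unshelve. all: by end_near. Qed.

Lemma single_square_summable (H : hilbertType R) (h : H) :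
  square_summable (fun i => if i is 0%N then h else 0).
Proof.
apply/cvg_ex; exists (`|h| ^+ 2).
by apply: (series_single (u := fun i => `|if i is 0%N then h else 0| ^+ 2)) => i; rewrite normr0 expr0n.
Qed.

Lemma vec_ultraweak (H : hilbertType R) (h k : H) : @ultraweak R H (fun t => hip h (t k)).
Proof.
exists (fun i => if i is 0%N then h else 0), (fun i => if i is 0%N then k else 0).
split=> [||t]; try exact: single_square_summable.
by apply: (series_single (u := fun i => hip (if i is 0%N then h else 0)
  (t (if i is 0%N then k else 0)))) => i; rewrite hip0l.
Qed.

Lemma normal_vec (H : hilbertType R) (s : A -> bop H H) : star_rep s ->
  continuous_wrt (predual N) (@ultraweak R H) s -> vec_normal s.
Proof.
move=> ss sc h k; apply: (predual_continuous hM).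
  by move=> c a b; rewrite (srep_linl ss) hipDr hipZr.
by move=> F x FF Fx; exact: (sc F x FF Fx _ (vec_ultraweak h k)).
Qed.

Lemma lact_normal (F : corrType A) (f : A -> C) (x y : F) :
  setting_corr (WStarSetting N) F -> predual N f -> predual N (fun a => f (mip y (lact a x))).
Proof.
move=> [_ Fc] pf; have fl := predual_lin pf; apply: (predual_continuous hM).
  by move=> c a b; rewrite (lact_linl x) mipDr mipZr fl.
move=> G a FF Ga; apply: (Fc G a FF Ga (fun t => f (mip y (t x)))).
have [c fc] := predual_bounded pf.
have f0 : f 0 = 0 by apply: (addrI (f 0)); rewrite -{1}(mul1r (f 0)) -fl scale1r !addr0.
exists (fun=> f), (fun=> y), (fun i => if i is 0%N then x else 0), (fun=> c).
split=> //.
  apply/cvg_ex; exists (c * `|y| * `|x|).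
  by apply: (series_single (u := fun i => c * `|y| * `|if i is 0%N then x else 0|)) => i;
    rewrite normr0 mulr0.
move=> t [g tg].
apply: (series_single (u := fun i => f (mip y (t (if i is 0%N then x else 0))))) => i.
have -> : t 0 = 0 by apply: mip_injr => z; rewrite -[LHS]mip_star tg mip0l mip0r astar0.
by rewrite mip0r f0.
Qed.

(** Each functional <k_i, s(.) k_i> is the vector functional of some l_i. Evaluation at the unit
    gives |l_i| <= |k_i|, so the l_i can be merged into one vector. *)
Lemma normal_square_summable (H : hilbertType R) (s : A -> bop H H) (k : nat -> H) :
  star_rep s -> vec_normal s -> square_summable k ->
  exists L : K, forall a, series (fun i => hip (k i) (s a (k i))) @ \oo --> hip L (pi a L).
Proof.
move=> ss sn sk; have [e [re el er es e1]] := vn_unit_ex N.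
have hl : forall i : nat, exists l : K, forall a, hip (k i) (s a (k i)) = hip l (pi a l).
  move=> i; apply: (predual_positive hM); first exact: sn.
  by move=> a; rewrite srep_sq// exprn_ge0.
have [l lE] := choice hl; have [M hM'] := square_summable_bounded sk.
have [|L hL] := @isometries_sum _ _ _ _ _ _ hM l M.
  move=> n; apply: le_trans (hM' n); apply: ler_sum => i _.
  rewrite -hip_norm -{2}(pi_unit hM re (l i)) -lE.
  have h0 : 0 <= hip (k i) (s e (k i)) by rewrite (_ : e = astar e ** e) ?srep_sq ?exprn_ge0// es er.
  rewrite -(ger0_norm h0); apply: le_trans (hip_cs _ _) _; rewrite expr2 ler_wpM2l//.
  by apply: le_trans (srep_norm ss _ _) _; rewrite ler_piMl.
exists L => a; rewrite (_ : (fun i => _) = (fun i => hip (l i) (pi a (l i))))//.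
by apply/funext => i.
Qed.

Lemma ultraweak_bound (H : hilbertType R) (w : bop H H -> C) (h k : nat -> H) :
  square_summable h ->
  (forall t : bop H H, series (fun i => hip (h i) (t (k i))) @ \oo --> w t) ->
  exists2 M : C, 0 <= M & forall (t : bop H H) (u : nat -> C) (b : C),
    (forall i, `|t (k i)| ^+ 2 <= u i) -> series u @ \oo --> b -> `|w t| ^+ 2 <= M * b.
Proof.
move=> /square_summable_bounded [M hM'] hw; exists M.
  by have := hM' 0%N; rewrite big_ord0.
move=> t u b tu ub.
have M0 : 0 <= M by have := hM' 0%N; rewrite big_ord0.
rewrite expr2; apply: (le_limit _ (cvgM (cvg_norm (hw t)) (cvg_norm (hw t))) (cvgMl_tmp ub)) => n.
rewrite /= -[X in X <= _]/(_ * _) -expr2 /series /= !big_mkord.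
apply: (le_trans (sum_hip_cs n h (fun i => t (k i)))).
apply: ler_pM; rewrite ?sumr_ge0//; try by move=> i _; rewrite exprn_ge0.
by apply: ler_sum => i _.
Qed.

Lemma ultraweak_lin (H : hilbertType R) (w : bop H H -> C) : @ultraweak R H w ->
  forall (c : C) (t t' t'' : bop H H), (forall x, t'' x = c *: t x + t' x) -> w t'' = c * w t + w t'.
Proof.
move=> [h [k [_ _ hw]]] c t t' t'' e.
apply: (@clim_unique _ _ _ _ (hw t'')).
rewrite (_ : series _ = fun n => c * series (fun i => hip (h i) (t (k i))) n +
   series (fun i => hip (h i) (t' (k i))) n); last first.
  apply/funext => n; rewrite /series /= mulr_sumr -big_split; apply: eq_bigr => i _ /=.
  by rewrite e hipDr hipZr.
by apply: cvgD; [apply: cvgMl_tmp|].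
Qed.

Lemma vec_normal_continuous (H : hilbertType R) (s : A -> bop H H) : star_rep s ->
  vec_normal s -> continuous_wrt (predual N) (@ultraweak R H) s.
Proof.
move=> ss sn F x FF Fx w uw; apply: (Fx (fun a => w (s a))).
have [h [k [sh sk hw]]] := uw.
have [L hL] := normal_square_summable ss sn sk.
have [M M0 wM] := ultraweak_bound sh hw.
apply: (@predual_dominated _ _ _ _ _ _ hM _ M L) => // [c a b|a].
  by apply: ultraweak_lin uw _ _ _ _ _ => y; exact: (srep_linl ss).
rewrite -(srep_sq _ _ pis); apply: wM (hL _) => i.
by rewrite (srep_sq _ _ ss).
Qed.

End Normality.

(** * Density and automatic continuity *)

Section Factorization.
Variables (R : realType) (A : cstarType R) (N : von_neumann A).
Local Notation C := (cplx R).
Local Notation "a ** b" := (amul a b) (at level 40, left associativity).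
Local Notation rho := (vn_rep N).

(** r is the inverse of eps + m: this operator is bounded below, hence invertible on [vn_space], and
    its inverse commutes with the commutant. *)
Lemma vn_inverse (m : A) (eps : C) : 0 < eps -> cpos m -> (forall h, 0 <= hip h (rho m h)) ->
  exists r, [/\ astar r = r, forall a, m ** r ** a = a - eps *: (r ** a) &
    forall a, r ** m ** a = a - eps *: (r ** a)].
Proof.
move=> e0 [ms _] mp; have rs := vn_star_rep N.
pose B := bcomb eps (bid _) (rho m).
have BE x : B x = eps *: x + rho m x by rewrite bcombE bidE.
have low x : eps * `|x| ^+ 2 <= hip x (B x).
  by rewrite BE hipDr hipZr hip_norm lerDl.
have Bb x : `|x| <= eps^-1 * `|B x|.
  have [->|x0] := eqVneq x 0; first by rewrite normr0 mulr_ge0 ?invr_ge0 ?(ltW e0).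
  rewrite ler_pdivlMl// -(@ler_pM2r _ `|x|) ?normr_gt0// -mulrA -expr2.
  apply: le_trans (low x) _; rewrite -[X in X <= _]ger0_norm; last first.
    by apply: le_trans (low x); rewrite mulr_ge0 ?exprn_ge0// ltW.
  by rewrite mulrC; exact: hip_cs.
have [||L [LB _ _]] := @extension R _ _ (vn_space N) B id (eps^-1).
- by rewrite invr_ge0 ltW.
- move=> l; rewrite (_ : lc B l = B (lc id l)); first exact: Bb.
  by rewrite linear_lc.
have BL x : B (L x) = x.
  rewrite -[RHS]bidE -bcompE; move: x; apply: (@bop_total _ _ _ _ B) => [v hv|x].
    have h0 := low v; rewrite hv in h0.
    apply/normr0_eq0/eqP; rewrite -(@sqrf_eq0 _ `|v|) eq_le exprn_ge0// andbT.
    by rewrite -(pmulr_rle0 _ e0).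
  by rewrite bcompE bidE LB.
have [|r hr] := @vn_bicommutant _ _ N L.
  move=> s sc x; rewrite -[LHS]LB; congr (L _).
  by rewrite -[in RHS](BL x) !BE linearD linearZ /= sc.
have key a : r ** m ** a = a - eps *: (r ** a).
  apply: (@vn_inj _ _ N) => h; rewrite !(srepM rs) (linB (srep_linl rs h)) (linZ (srep_linl rs h)).
  rewrite (srepM rs) -!hr; apply/eqP; rewrite eq_sym subr_eq -linearZ -linearD addrC -BE LB.
  exact/eqP.
have key' a : m ** r ** a = a - eps *: (r ** a).
  apply: (@vn_inj _ _ N) => h; rewrite !(srepM rs) (linB (srep_linl rs h)) (linZ (srep_linl rs h)).
  rewrite (srepM rs) -!hr; apply/eqP; rewrite eq_sym subr_eq addrC -BE BL.
  exact/eqP.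
exists r; split=> //; have [e [re el er es _]] := vn_unit_ex N.
have h3 : astar r ** m ** r = astar r - eps *: (astar r ** r).
  by rewrite -amulA -[X in _ ** X]er key' amulBr amulZr !er.
have : astar r ** m ** r = r - eps *: (astar r ** r).
  have := congr1 astar (key' e); rewrite !er astarM ms astarB astarZ es (conj_Creal (gtr0_real e0)).
  by move=> ->; rewrite amulBl amulZl el.
by rewrite h3 => /addIr.
Qed.

(** With r = (eps + <y,y>)^(-1), take y' = y r g^* and z = eps y r, so that y' g = y r <y,y> = y -
    z. The first bound holds because p = g r g^* satisfies p^2 <= p, the second because eps |r| <=
    1. *)
Lemma mip_factor (F : hilbmodType A) (y : F) (eps : C) : 0 < eps ->
  exists y' g z, [/\ y = ract y' g + z, `|y'| <= 1, `|z| ^+ 2 <= eps &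
    mip y y = astar g ** g].
Proof.
move=> e0; have rs := vn_star_rep N.
have [e [_ el er es _]] := vn_unit_ex N.
have ye (x : F) : ract x e = x by apply: mip_injr => z; rewrite mip_ract er.
have [g gE] := mip_ge0 y.
have [||r [rr mr rm]] := @vn_inverse (mip y y) eps e0.
- exact: cpos_mip.
- by move=> h; rewrite gE srep_sq// exprn_ge0.
have rme : r ** mip y y = e - eps *: r by rewrite -[LHS]er rm er.
exists (ract (ract y r) (astar g)), g, (eps *: ract y r).
pose p := g ** r ** astar g; pose c := r ** astar g.
have ps : astar p = p by rewrite /p !astarM astarK rr amulA.
have pp : p ** p = p - eps *: (astar c ** c).
  rewrite /p /c astarM astarK rr -!amulA [astar g ** (g ** _)]amulA -gE.
  by rewrite [r ** (mip y y ** _)]amulA rm amulBr amulZr !amulA.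
have sq (a : A) : eps *: (astar a ** a) = astar (sqrtC eps *: a) ** (sqrtC eps *: a).
  rewrite astarZ amulZl amulZr scalerA conj_Creal ?ger0_real ?sqrtC_ge0 ?(ltW e0)//.
  by rewrite -expr2 sqrtCK.
have p1 : `|p| <= 1.
  have : `|p| ^+ 2 <= `|p|.
    rewrite -anorm_star ps.
    have {3}-> : p = p ** p + eps *: (astar c ** c) by rewrite pp subrK.
    apply: norm_le_cpos; last by rewrite sq; exact: cpos_sq.
    by rewrite -{1}ps; exact: cpos_sq.
  have [->|p0] := eqVneq `|p| 0; first by rewrite ler01.
  by rewrite expr2 ger_pMr// lt_def p0 normr_ge0.
have rm2 : r ** mip y y ** r = r - eps *: (r ** r) by rewrite rm.
have cr : cpos (r ** mip y y ** r).
  have -> : r ** mip y y ** r = astar (g ** r) ** (g ** r).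
    by rewrite gE astarM rr !amulA.
  exact: cpos_sq.
have rE : r = r ** mip y y ** r + eps *: (r ** r) by rewrite rm2 subrK.
have crr : cpos (eps *: (r ** r)) by rewrite -{1}rr sq; exact: cpos_sq.
have r1 : eps * `|r| <= 1.
  have : eps * `|r| ^+ 2 <= `|r|.
    rewrite -anorm_star rr -{1}[eps]gtr0_norm// -normrZ.
    by rewrite {3}rE addrC; exact: norm_le_cpos.
  have [->|p0] := eqVneq `|r| 0; first by rewrite mulr0 ler01.
  by rewrite expr2 mulrA ger_pMl// lt_def p0 normr_ge0.
split=> //.
- rewrite !ractA -gE rme; apply: mip_injr => z.
  by rewrite mipDr mip_ract amulBr amulZr er mipZr mip_ract subrK.
- have h : `|ract (ract y r) (astar g)| ^+ 2 = `|p| ^+ 2.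
    rewrite -mip_norm -anorm_star ps; congr `|_|.
    by rewrite !mip_ract !mip_ractl astarK rr /p gE !amulA.
  by rewrite -(@ler_pXn2r _ 2)// ?nnegrE// h expr1n expr_le1.
- rewrite -mip_norm mipZl mipZr mip_ract mip_ractl rr scalerA normrZ.
  rewrite conj_Creal ?gtr0_real// normrM gtr0_norm// -mulrA ler_piMr ?(ltW e0)//.
  apply: le_trans r1; rewrite ler_wpM2l ?(ltW e0)// {3}rE.
  exact: norm_le_cpos.
Qed.

End Factorization.

Lemma cvg_half (R : realType) : (fun n : nat => (2^-1) ^+ n : cplx R) @ \oo --> (0 : cplx R).
Proof.
apply/cvgn_le0P => e /cplx_archi [n hn]; exists n.+1 => m nm.
rewrite subr0 ger0_norm ?exprn_ge0 ?invr_ge0//; apply: le_trans (ltW hn).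
rewrite exprVn lef_pV2 ?posrE ?exprn_gt0 ?ltr0n// -natrX ler_nat.
by apply: leq_trans nm _; exact/ltnW/ltn_expl.
Qed.

Lemma sum_half (R : realType) n : \sum_(i < n) (2^-1) ^+ i <= 2 :> cplx R.
Proof.
suff -> : \sum_(i < n) (2^-1) ^+ i = 2 - 2 * (2^-1) ^+ n :> cplx R.
  by rewrite gerDl oppr_le0 mulr_ge0// exprn_ge0// invr_ge0.
elim: n => [|n IH]; first by rewrite big_ord0 expr0 mulr1 subrr.
by rewrite big_ord_recr/= IH exprS; field.
Qed.

Section Domination.
Variables (R : realType) (A : cstarType R) (N : von_neumann A).
Local Notation C := (cplx R).
Local Notation "a ** b" := (amul a b) (at level 40, left associativity).
Variables (K : hilbertType R) (pi : A -> bop K K) (J : nat -> bop K K).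
Hypothesis hM : vn_model N pi J.
Variables (F : hilbmodType A) (G : hilbertType R) (t : F -> K -> G).
Hypothesis ht : htensor pi t.

Let pis : star_rep pi. Proof. by case: hM. Qed.
Let predualE f : predual N f <-> exists h k, forall a, f a = hip h (pi a k).
Proof. by case: hM. Qed.

(* Writing [f x = <g0, t x l>], [g0] is approximated by vectors [t w l]; each
   correction is factored as [w = ract y b + small] with [y] in the unit ball,
   which makes the resulting series of elementary functionals absolutely summable. *)
Lemma dominated_sigma (f : F -> C) (M : C) l : 0 <= M -> lin f ->
  (forall x, `|f x| <= M * `|t x l|) -> sigma_functionals N f.
Proof.
move=> M0 fl fM.
have tl : lin (fun x => t x l) by exact: (ht_linl pis ht).
have tlc L : lc (fun x => t x l) L = t (lc id L) l.
  elim: L => [|[c a] L IH]; first by rewrite /lc !big_nil (lin0 tl).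
  by rewrite /lc !big_cons /= [RHS]tl; congr (_ + _); exact: IH.
have fev L : ev f L = f (lc id L).
  elim: L => [|[c a] L IH]; first by rewrite /ev /lc !big_nil (lin0 fl).
  by rewrite /ev /lc !big_cons /= [RHS]fl; congr (_ + _); exact: IH.
have [|g [gf _ [Ls Lg]]] := @family_riesz R G F (fun x => t x l) f (M ^+ 2) (exprn_ge0 _ M0).
  by move=> L; rewrite fev tlc -exprMn lerXn2r ?nnegrE ?mulr_ge0.
pose d n : C := (`|g| + 1) * (2^-1) ^+ n.
have d0 n : 0 < d n by rewrite mulr_gt0 ?exprn_gt0 ?invr_gt0// ltr_wpDl.
have dS n : d n = d n.+1 + d n.+1 by rewrite /d exprS; field.
have tq x : `|t x l| ^+ 2 = hip l (pi (mip x x) l) by rewrite -hip_norm (ht_ip ht).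
have step : forall p : nat * F, exists q : F * A, `|g - t p.2 l| <= d p.1 ->
    [/\ `|q.1| <= 1, `|pi q.2 l| <= 2 * d p.1 & `|g - t (p.2 + ract q.1 q.2) l| <= d p.1.+1].
  move=> [n w] /=; have h0 : 0 < d n.+1 / 2 by rewrite divr_gt0.
  have [y hy] : exists y, `|g - t w l - t y l| <= d n.+1 / 2.
    have /cvgn_le0P/(_ _ h0) [m /(_ m (leqnn m))] := Lg.
    rewrite tlc => hm; exists (lc id (Ls m) - w); rewrite (linB tl) opprB.
    by rewrite addrA subrK distrC.
  (* Chosen so that the remainder z of the factorization has |t z l| <= d_(n+1)/2; the other half of
     d_(n+1) is the error left by y. *)
  pose eta := d n.+1 / 2 / (`|l| + 1).
  have l1 : 0 < `|l| + 1 by rewrite ltr_wpDl.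
  have eta0 : 0 < eta by rewrite divr_gt0.
  have [y' [b [z [yE y1 z1 myb]]]] := mip_factor N y (exprn_gt0 2 eta0).
  have tz : `|t z l| <= d n.+1 / 2.
    apply: le_trans (ht_norm pis ht _ _) _.
    have -> : d n.+1 / 2 = eta * (`|l| + 1) by rewrite /eta divfK ?gt_eqF.
    apply: ler_pM => //; last by rewrite lerDl ler01.
    by rewrite -(@ler_pXn2r _ 2)// ?nnegrE ?(ltW eta0).
  have half : d n.+1 / 2 + d n.+1 / 2 = d n.+1 by field.
  exists (y', b) => /= gw; split=> //.
  - have -> : `|pi b l| = `|t y l|.
      by apply/eqP; rewrite -(@eqrXn2 _ 2)// tq myb srep_sq.
    have -> : t y l = (g - t w l) - (g - t w l - t y l) by rewrite opprB addrC subrK.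
    apply: le_trans (ler_normB _ _) _; rewrite mulr_natl mulr2n lerD//.
    by apply: le_trans hy _; apply: (@le_subE _ (d n.+1 + d n.+1 / 2));
      [rewrite addr_ge0 ?(ltW h0) ?(ltW (d0 _))|rewrite (dS n); field].
  - have -> : ract y' b = y - z by rewrite yE addrK.
    rewrite (linD tl) (linB tl).
    have -> : g - (t w l + (t y l - t z l)) = (g - t w l - t y l) + t z l.
      by rewrite !opprD opprK !addrA.
    by apply: le_trans (ler_normD _ _) _; rewrite -half lerD.
have [q hq] := choice step.
pose w := fun n => iteri n (fun n w => w + ract (q (n, w)).1 (q (n, w)).2) 0.
have wS n : w n.+1 = w n + ract (q (n, w n)).1 (q (n, w n)).2 by [].
have wd n : `|g - t (w n) l| <= d n.
  elim: n => [|n IH].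
    by rewrite /w /= (lin0 tl) subr0 /d expr0 mulr1 lerDl ler01.
  by have [] := hq (n, w n) IH.
pose y n := (q (n, w n)).1; pose b n := (q (n, w n)).2.
have yb n : `|y n| <= 1 /\ `|pi (b n) l| <= 2 * d n by have [] := hq (n, w n) (wd n).
exists (fun i a => hip (pi (b i) l) (pi a l)), y, (fun i => 2 * d i * `|l|); split.
- by move=> i; apply/predualE; exists (pi (b i) l), l.
- move=> i a; apply: le_trans (hip_cs _ _) _; rewrite -mulrA ler_pM//.
    by case: (yb i).
  by rewrite mulrC; exact: (srep_norm pis).
- have [||s hs] := @series_bounded_cvg _ (fun i => 2 * d i * `|l| * `|y i|)
      (2 * (`|g| + 1) * `|l| * 2); last by apply/cvg_ex; exists s.
    by move=> i; rewrite !mulr_ge0// ltW.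
  move=> n; apply: (@le_trans _ _ (\sum_(i < n) (2 * (`|g| + 1) * `|l|) * (2^-1) ^+ i)).
    apply: ler_sum => i _; have [y1 _] := yb i.
    apply: (@le_trans _ _ (2 * d i * `|l|)).
      by rewrite ler_piMr// !mulr_ge0// ltW.
    by rewrite /d le_eqVlt; apply/orP; left; apply/eqP; ring.
  rewrite -mulr_sumr ler_wpM2l ?sum_half// !mulr_ge0//.
- move=> x; rewrite (_ : series _ = fun n => hip (t (w n) l) (t x l)); last first.
    apply/funext => n; elim: n => [|n IH].
      by rewrite /series /= big_geq// /w /= (lin0 tl) hip0l.
    rewrite wS (linD tl) hipDl -IH /series /= big_nat_recr//=; congr (_ + _).
    rewrite (ht_ip ht) mip_ractl (srepM pis).
    by rewrite -(srep_adj pis).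
  rewrite -gf; apply: cvg_hip; last exact: cvg_cst.
  apply: (@cvg_rate _ _ _ _ d) => [n|]; first by rewrite distrC.
  rewrite -[X in _ --> X](mulr0 (`|g| + 1)); apply: cvgMl_tmp; exact: cvg_half.
Qed.

End Domination.

Section Density.
Variables (R : realType) (A : cstarType R).
Local Notation C := (cplx R).
Local Notation "a ** b" := (amul a b) (at level 40, left associativity).

Definition setting_normal (S : setting A) (H : hilbertType R) (s : A -> bop H H) :=
  if S is WStarSetting N then vec_normal N s else True.

Variables (F : hilbmodType A) (H : hilbertType R) (s : A -> bop H H).
Hypothesis ss : star_rep s.

(** The family k is first merged into one vector L of the model with <L, pi(.) L> = sum <k_i, s(.)
    k_i>; then the hypothesis reads |f x|^2 <= M |t x L|^2. *)
Lemma tensor_dominated_sigma N (f : F -> C) (M : C) (k : nat -> H) :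
  vec_normal N s -> 0 <= M -> lin f -> square_summable k ->
  (forall x b, series (fun i => hip (k i) (s (mip x x) (k i))) @ \oo --> b ->
     `|f x| ^+ 2 <= M * b) -> sigma_functionals N f.
Proof.
move=> sn M0 fl sk fM; have [K [pi [J hM]]] := vn_model_ex N.
have pis : star_rep pi by case: hM.
have [G [t ht]] := tensor_ex F pis.
have [L hL] := normal_square_summable hM ss sn sk.
apply: (dominated_sigma hM ht (M := sqrtC M) (l := L)) => //; first by rewrite sqrtC_ge0.
move=> x; rewrite -(@ler_pXn2r _ 2)// ?nnegrE ?mulr_ge0 ?sqrtC_ge0// exprMn sqrtCK.
by rewrite -[`|t x L| ^+ 2]hip_norm (ht_ip ht); exact: fM.
Qed.

(** Cauchy-Schwarz bounds |w(V x)|^2 by a multiple of sum <k_i, s(<x,x>) k_i>. Hence each ultraweak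
    w pulls back along V to one of the [sigma_functionals], whose convergence along the filter is
    given. *)
Lemma auto_continuous N (V : F -> bop H H) : vec_normal N s -> (forall h, lin (fun x => V x h)) ->
  (forall x h, `|V x h| ^+ 2 <= hip h (s (mip x x) h)) ->
  continuous_wrt (@sigma_functionals R A N F) (@ultraweak R H) V.
Proof.
move=> sn Vl Vb FF x pF Fx w uw; apply: (Fx (fun x => w (V x))).
have [h [k [sh sk hw]]] := uw.
have [M M0 wM] := ultraweak_bound sh hw.
apply: (@tensor_dominated_sigma N (w \o V) M k) => // [c y z|y b yb].
  by apply: ultraweak_lin uw _ _ _ _ _ => u; exact: Vl.
by apply: (wM _ _ _ _ yb) => i; exact: Vb.
Qed.

(** The functionals whose vanishing passes from a set to the [module_closure] of its span. Density
    arguments for both settings are conducted with them. *)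
Definition setting_functional (S : setting A) (f : F -> C) := lin f /\
  match S with
  | CStarSetting => exists2 c, 0 <= c & forall x, `|f x| <= c * `|x|
  | WStarSetting N => forall (Phi : set_system F) x, ProperFilter Phi ->
      (forall g, @sigma_functionals R A N F g -> g @ Phi --> g x) -> f @ Phi --> f x
  end.

Lemma functional_dense S (f : F -> C) (B : set F) x : setting_functional S f ->
  (forall b, B b -> f b = 0) -> module_closure S (lspan B) x -> f x = 0.
Proof.
move=> [fl fc] fB.
have f0 y : lspan B y -> f y = 0.
  move=> [n [c [b [Bb ->]]]]; rewrite (lin_sum fl) big1// => i _.
  by rewrite (linZ fl) fB// scaler0.
case: S fc => [|N] /= fc.
  have [c c0 fb] := fc.
  move=> /closure_seqP [u Bu /cvgn_le0P ux].
  symmetry; apply: (@clim_unique _ (fun n => f (u n))).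
    rewrite (_ : (fun n => _) = (fun=> 0)); first exact: cvg_cst.
    by apply/funext => n; exact: f0.
  apply/cvgn_le0P => e e0; have d1 : 0 < c + 1 by rewrite ltr_wpDl.
  have [n hn] := ux _ (divr_gt0 e0 d1); exists n => m /hn um.
  rewrite -(linB fl); apply: le_trans (fb _) _.
  rewrite mulrC -[e](@divfK _ (c + 1)) ?gt_eqF//.
  by rewrite ler_pM// lerDl ler01.
move=> [Phi [pP PB hP]].
apply: (cvg_unique (F := f @ Phi) _ (fc _ _ pP hP)); first exact: norm_hausdorff.
by apply: cvg_near_cst; apply: filterS PB => y yB; rewrite f0.
Qed.

Lemma setting_functionalB S (f g : F -> C) : setting_functional S f -> setting_functional S g ->
  setting_functional S (fun x => f x - g x).
Proof.
move=> [fl fc] [gl gc]; split.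
  by move=> c x y; rewrite fl gl scalerBr opprD addrACA.
case: S fc gc => [[c c0 fc] [d d0 gc]|N fc gc].
  exists (c + d) => [|x]; first by rewrite addr_ge0.
  by rewrite mulrDl; apply: le_trans (ler_normB _ _) _; exact: lerD.
by move=> Phi x pP hP; apply: cvgB; [exact: fc|exact: gc].
Qed.

Variables (G : hilbertType R) (t : F -> H -> G).
Hypothesis ht : htensor s t.

Lemma tensor_functional S (v : G) (d : H) : setting_normal S s ->
  setting_functional S (fun x => hip v (t x d)).
Proof.
move=> sn; split; first by move=> c y z /=; rewrite (ht_linl ss ht) hipDr hipZr.
case: S sn => [_|N sn] /=.
  exists (`|v| * `|d|) => [|x]; first exact: mulr_ge0.
  apply: le_trans (hip_cs _ _) _; rewrite -mulrA ler_wpM2l// mulrC.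
  exact: (ht_norm ss ht).
move=> Phi x pP hP; apply: hP.
apply: (@tensor_dominated_sigma N (fun x => hip v (t x d)) (`|v| ^+ 2)
  (fun i => if i is 0%N then d else 0)) => //.
- by move=> c y z /=; rewrite (ht_linl ss ht) hipDr hipZr.
- exact: single_square_summable.
- move=> y b yb; suff -> : b = `|t y d| ^+ 2.
    by rewrite -exprMn lerXn2r ?nnegrE ?mulr_ge0//; exact: hip_cs.
  apply: clim_unique yb _; rewrite -hip_norm (ht_ip ht).
  apply: (series_single (u := fun i => hip (if i is 0%N then d else 0)
    (s (mip y y) (if i is 0%N then d else 0)))) => i.
  by rewrite hip0l.
Qed.

Lemma module_dense S (B : set F) (v : G) (d : H) x : setting_normal S s ->
  (forall b, B b -> hip v (t b d) = 0) -> module_closure S (lspan B) x -> hip v (t x d) = 0.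
Proof. by move=> sn; apply: functional_dense; exact: tensor_functional. Qed.

End Density.

(** * Normality of a representation from a total family of vectors *)

Section NormalExtension.
Variables (R : realType) (A : cstarType R) (N : von_neumann A).
Local Notation C := (cplx R).
Local Notation "a ** b" := (amul a b) (at level 40, left associativity).
Variables (K : hilbertType R) (pi : A -> bop K K) (J : nat -> bop K K).
Hypothesis hM : vn_model N pi J.
Variables (H : hilbertType R) (s : A -> bop H H).
Hypothesis ss : star_rep s.

Let pis : star_rep pi. Proof. by case: hM. Qed.

Let dominated g := exists L : K, forall a, `|s a g| <= `|pi a L|.

Let pi_merge (l : nat -> K) (M : C) : (forall n, \sum_(i < n) `|l i| ^+ 2 <= M) ->
  exists L : K, forall a i, `|pi a (l i)| <= `|pi a L|.
Proof.
move=> /(isometries_sum hM) [L hL]; exists L => a i.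
rewrite -(@ler_pXn2r _ 2)// ?nnegrE// -(srep_sq a L pis).
apply: le_trans (partial_sum_le i.+1 _ (hL (astar a ** a))) => [|n]; last first.
  by rewrite srep_sq// exprn_ge0.
rewrite big_ord_recr/= srep_sq// lerDr sumr_ge0// => j _.
by rewrite srep_sq// exprn_ge0.
Qed.

(** Domination makes <g, s(.) g> normal, hence a vector functional of the model. The bound |L| <=
    |g|, seen at the unit, is what keeps infinite sums of such vectors summable. *)
Let dominatedP g : dominated g -> exists2 L : K, (forall a, `|s a g| = `|pi a L|) & `|L| <= `|g|.
Proof.
have [e [re el er es e1]] := vn_unit_ex N.
move=> [L0 hL0]; have [||L hL] := predual_positive hM (w := fun a => hip g (s a g)).
- apply: (predual_dominated hM (M := `|g| ^+ 2) (k := L0)).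
  + exact: exprn_ge0.
  + by move=> c a b; rewrite (srep_linl ss) hipDr hipZr.
  + move=> a; rewrite -exprMn lerXn2r ?nnegrE ?mulr_ge0//.
    by apply: le_trans (hip_cs _ _) _; rewrite ler_wpM2l.
- by move=> a; rewrite srep_sq// exprn_ge0.
have eqn a : `|s a g| = `|pi a L|.
  by apply/eqP; rewrite -(@eqrXn2 _ 2)// -!srep_sq// hL.
exists L => //; rewrite -{1}(pi_unit hM re L) -eqn.
by apply: le_trans (srep_norm ss _ _) _; rewrite ler_piMl.
Qed.

Let dominated_lin c g h : dominated g -> dominated h -> dominated (c *: g + h).
Proof.
move=> [L1 h1] [L2 h2].
(* The vectors are doubled: each merged vector is bounded by |pi(a) L|, and a sum of two terms has
   to be. *)
pose l i : K := if i is 0%N then (2 * c) *: L1 else if i is 1%N then 2%:R *: L2 else 0.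
have [|L hL] := @pi_merge l (`|l 0%N| ^+ 2 + `|l 1%N| ^+ 2).
  move=> [|[|n]]; first by rewrite big_ord0 addr_ge0 ?exprn_ge0.
    by rewrite big_ord_recl big_ord0 addr0 lerDl exprn_ge0.
  rewrite !big_ord_recl big1 ?addr0// => i _; by rewrite /l /= normr0 expr0n.
exists L => a; rewrite linearP; apply: le_trans (ler_normD _ _) _.
rewrite normrZ; have := hL a 0%N; have := hL a 1%N; rewrite /l !linearZ /= !normrZ normr_nat => k2 k1.
rewrite -(@ler_pM2l _ 2)// [leRHS]mulr_natl [leRHS]mulr2n mulrDr lerD//.
  by apply: le_trans k1; rewrite -mulrA !ler_wpM2l.
by apply: le_trans k2; rewrite ler_wpM2l.
Qed.

(* [g] is a telescoping sum of dominated vectors [e j] with |e j| <= c 4^-j; the vectors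
   representing them, weighted by 2^j, are still square summable. *)
Let dominated_lim (w : nat -> H) g : (forall n, dominated (w n)) ->
  (forall n, `|w n - g| <= (4^-1) ^+ n) -> dominated g.
Proof.
move=> dw wg; pose e j := w j - (if j is i.+1 then w i else 0).
have de j : dominated (e j).
  rewrite /e; case: j => [|j]; first by rewrite subr0.
  by rewrite addrC -scaleN1r; exact: dominated_lin.
(* The 5 comes from 4^-(j+1) + 4^-j = 5 * 4^-(j+1), which bounds |w (j+1) - w j|; for j = 0 the
   bound |g| + 1 suffices. *)
pose c : C := `|g| + 5.
have c0 : 0 <= c by rewrite addr_ge0.
have eb j : `|e j| <= c * (4^-1) ^+ j.
  rewrite /e; case: j => [|j].
    rewrite subr0 expr0 mulr1 -[w 0%N](subrK g); apply: le_trans (ler_normD _ _) _.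
    rewrite addrC lerD2l; apply: le_trans (wg 0%N) _; rewrite expr0.
    by rewrite -[1]/(1%:R) ler_nat.
  rewrite (_ : w j.+1 - w j = (w j.+1 - g) - (w j - g)); last by rewrite opprB addrA subrK.
  apply: le_trans (ler_normB _ _) _; apply: (@le_trans _ _ (5 * (4^-1) ^+ j.+1)).
    by rewrite (_ : 5 * _ = (4^-1) ^+ j.+1 + (4^-1) ^+ j) ?lerD// exprS; field.
  by rewrite ler_wpM2r ?exprn_ge0 ?invr_ge0// lerDr.
have hL j : exists L : K, (forall a, `|s a (e j)| = `|pi a L|) /\ `|L| <= `|e j|.
  by have [L] := dominatedP (de j); exists L.
have [l hl] := choice hL.
have [|L LE] := @pi_merge (fun j => 2 ^+ j *: l j) (c ^+ 2 * 2).
  move=> n; apply: (@le_trans _ _ (\sum_(j < n) c ^+ 2 * (2^-1) ^+ j)).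
    apply: ler_sum => j _; have [_ lj] := hl j.
    apply: (@le_trans _ _ ((c * (2^-1) ^+ j) ^+ 2)).
      rewrite lerXn2r ?nnegrE ?mulr_ge0 ?exprn_ge0 ?invr_ge0//.
      rewrite normrZ ger0_norm ?exprn_ge0//.
      rewrite (_ : c * _ = 2 ^+ j * (c * (4^-1) ^+ j)).
        by rewrite ler_wpM2l ?exprn_ge0// (le_trans lj).
      by rewrite mulrCA -exprMn; congr (_ * _ ^+ _); field.
    rewrite exprMn ler_wpM2l ?exprn_ge0// expr2 ler_piMr ?exprn_ge0 ?invr_ge0//.
    by rewrite exprn_ile1 ?invr_ge0// invf_le1 ?ler1n.
  by rewrite -mulr_sumr ler_wpM2l ?exprn_ge0// sum_half.
exists (2%:R *: L) => a; rewrite linearZ normrZ /= normr_nat.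
have wlim : w @ \oo --> g.
  apply: (@cvg_rate _ _ _ _ (fun n => (2^-1) ^+ n)); last exact: cvg_half.
  move=> n; apply: le_trans (wg n) _; rewrite lerXn2r ?nnegrE ?invr_ge0//.
  by rewrite lef_pV2 ?posrE// ler_nat.
have wlim' : (fun n => w n.+1) @ \oo --> g by rewrite (cvg_shiftS w).
apply: (le_limit _ (cvg_norm (bop_cvg (f := s a) wlim)) (cvg_cst _)) => n.
have -> : w n = \sum_(j < n.+1) e j.
  elim: n => [|n IH]; first by rewrite big_ord_recl big_ord0 addr0 /e subr0.
  by rewrite big_ord_recr/= -IH /e addrC subrK.
rewrite linear_sum; apply: le_trans (ler_norm_sum _ _ _) _.
apply: (@le_trans _ _ (\sum_(j < n.+1) (2^-1) ^+ j * `|pi a L|)).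
  apply: ler_sum => j _; have [-> _] := hl j.
  have := LE a j; rewrite linearZ normrZ /= ger0_norm ?exprn_ge0// => h1.
  by rewrite exprVn ler_pdivlMl ?exprn_gt0.
by rewrite -mulr_suml ler_wpM2r// sum_half.
Qed.

(** The dominated vectors form a closed subspace, hence everything; the functionals <h, s(.) k> are
    then dominated by a vector of the model and so normal. *)
Lemma dominated_normal I (t : I -> H) : total_family t ->
  (forall i, exists L : K, forall a, `|s a (t i)| <= `|pi a L|) -> vec_normal N s.
Proof.
move=> tt td.
have dl l : dominated (lc t l).
  elim: l => [|[c i] l IH]; last by rewrite /lc big_cons; exact: dominated_lin.
  by exists 0 => a; rewrite /lc big_nil !linear0 !normr0.
have dall g : dominated g.
  have [l /cvgn_le0P hl] := total_dense tt g.
  have hm n : exists m : nat, `|lc t (l m) - g| <= (4^-1) ^+ n.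
    have [|m hm] := hl ((4^-1) ^+ n); first by rewrite exprn_gt0 ?invr_gt0.
    by exists m; exact: hm.
  have [m hm'] := choice hm.
  exact: (@dominated_lim (fun n => lc t (l (m n)))).
move=> h k; have [L hL] := dall k.
apply: (predual_dominated hM (M := `|h| ^+ 2) (k := L)).
- exact: exprn_ge0.
- by move=> c a b; rewrite (srep_linl ss) hipDr hipZr.
- move=> a; rewrite -exprMn lerXn2r ?nnegrE ?mulr_ge0//.
  by apply: le_trans (hip_cs _ _) _; rewrite ler_wpM2l.
Qed.

End NormalExtension.

(** On an elementary tensor, <x (x) h, a x (x) h> = <h, s(<x, a x>) h> is normal by normality of s
    and of the left action, and elementary tensors are total. *)
Lemma lact_setting_normal (R : realType) (A : cstarType R) (S : setting A) (F : corrType A)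
    (H G : hilbertType R) (s : A -> bop H H) (t : F -> H -> G) (lam : A -> bop G G) :
  setting_corr S F -> star_rep s -> setting_normal S s -> htensor s t -> star_rep lam ->
  (forall a x h, lam a (t x h) = t (lact a x) h) -> setting_normal S lam.
Proof.
case: S => //= N Fc ss sn ht ls lE.
have [K [pi [J hM]]] := vn_model_ex N; have pis : star_rep pi by case: hM.
apply: (dominated_normal hM ls (proj2 ht)) => -[x h].
have [||L hL] := predual_positive hM (w := fun a => hip h (s (mip x (lact a x)) h)).
- by apply: (lact_normal hM (f := fun b => hip h (s b h))).
- move=> a; rewrite -(ht_ip ht) -lE srep_sq// exprn_ge0//.
exists L => a; rewrite -(@ler_pXn2r _ 2)// ?nnegrE// -!srep_sq// -hL.
by rewrite /uncur /= lE (ht_ip ht).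
Qed.

(** * Tensor powers and subproduct systems *)

Section CanonicalTensor.
Variables (R : realType) (A : cstarType R) (H : hilbertType R) (s : A -> bop H H).
Hypothesis ss : star_rep s.

(** A realisation of F (x) H fixed by choice; it depends on the proof [ss], and [ht_iso] compares it
    with other realisations. *)
Definition tens (F : hilbmodType A) : hilbertType R := sval (cid (tensor_ex F ss)).

Definition tm (F : hilbmodType A) : F -> H -> tens F :=
  sval (cid (svalP (cid (tensor_ex F ss)))).

Lemma tmP (F : hilbmodType A) : htensor s (@tm F).
Proof. exact: (svalP (cid (svalP (cid (tensor_ex F ss))))). Qed.

Definition tlam (F : corrType A) : A -> bop (tens F) (tens F) :=
  sval (cid (ht_lact ss (@tmP F))).

Lemma tlam_rep (F : corrType A) : star_rep (@tlam F).
Proof. by case: (svalP (cid (ht_lact ss (@tmP F)))). Qed.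

Lemma tlamE (F : corrType A) a x h : tlam F a (tm x h) = tm (lact a x : F) h.
Proof. by case: (svalP (cid (ht_lact ss (@tmP F)))) => _; exact. Qed.

Lemma tlam_normal S (F : corrType A) : setting_corr S F -> setting_normal S s ->
  setting_normal S (@tlam F).
Proof.
by move=> Fc sn; apply: (lact_setting_normal Fc ss sn (@tmP F) (tlam_rep F)); exact: tlamE.
Qed.

End CanonicalTensor.

Section IteratedTensor.
Variables (R : realType) (A : cstarType R).

Lemma ht_bop (F : hilbmodType A) (H G : hilbertType R) (s : A -> bop H H) (t : F -> H -> G) x :
  star_rep s -> htensor s t -> exists B : bop H G, forall h, B h = t x h.
Proof.
move=> ss ht; have [||B hB] := @bopP R H G (t x) `|x|; last by exists B.
  exact: (ht_linr ht).
by move=> h; exact: (ht_norm ss ht).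
Qed.

Variables (E F : corrType A) (H G P : hilbertType R) (s : A -> bop H H) (t : F -> H -> G)
  (lam : A -> bop G G) (p : E -> G -> P).
Hypotheses (ss : star_rep s) (ht : htensor s t) (ls : star_rep lam)
  (lamE : forall a x h, lam a (t x h) = t (lact a x) h) (hp : htensor lam p).

Lemma ht2_total : total_family (fun q : E * (F * H) => p q.1 (t q.2.1 q.2.2)).
Proof.
move=> v hv; apply: (ht_total hp) => x g.
have [B hB] := ht_bop x ls hp.
rewrite -hB adjEr; have -> : adj B v = 0; last by rewrite hip0l.
apply: (ht_total ht) => y h; rewrite -adjEr hB.
exact: (hv (x, (y, h))).
Qed.

Lemma ht2_ip x y h x' y' h' :
  hip (p x (t y h)) (p x' (t y' h')) = hip h (s (mip y (lact (mip x x') y')) h').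
Proof. by rewrite (ht_ip hp) lamE (ht_ip ht). Qed.

Lemma ht2_iso (M : hilbmodType A) (W : hilbertType R) (tau : M -> H -> W) (m : E -> F -> M) :
  htensor s tau ->
  (forall x x' y y', mip (m x y) (m x' y') = mip y (lact (mip x x' : A) y') :> A) ->
  exists Th : bop P W, isometric_bop Th /\ forall x y h, Th (p x (t y h)) = tau (m x y) h.
Proof.
move=> hW mE; have [[x [y h]] [x' [y' h']]|Th [Ti ThE]] := iso_extension
  (f := fun q : E * (F * H) => tau (m q.1 q.2.1) q.2.2) ht2_total.
  by rewrite /= ht2_ip (ht_ip hW) mE.
by exists Th; split=> // x y h; exact: (ThE (x, (y, h))).
Qed.

(** The isometry [Th] turns the map x |-> m x y (x) d into x |-> x (x) (y (x) d), a single tensor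
    over [lam], to which [tensor_functional] applies. *)
Lemma cat_functional S (M : hilbmodType A) (W : hilbertType R) (tau : M -> H -> W) (m : E -> F -> M) :
  htensor s tau -> setting_normal S lam ->
  (forall x x' y y', mip (m x y) (m x' y') = mip y (lact (mip x x' : A) y') :> A) ->
  forall v y d, setting_functional S (fun x => hip v (tau (m x y) d)).
Proof.
move=> hW ln mE v y d; have [Th [Ti ThE]] := ht2_iso hW mE.
rewrite (_ : (fun x => _) = (fun x => hip (adj Th v) (p x (t y d)))).
  exact: (tensor_functional ls hp).
by apply/funext => x; rewrite -adjEr ThE.
Qed.

End IteratedTensor.

Section Subproduct.
Variables (R : realType) (A : cstarType R) (S : setting A) (X : subproduct_system S).
Local Notation C := (cplx R).
Local Notation "a ** b" := (amul a b) (at level 40, left associativity).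

Lemma sp_proj_lin n : lin (@sp_proj R A S X n).
Proof.
move=> c x y; apply: mip_injr => z.
by rewrite mipDr mipZr -!sp_incl_adj mipDr mipZr.
Qed.

Lemma sp_proj_incl n (x : X n) : sp_proj (sp_incl x) = x.
Proof. by apply: mip_injr => z; rewrite -sp_incl_adj sp_incl_isom. Qed.

Lemma sp_incl_norm n (x : X n) : `|sp_incl x| = `|x|.
Proof. by apply/eqP; rewrite -(@eqrXn2 _ 2)// -!mip_norm sp_incl_isom. Qed.

Lemma sp_proj_norm n (w : sp_pow X n) : `|sp_proj w| <= `|w|.
Proof.
have [->|w0] := eqVneq `|sp_proj w| 0; first exact: normr_ge0.
rewrite -(@ler_pM2l _ `|sp_proj w|) ?lt_def ?w0 ?normr_ge0//.
rewrite -expr2 -mip_norm -sp_incl_adj; apply: le_trans (norm_mip _ _) _.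
by rewrite sp_incl_norm.
Qed.

Lemma sp_proj_lact n a (w : sp_pow X n) : sp_proj (lact a w) = lact a (sp_proj w).
Proof.
by apply: mip_injr => z; rewrite -sp_incl_adj !mip_lactr -sp_incl_lact sp_incl_adj.
Qed.

Lemma tp_cat_ip n m (x x' : sp_pow X n) (y y' : sp_pow X m) :
  mip (tp_cat x y) (tp_cat x' y') = mip y (lact (mip x x' : A) y') :> A.
Proof. by case: (tp_catP (sp_pow X) n m). Qed.

Lemma tp_cat_lact n m a (x : sp_pow X n) (y : sp_pow X m) :
  tp_cat (lact a x) y = lact a (tp_cat x y).
Proof. by case: (tp_catP (sp_pow X) n m) => _ + _; apply. Qed.

Lemma incl_cat_ip n m (x x' : X n) (y y' : X m) :
  mip (tp_cat (sp_incl x) (sp_incl y)) (tp_cat (sp_incl x') (sp_incl y')) =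
  mip y (lact (mip x x' : A) y') :> A.
Proof. by rewrite tp_cat_ip sp_incl_isom -sp_incl_lact sp_incl_isom. Qed.

End Subproduct.

(** As <eta, p_n w> is the inner product of w with the included eta, the data of a sigma-functional
    on X(n) are carried by the isometric inclusion to data on the tensor power. *)
Lemma proj_functional (R : realType) (A : cstarType R) (S : setting A) (X : subproduct_system S)
    n (f : X n -> cplx R) : setting_functional S f ->
  setting_functional S (fun w : sp_pow X n => f (sp_proj w)).
Proof.
move=> [fl fc]; split; first by move=> c x y; rewrite sp_proj_lin fl.
case: S X f fl fc => [Y|N Y] f fl fc.
  have [c c0 fb] := fc; exists c => // x; apply: le_trans (fb _) _.
  by rewrite ler_wpM2l// sp_proj_norm.
move=> Phi w pP hP; apply: (fc ((@sp_proj R A (WStarSetting N) Y n) @ Phi) (sp_proj w)) => g [u [eta [c [h1 h2 h3 h4]]]].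
apply: (hP (fun w => g (sp_proj w))).
exists u, (fun i => sp_incl (eta i)), c; split=> //.
  by rewrite (_ : (fun i => _) = (fun i => c i * `|eta i|))//; apply/funext => i; rewrite sp_incl_norm.
move=> x; rewrite (_ : (fun i => _) = (fun i => u i (mip (eta i) (sp_proj x)))); first exact: h4.
by apply/funext => i; rewrite sp_incl_adj.
Qed.

(** * Multiplication of X after tensoring with H *)

Section Multiplication.
Variables (R : realType) (A : cstarType R) (S : setting A) (X : subproduct_system S).
Local Notation C := (cplx R).
Variables (H : hilbertType R) (s : A -> bop H H).
Hypotheses (ss : star_rep s) (sn : setting_normal S s).

Lemma incl_cat_zero n m (v : tens ss (sp_pow X (n + m))) :
  (forall x y h, hip v (tm ss (tp_cat (sp_incl x) (sp_incl y)) h) = 0) ->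
  forall (z : X (n + m)%N) h, hip v (tm ss (sp_incl z) h) = 0.
Proof.
move=> hv z h; apply: (module_dense ss (tmP ss (sp_pow X (n + m))) sn _ (sp_incl_tensor z)).
by move=> b [x [y ->]].
Qed.

(* [Th] and [J] embed X(n) (x) X(m) (x) H and X(n+m) (x) H in E^(n+m) (x) H;
   the last clause says that the range of [J] is contained in that of [Th]. *)
Lemma mul_structure n m :
  exists (Th : bop (tens (tlam_rep ss (X m)) (X n)) (tens ss (sp_pow X (n + m))))
    (J : bop (tens ss (X (n + m)%N)) (tens ss (sp_pow X (n + m)))),
  [/\ isometric_bop Th,
      forall (x : X n) (y : X m) h,
        Th (tm _ x (tm ss y h)) = tm ss (tp_cat (sp_incl x) (sp_incl y)) h,
      forall (z : X (n + m)%N) h, J (tm ss z h) = tm ss (sp_incl z) h,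
      forall w h, adj J (tm ss w h) = tm ss (sp_proj w) h &
      isometric_bop J /\ forall g, Th (adj Th (J g)) = J g].
Proof.
have [Th [Ti ThE]] := ht2_iso (tmP ss (X m)) (tlam_rep ss (X m)) (@tlamE _ _ _ _ ss (X m))
  (tmP (tlam_rep ss (X m)) (X n)) (tmP ss (sp_pow X (n + m))) (@incl_cat_ip _ _ _ X n m).
have [J [Ji JE Ja]] := ht_incl (tmP ss (X (n + m)%N)) (tmP ss (sp_pow X (n + m)))
  (@sp_incl_isom _ _ _ X (n + m)).
exists Th, J; split=> //; first by apply: Ja => x w; exact: sp_incl_adj.
split=> // g.
have h0 v : adj Th v = 0 -> adj J v = 0.
  move=> hv; apply: (ht_total (tmP ss (X (n + m)%N))) => z h.
  rewrite -adjEr JE; apply: incl_cat_zero => x y k.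
  by rewrite -ThE adjEr hv hip0l.
apply/eqP; rewrite eq_sym -subr_eq0; apply/eqP/hip_eq0; set v := _ - _.
have v0 : adj Th v = 0 by rewrite /v linearB /= (isometric_adj Ti) subrr.
by rewrite {2}/v hipBr (adjEr J) (adjEr Th) (h0 _ v0) v0 !hip0l subrr.
Qed.

(** Co = J^* Th is coisometric: the range of J lies in that of the isometry Th, so J^* Th Th^* J =
    J^* J = 1. *)
Lemma mul_coisometry n m :
  exists Co : bop (tens (tlam_rep ss (X m)) (X n)) (tens ss (X (n + m)%N)),
  [/\ forall (x : X n) (y : X m) h, Co (tm _ x (tm ss y h)) = tm ss (sp_mul x y) h,
      forall g, Co (adj Co g) = g & forall v, `|Co v| <= `|v|].
Proof.
have [Th [J [Ti ThE JE Ja [Ji TJ]]]] := mul_structure n m.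
exists (bcomp (adj J) Th); split=> [x y h|g|v]; first by rewrite bcompE ThE Ja.
  rewrite bcompE (_ : adj (bcomp (adj J) Th) g = adj Th (J g)); last first.
    by apply: hip_injr => v; rewrite -adjE bcompE -adjE -adjEr.
  by rewrite TJ (isometric_adj Ji).
rewrite bcompE -[leRHS](isometric_norm _ Ti) -[leRHS]mul1r.
by apply: adj_norm => // x; rewrite mul1r isometric_norm.
Qed.

End Multiplication.

Section Associativity.
Variables (R : realType) (A : cstarType R) (S : setting A) (X : subproduct_system S).
Local Notation C := (cplx R).
Variables (H : hilbertType R) (s : A -> bop H H).
Hypotheses (ss : star_rep s) (sn : setting_normal S s).
Local Notation pow := (sp_pow X).

(** Associativity relates elements of X(n+(m+k)) and X(n+m+k), two types that are not
    convertible. *)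
Definition index_cast (V : nat -> Type) i j (e : i = j) (x : V i) : V j := eq_rect i V x j e.

Lemma index_cast_id (V : nat -> Type) i (e : i = i) (x : V i) : index_cast e x = x.
Proof. by rewrite (eq_irrelevance e erefl). Qed.

Lemma tm_cast_functional (V : nat -> corrType A) i j (e : i = j) (v : tens ss (V j)) :
  exists v' : tens ss (V i), forall (x : V i) d,
    hip v (tm ss (index_cast (V := fun i => V i) e x) d) = hip v' (tm ss x d).
Proof. by case: _ / e v => v; exists v. Qed.

Lemma tm_cast_congr (V : nat -> corrType A) i j (e : i = j) (x y : V i) :
  (forall d, tm ss x d = tm ss y d) ->
  forall d, tm ss (index_cast (V := fun i => V i) e x) d = tm ss (index_cast (V := fun i => V i) e y) d.
Proof. by case: _ / e. Qed.

Lemma pow_iso n m :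
  exists Th : bop (tens (tlam_rep ss (pow m)) (pow n)) (tens ss (pow (n + m))),
    isometric_bop Th /\
    forall (x : pow n) (y : pow m) h, Th (tm _ x (tm ss y h)) = tm ss (tp_cat x y) h.
Proof.
exact: (ht2_iso (tmP ss (pow m)) (tlam_rep ss (pow m)) (@tlamE _ _ _ _ ss (pow m))
  (tmP (tlam_rep ss (pow m)) (pow n)) (tmP ss (pow (n + m))) (@tp_cat_ip _ _ _ X n m)).
Qed.

Lemma tm_cat_congr n m (x : pow n) (y y' : pow m) : (forall d, tm ss y d = tm ss y' d) ->
  forall d, tm ss (tp_cat x y) d = tm ss (tp_cat x y') d.
Proof. by move=> h d; have [Th [_ ThE]] := pow_iso n m; rewrite -!ThE h. Qed.

Lemma cast_cat i j (e : i = j) (e' : (1 + i = 1 + j)%N) (x : pow 1) (y : pow i) :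
  index_cast (V := fun i => pow i) e' (tp_cat x y) = tp_cat x (index_cast (V := fun i => pow i) e y).
Proof. by case: _ / e e' => e'; rewrite index_cast_id. Qed.

(* Associativity of tp_cat is only needed, and only proved, after tensoring with H:
   both sides are then continuous in [a], so that induction on elementary tensors applies. *)
Lemma pow_assoc n m k (e : (n + (m + k) = n + m + k)%N) (a : pow n) (b : pow m) (c : pow k) d :
  tm ss (index_cast (V := fun i => pow i) e (tp_cat a (tp_cat b c))) d = tm ss (tp_cat (tp_cat a b) c) d.
Proof.
elim: n e a d => [|n IH] e a d.
  have [_ _ _ _ usurj] := tp_unitP pow; have [al <-] := usurj a.
  rewrite (index_cast_id (V := fun i => pow i) (e : (m + k = m + k)%N)).
  by rewrite !tp_cat_unitl -tp_cat_lact.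
apply: hip_injr => v; apply/eqP; rewrite -subr_eq0; apply/eqP.
have [v' hv'] := tm_cast_functional e v.
have [Th [_ ThE]] := pow_iso (n.+1 + m) k.
have lk := tlam_normal ss (tp_setting pow k) sn.
pose f (a : pow n.+1) := hip v' (tm ss (tp_cat a (tp_cat b c)) d) -
  hip (adj Th v) (tm (tlam_rep ss (pow k)) (tp_cat a b) (tm ss c d)).
suff : f a = 0 by rewrite /f -hv' -adjEr ThE.
have [_ _ dense] := tp_catP pow 1 n.
apply: (@functional_dense _ _ _ S f _ a _ _ (eq_ind_r (fun B => B a) I dense)).
  apply: setting_functionalB.
    apply: (cat_functional (tmP ss (pow (m + k))) (tlam_rep ss _) (@tlamE _ _ _ _ ss _)
      (tmP (tlam_rep ss (pow (m + k))) (pow n.+1)) (tmP ss _)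
      (tlam_normal ss (tp_setting pow _) sn) (@tp_cat_ip _ _ _ X n.+1 (m + k))).
  apply: (cat_functional (tmP (tlam_rep ss (pow k)) (pow m)) (tlam_rep _ _)
    (@tlamE _ _ _ _ (tlam_rep ss (pow k)) (pow m))
      (tmP (tlam_rep (tlam_rep ss (pow k)) (pow m)) (pow n.+1)) (tmP _ _)
      (tlam_normal _ (tp_setting pow _) lk) (@tp_cat_ip _ _ _ X n.+1 m)).
move=> _ [u [x ->]]; rewrite /f -hv' -adjEr ThE.
have e' : (n + (m + k) = n + m + k)%N by rewrite addnA.
have -> : tp_cat (tp_cat (tp_cat u x : pow n.+1) b) c = tp_cat u (tp_cat (tp_cat x b) c).
  by rewrite tp_catA tp_catA.
rewrite -(tm_cat_congr u (IH e' x)) -(cast_cat e' e) tp_catA subrr//.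
Qed.

Lemma tm_proj_congr n (w w' : pow n) : (forall d, tm ss w d = tm ss w' d) ->
  forall d, tm ss (sp_proj w) d = tm ss (sp_proj w') d.
Proof.
move=> h d; have [J [_ _ Ja]] := ht_incl (tmP ss (X n)) (tmP ss (pow n)) (@sp_incl_isom _ _ _ X n).
by rewrite -!(Ja (@sp_proj _ _ _ X n)) ?h// => x y; exact: sp_incl_adj.
Qed.

(** X(n+m) lies in the closed span of the tensors from X(n) and X(m), so these determine p_(n+m) w.
    This is what allows inner projections to be dropped in iterated products. *)
Lemma proj_cat_zero n m (w w' : pow (n + m)) d :
  (forall (x : X n) (y : X m),
    mip w (tp_cat (sp_incl x) (sp_incl y)) = mip w' (tp_cat (sp_incl x) (sp_incl y)) :> A) ->
  tm ss (sp_proj w : X (n + m)%N) d = tm ss (sp_proj w' : X (n + m)%N) d.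
Proof.
move=> h.
have [J [_ JE Ja]] := ht_incl (tmP ss (X (n + m)%N)) (tmP ss (pow (n + m))) (@sp_incl_isom _ _ _ X (n + m)).
have {}Ja := Ja (@sp_proj _ _ _ X (n + m)) (fun x y => sp_incl_adj x y).
rewrite -!Ja; apply/eqP; rewrite -subr_eq0 -linearB; apply/eqP.
apply: (ht_total (tmP ss (X (n + m)%N))) => z k; rewrite -adjEr JE.
apply: incl_cat_zero => // x y {}k.
by rewrite hipBl !(ht_ip (tmP ss _)) h subrr.
Qed.

Lemma mip_proj n (w : pow n) (x : X n) : mip w (sp_incl x) = mip (sp_proj w) x :> A.
Proof. by rewrite -mip_star sp_incl_adj mip_star. Qed.

(** Both sides are p_(n+m+k) of the full tensor of x, y and z, where [pow_assoc] applies. *)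
Lemma sp_mul_assoc n m k (e : (n + (m + k) = n + m + k)%N) (x : X n) (y : X m) (z : X k) d :
  tm ss (index_cast (V := fun i => X i) e (sp_mul x (sp_mul y z))) d = tm ss (sp_mul (sp_mul x y) z) d.
Proof.
have -> : tm ss (sp_mul (sp_mul x y) z) d =
    tm ss (sp_proj (tp_cat (tp_cat (sp_incl x) (sp_incl y)) (sp_incl z)) : X (n + m + k)%N) d.
  by apply: proj_cat_zero => u v; rewrite !tp_cat_ip sp_incl_isom !mip_proj.
have h d' : tm ss (sp_mul x (sp_mul y z)) d' =
    tm ss (sp_proj (tp_cat (sp_incl x) (tp_cat (sp_incl y) (sp_incl z))) : X (n + (m + k))%N) d'.
  by apply: proj_cat_zero => u v; rewrite !tp_cat_ip -sp_incl_lact !sp_incl_isom mip_proj.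
rewrite (tm_cast_congr e h).
have castp i j (e1 : i = j) (w : pow i) :
    index_cast (V := fun i => X i) e1 (sp_proj w) = sp_proj (index_cast (V := fun i => pow i) e1 w).
  by case: _ / e1.
rewrite castp; apply: tm_proj_congr => d'; exact: pow_assoc.
Qed.

End Associativity.

(** * The operators T~_n *)

Lemma positive_sym (R : realType) (H : hilbertType R) (f : bop H H) : positive_bop f ->
  forall x y, hip (f x) y = hip x (f y).
Proof.
move=> fp x y; rewrite -hip_conj; symmetry; rewrite -[LHS]conjCK; congr (_^*); symmetry.
apply: hermitian_of_real.
  have q := ger0_real (fp (x + y)); have q1 := rpredB q (rpredD (ger0_real (fp x)) (ger0_real (fp y))).
  rewrite [X in X \in _](_ : _ = (hip x (f (x + y)) + hip y (f (x + y))) - (hip x (f x) + hip y (f y)))//.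
    by rewrite -hipDl.
  by rewrite linearD !hipDr; ring.
have ii : 'i * 'i = -1 :> cplx R by rewrite -expr2 sqrCi.
have q := ger0_real (fp (x + 'i *: y)).
have q1 := rpredB q (rpredD (ger0_real (fp x)) (ger0_real (fp y))).
move: q1; rewrite linearD linearZ /= hipDl !hipDr hipZl !hipZr conjCi.
rewrite [X in X \in _ -> _](_ : _ = 'i * (hip x (f y) - hip y (f x)))//.
rewrite hipZl conjCi.
transitivity ('i * (hip x (f y) - hip y (f x)) - ('i * 'i + 1) * hip y (f y)); first by ring.
by rewrite ii addNr mul0r subr0.
Qed.

Section Tilde.
Variables (R : realType) (A : cstarType R) (S : setting A) (X : subproduct_system S).
Local Notation C := (cplx R).
Variables (H : hilbertType R) (T : ccc_rep X H).

Lemma rep0_rep : star_rep (rep0 T).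
Proof. exact: (rep_star T). Qed.

Lemma rep0_normal : setting_normal S (rep0 T).
Proof.
have := rep_continuous T; rewrite /rep0; case: S X T => //= N Y W [c0 _].
have [K [pi [J hM]]] := vn_model_ex N.
exact: (normal_vec hM (rep_star W)).
Qed.

Lemma rep_functional n (v h : H) : setting_functional S (fun x : X n => hip v (T n x h)).
Proof.
split; first by move=> c x y; rewrite rep_linear hipDr hipZr.
case: S X T n => [|N] Y W n.
  exists (`|v| * `|h|) => [|x]; first exact: mulr_ge0.
  apply: le_trans (hip_cs _ _) _; rewrite -mulrA ler_wpM2l// mulrC.
  exact: (cc_norm (@rep_cc _ _ _ _ _ W n)  x h).
move=> Phi x pP hP; have [_ c1] := rep_continuous W.
exact: (c1 n Phi x pP hP _ (vec_ultraweak v h)).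
Qed.

Local Notation ss := rep0_rep.
Local Notation G n := (tens rep0_rep (X n)).

Definition tilde n (L : bop (G n) H) :=
  (forall x h, L (tm ss x h) = T n x h) /\ forall g, `|L g| <= `|g|.

Lemma tilde_lact n (L : bop (G n) H) : (forall x h, L (tm ss x h) = T n x h) ->
  forall a g, L (tlam ss (X n) a g) = rep0 T a (L g).
Proof.
move=> LE a g; rewrite -!bcompE; move: g; apply: (bop_ht (tmP ss (X n))) => x h.
by rewrite !bcompE tlamE !LE rep_lact.
Qed.

(* T(z)h is compared with the tensor formula on the dense set of tensors inside
   X(n+m), in E^(n+m), where both sides depend continuously on z. *)
Lemma tilde_mul n m (Ln : bop (G n) H) (Lm : bop (G m) H) : tilde Ln -> tilde Lm ->
  exists L : bop (G (n + m)%N) H, tilde L.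
Proof.
move=> [LnE Lnb] [LmE Lmb].
have [Th [J [Ti ThE JE _ [Ji _]]]] := mul_structure X ss rep0_normal n m.
have [|B [BE Bb]] := ht_map (tlam_rep ss (X m)) ss (tmP (tlam_rep ss (X m)) (X n)) (tmP ss (X n))
  (tilde_lact LmE) ler01.
  by move=> h; rewrite mul1r.
pose L' := bcomp Ln B; pose L := bcomp (bcomp L' (adj Th)) J.
exists L; split=> [z h|g]; last first.
  rewrite !bcompE; apply: le_trans (Lnb _) _; apply: le_trans (Bb _) _; rewrite mul1r.
  rewrite -[leRHS](isometric_norm _ Ji) -[leRHS]mul1r; apply: adj_norm => // x.
  by rewrite mul1r isometric_norm.
apply: hip_injr => v; apply/eqP; rewrite -subr_eq0; apply/eqP.
pose f (w : sp_pow X (n + m)) := hip (adj (bcomp L' (adj Th)) v) (tm ss w h) -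
  hip v (T (n + m)%N (sp_proj w) h).
suff : f (sp_incl z) = 0 by rewrite /f -adjEr !bcompE JE sp_proj_incl.
apply: (functional_dense _ _ (sp_incl_tensor z)).
  apply: setting_functionalB.
    exact: (tensor_functional ss (tmP ss _) _ _ rep0_normal).
  apply: (proj_functional (f := fun x : X (n + m)%N => hip v (T (n + m)%N x h))).
  exact: rep_functional.
move=> _ [x [y ->]]; rewrite /f -adjEr !bcompE -ThE (isometric_adj Ti) BE LmE LnE.
by rewrite -/(sp_mul x y) rep_mul subrr.
Qed.

Lemma tilde0 : exists L : bop (G 0%N) H, tilde L /\ isometric_bop L.
Proof.
have [|L [Li LE]] := ht_iso (tmP ss (X 0%N)) (f := fun x h => T 0%N x h).
  move=> x y h k; have [_ uip _ _ us] := sp_unitP X.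
  have [a <-] := us x; have [b <-] := us y.
  by rewrite uip -/(rep0 T _) (srepM ss) -(srep_adj ss).
by exists L; split=> //; split=> // g; rewrite isometric_norm.
Qed.

(** The specifications allow any realisation of X(n) (x) H; the unitary U links it to the chosen
    one. *)
Lemma tilde_transport n (G' : hilbertType R) (t : X n -> H -> G') (L' : bop G' H) :
  is_tilde T t L' -> exists (L : bop (G n) H) (U : bop (G n) G'),
  [/\ forall x h, L (tm ss x h) = T n x h, isometric_bop U,
      forall g, L g = L' (U g) & forall g, U (adj U g) = g].
Proof.
move=> [/hilbert_tensorP ht LE].
have [x y h k|U [Ui UE]] := ht_iso (tmP ss (X n)) (f := t).
  by rewrite (ht_ip ht).
exists (bcomp L' U), U; split=> // [x h|g|g].
- by rewrite bcompE UE LE.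
- by rewrite bcompE.
- rewrite -bcompE -[RHS]bidE; move: g; apply: (bop_ht ht) => x h.
  by rewrite bcompE bidE -UE (isometric_adj Ui).
Qed.

(* The bound is read off [Delta (Delta h) = h - Q h], with no appeal to complete contractivity. *)
Lemma tilde1 (Delta : bop H H) : is_defect T Delta -> exists L : bop (G 1%N) H, tilde L.
Proof.
move=> [Q [G' [t [L' [L'' [hL ha QE]]]]] [Dp DD]].
have [L [U [LE Ui LU _]]] := tilde_transport hL; exists L; split=> // g.
rewrite LU -(isometric_norm g Ui) -[leRHS]mul1r; move: (U g) => {}g.
have L''b h : `|L'' h| <= 1 * `|h|.
  rewrite mul1r -(@ler_pXn2r _ 2)// ?nnegrE// -!hip_norm -ha -QE.
  have -> : Q h = h - Delta (Delta h) by rewrite DD opprB addrC subrK.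
  by rewrite hipBl gerBl (positive_sym Dp) hip_ge0.
have -> : L' g = adj L'' g.
  by apply: hip_injr => h; rewrite -adjE -hip_conj ha hip_conj.
by apply: adj_norm.
Qed.

Lemma tilde_ex (Delta : bop H H) : is_defect T Delta -> forall n, exists L : bop (G n) H, tilde L.
Proof.
move=> /tilde1 [L1 hL1]; elim=> [|n [L hL]]; first by have [L [hL _]] := tilde0; exists L.
exact: (tilde_mul hL1 hL).
Qed.

End Tilde.

Section Intertwiners.
Variables (R : realType) (A : cstarType R).

Lemma adj_intertwines (H K : hilbertType R) (s : A -> bop H H) (s' : A -> bop K K) (B : bop H K) :
  star_rep s -> star_rep s' -> (forall a h, B (s a h) = s' a (B h)) ->
  forall a k, adj B (s' a k) = s a (adj B k).
Proof.
move=> ss ss' Bs a k; apply: hip_injr => h.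
by rewrite -adjE (srep_adjr ss') -Bs adjE -(srep_adjr ss).
Qed.

Variables (F : hilbmodType A) (H K : hilbertType R) (s : A -> bop H H) (s' : A -> bop K K).
Hypotheses (ss : star_rep s) (ss' : star_rep s').

Lemma tens_map (B : bop H K) : (forall a h, B (s a h) = s' a (B h)) -> (forall h, `|B h| <= `|h|) ->
  exists L : bop (tens ss F) (tens ss' F), [/\ forall x h, L (tm ss x h) = tm ss' x (B h),
    forall v, `|L v| <= `|v| & forall x k, adj L (tm ss' x k) = tm ss x (adj B k)].
Proof.
move=> Bs Bb; have [|L [LE Lb]] := ht_map ss ss' (tmP ss F) (tmP ss' F) Bs ler01.
  by move=> h; rewrite mul1r.
exists L; split=> // [v|x k]; first by rewrite -[leRHS]mul1r.
apply: (ht_inj (tmP ss F)) => y h; rewrite -adjEr LE !(ht_ip (tmP _ _)).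
by rewrite -adjEr Bs.
Qed.

End Intertwiners.

Section Coisometry.
Variables (R : realType) (A : cstarType R) (S : setting A) (X : subproduct_system S).
Local Notation C := (cplx R).
Variables (H : hilbertType R) (T : ccc_rep X H).
Local Notation ss := (rep0_rep T).
Local Notation G n := (tens (rep0_rep T) (X n)).
Variable L : forall n, bop (G n) H.
Hypothesis hL : forall n, tilde (L n).
Local Notation xi n := (adj (L n)).

Lemma xi_lact n a h : xi n (rep0 T a h) = tlam ss (X n) a (xi n h).
Proof.
by apply: (adj_intertwines (tlam_rep ss (X n)) ss); apply: tilde_lact; case: (hL n).
Qed.

Lemma xi_norm n h : `|xi n h| <= `|h|.
Proof.
rewrite -[leRHS]mul1r; apply: adj_norm => // g; rewrite mul1r; by case: (hL n).
Qed.

(** T~_0 is an isometry, and its range is dense because T_0 is nondegenerate; hence it is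
    coisometric. *)
Lemma xi0 h h' : hip (xi 0%N h) (xi 0%N h') = hip h h'.
Proof.
have [L0 [[L0E _] Li]] := tilde0 T; have [LE _] := hL 0%N.
have LL g : L 0%N g = L0 g by move: g; apply: (bop_ht (tmP ss (X 0%N))) => x k; rewrite LE L0E.
have Ls g : xi 0%N (L 0%N g) = g.
  by apply: hip_injl => k; rewrite -adjEr !LL Li.
have inj k : xi 0%N k = 0 -> k = 0.
  move=> h0; have /total_closure td := rep_nondegenerate T; apply: td => _ [a [u ->]].
  by rewrite -[T 0%N _ _]LE adjEr h0 hip0l.
have LX k : L 0%N (xi 0%N k) = k.
  by apply/eqP; rewrite -subr_eq0; apply/eqP/inj; rewrite linearB /= Ls subrr.
by rewrite -adjE LX.
Qed.

Lemma tens_shift_ex n m : exists M : bop (G n) (tens (tlam_rep ss (X m)) (X n)),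
  [/\ forall x h, M (tm ss x h) = tm _ x (xi m h), forall v, `|M v| <= `|v| &
      forall x g, adj M (tm _ x g) = tm ss x (L m g)].
Proof.
have [M [ME Mb Ma]] := tens_map (X n) ss (tlam_rep ss (X m)) (@xi_lact m) (@xi_norm m).
by exists M; split=> // x g; rewrite Ma adjK.
Qed.

(** The operator 1 (x) xi_m from X(n) (x) H to X(n) (x) X(m) (x) H. *)
Definition tens_shift n m := sval (cid (tens_shift_ex n m)).

Lemma tens_shiftE n m x h : tens_shift n m (tm ss x h) = tm (tlam_rep ss (X m)) x (xi m h).
Proof. by case: (svalP (cid (tens_shift_ex n m))). Qed.

Lemma tens_shift_norm n m v : `|tens_shift n m v| <= `|v|.
Proof. by case: (svalP (cid (tens_shift_ex n m))). Qed.

Lemma tens_shift_adj n m x g : adj (tens_shift n m) (tm (tlam_rep ss (X m)) x g) = tm ss x (L m g).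
Proof. by case: (svalP (cid (tens_shift_ex n m))). Qed.

(* L_(n+m) Co = L_n (1 (x) L_m) for the coisometry Co : X(n) (x) X(m) (x) H -> X(n+m) (x) H,
   so the adjoints differ by the isometry adj Co. *)
Lemma tens_shift_xi n m h h' : hip (tens_shift n m (xi n h)) (tens_shift n m (xi n h')) =
  hip (xi (n + m)%N h) (xi (n + m)%N h').
Proof.
have [Co [CoE CoK _]] := mul_coisometry X ss (rep0_normal T) n m.
have key v : L (n + m)%N (Co v) = L n (adj (tens_shift n m) v).
  rewrite -!bcompE; apply: (bop_total (ht2_total (tmP ss (X m)) (tlam_rep ss (X m))
    (tmP (tlam_rep ss (X m)) (X n)))) => -[x [y k]] /=.
  rewrite !bcompE CoE tens_shift_adj; have [-> _] := hL (n + m); have [Ln _] := hL n.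
  by have [Lm _] := hL m; rewrite Lm Ln rep_mul.
have e k : tens_shift n m (xi n k) = adj Co (xi (n + m)%N k).
  by apply: hip_injl => v; rewrite -[RHS]adjEr -[RHS]adjEr key [RHS]adjEr -[RHS]adjE.
by rewrite !e -adjE CoK.
Qed.

End Coisometry.

(** * The Poisson kernel *)

Section Operators.
Variable R : realType.
Local Notation C := (cplx R).

(** Uniqueness of positive roots: D is identified with the root S of D^2, whose commutation
    relations are known. For d = S v - D v, <d, S d> + <d, D d> = <d, (S^2 - D^2) v> = 0, so S d = D
    d = 0 and then |d|^2 = <v, S d - D d> = 0. *)
Lemma positive_commute (H : hilbertType R) (D B : bop H H) : positive_bop D ->
  (forall x, B (D (D x)) = D (D (B x))) -> forall x, B (D x) = D (B x).
Proof.
move=> Dp DDB; have Ds := positive_sym Dp.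
have [||S [Ss Sp SS Sc]] := @bop_sqrt R H (bcomp D D).
- by move=> x y; rewrite !bcompE !Ds.
- by move=> x; rewrite bcompE -Ds hip_ge0.
have SD x : S (D x) = D (S x) by symmetry; apply: Sc => y; rewrite !bcompE.
have vanish (f : bop H H) x : (forall x y, hip (f x) y = hip x (f y)) -> (forall x, 0 <= hip x (f x)) ->
    hip x (f x) = 0 -> f x = 0.
  move=> fs fp fx; have fl : lin f by move=> c u v; rewrite linearP.
  have := positive_cs (f x) x fl fs fp; rewrite fx mulr0 => h.
  apply/hip_eq0/eqP; rewrite -normr_eq0 -(@sqrf_eq0 _ `|_|) eq_le h exprn_ge0//.
have eqS v : S v = D v.
  apply/eqP; rewrite -subr_eq0; apply/eqP; set d := _ - _.
  have h : hip d (S d) + hip d (D d) = 0.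
    rewrite -hipDr /d !linearB /= SS bcompE SD addrC addrA subrK subrr hip0r//.
  have h1 : hip d (S d) = 0.
    by move/eqP: h; rewrite paddr_eq0// => /andP[/eqP].
  have h2 : hip d (D d) = 0 by move: h; rewrite h1 add0r.
  apply: hip_eq0; rewrite {1}/d hipBl Ss Ds (vanish _ _ Ss Sp h1) (vanish _ _ Ds Dp h2).
  by rewrite hip0r subrr.
by move=> x; rewrite -!eqS; apply: Sc => y; rewrite !bcompE.
Qed.

Section OrthogonalSum.
Variables (H K : hilbertType R) (w : nat -> bop H K).
Hypothesis worth : forall i j x y, i != j -> hip (w i x) (w j y) = 0.

Lemma orth_sum_hip n x y :
  hip (\sum_(i < n) w i x) (\sum_(i < n) w i y) = \sum_(i < n) hip (w i x) (w i y).
Proof.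
rewrite hip_suml; apply: eq_bigr => i _; rewrite hip_sumr (bigD1 i)//= big1 ?addr0// => j ji.
by rewrite worth// eq_sym.
Qed.

Lemma orth_sum_bop : (forall n x, \sum_(i < n) `|w i x| ^+ 2 <= `|x| ^+ 2) ->
  exists F : bop H K, (forall x, (fun n => \sum_(i < n) w i x) @ \oo --> F x) /\
    forall x, `|F x| <= `|x|.
Proof.
move=> wb.
have lim x : exists y : K, (fun n => \sum_(i < n) w i x) @ \oo --> y.
  by apply: (orth_series_cvg (v := fun i => w i x) _ (wb ^~ x)) => i j ij; exact: worth.
have sb n x : `|\sum_(i < n) w i x| <= 1 * `|x|.
  rewrite mul1r -(@ler_pXn2r _ 2)// ?nnegrE// -hip_norm orth_sum_hip.
  by under eq_bigr do rewrite hip_norm; exact: wb.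
have hf n : exists f : bop H K, forall x, f x = \sum_(i < n) w i x.
  have [||f hf] := @bopP R H K (fun x => \sum_(i < n) w i x) 1; last by exists f.
    by move=> c x y; rewrite scaler_sumr -big_split; apply: eq_bigr => i _; rewrite linearP.
  exact: sb.
have [f fE] := choice hf.
have [n x|x|F hF] := @bop_limit _ H K f 1.
- by rewrite fE.
- by have [y hy] := lim x; exists y; under eq_fun do rewrite fE.
have hF' x : (fun n => \sum_(i < n) w i x) @ \oo --> F x.
  by have := hF x; under eq_fun do rewrite fE.
exists F; split=> // x; apply: (le_limit _ (cvg_norm (hF' x)) (cvg_cst `|x|)) => n.
by rewrite -[leRHS]mul1r.
Qed.

Lemma cvg_eventually (E : normedModType C) (u : nat -> E) l n :
  (forall m, (n <= m)%N -> u m = l) -> u @ \oo --> l.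
Proof. by move=> ul; apply/cvgn_le0P => e e0; exists n => m /ul ->; rewrite subrr normr0 ltW. Qed.

Lemma orth_sum_component (F : bop H K) x y n : (forall x, (fun n => \sum_(i < n) w i x) @ \oo --> F x) ->
  (forall i, i != n -> hip (w i x) y = 0) -> hip (F x) y = hip (w n x) y.
Proof.
move=> hF wy; apply: (@clim_unique _ (fun n => hip (\sum_(i < n) w i x) y)).
  by apply: cvg_hip; [exact: hF|exact: cvg_cst].
apply: (@cvg_eventually _ _ _ n.+1) => m nm.
by rewrite hip_suml (bigD1 (Ordinal nm))//= big1 ?addr0// => i ij; exact: wy.
Qed.

End OrthogonalSum.

Lemma bessel (K : hilbertType R) (V : nat -> hilbertType R) (W : forall n, bop (V n) K) :
  (forall n, isometric_bop (W n)) -> (forall i j x y, i != j -> hip (W i x) (W j y) = 0) ->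
  forall n x, \sum_(i < n) `|adj (W i) x| ^+ 2 <= `|x| ^+ 2.
Proof.
move=> Wi Wo n x.
have h0 : 0 <= `|x - \sum_(i < n) W i (adj (W i) x)| ^+ 2 by rewrite exprn_ge0.
rewrite norm_subE in h0.
have e1 : hip x (\sum_(i < n) W i (adj (W i) x)) = \sum_(i < n) `|adj (W i) x| ^+ 2.
  by rewrite hip_sumr; apply: eq_bigr => i _; rewrite adjEr hip_norm.
have e2 : `|\sum_(i < n) W i (adj (W i) x)| ^+ 2 = \sum_(i < n) `|adj (W i) x| ^+ 2.
  rewrite -hip_norm hip_suml; apply: eq_bigr => i _.
  rewrite hip_sumr (bigD1 i)//= Wi hip_norm big1 ?addr0// => j ji.
  by rewrite Wo// eq_sym.
have s0 : 0 <= \sum_(i < n) `|adj (W i) x| ^+ 2 by apply: sumr_ge0 => i _; rewrite exprn_ge0.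
rewrite e2 -[hip (\sum_(i < n) _) x]hip_conj e1 (conj_Creal (ger0_real s0)) in h0.
by apply: le_subE h0 _; ring.
Qed.

End Operators.

Section FockTensor.
Variables (R : realType) (A : cstarType R) (S : setting A) (X : subproduct_system S).
Variables (D : hilbertType R) (sD : A -> bop D D) (ds : star_rep sD).
Variables (FX : fock_space X) (G : hilbertType R) (tG : FX -> D -> G).
Hypothesis hG : htensor sD tG.

Lemma fock_iso n : exists W : bop (tens ds (X n)) G, isometric_bop W /\
  forall x d, W (tm ds x d) = tG (fock_in FX x) d.
Proof.
apply: (ht_iso (tmP ds (X n)) (f := fun x d => tG (fock_in FX x) d)) => x y h k.
by rewrite (ht_ip hG) fock_in_isom.
Qed.

Definition fock_emb n := sval (cid (fock_iso n)).

Lemma fock_emb_iso n : isometric_bop (fock_emb n).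
Proof. by case: (svalP (cid (fock_iso n))). Qed.

Lemma fock_embE n x d : fock_emb n (tm ds x d) = tG (fock_in FX x) d.
Proof. by case: (svalP (cid (fock_iso n))). Qed.

Lemma fock_emb_adj n m (x : X m) d : n != m -> adj (fock_emb n) (fock_emb m (tm ds x d)) = 0.
Proof.
move=> nm; apply: (ht_total (tmP ds (X n))) => y e.
by rewrite -adjEr !fock_embE (ht_ip hG) fock_in_orth 1?eq_sym// (lin0 (srep_linl ds _)) hip0r.
Qed.

Lemma fock_emb_orth i j x y : i != j -> hip (fock_emb i x) (fock_emb j y) = 0.
Proof.
move=> ij; rewrite -[RHS](hip0l y) [LHS]adjEr; congr (hip _ y).
apply: (ht_total (tmP ds (X j))) => z d.
by rewrite -adjEr adjE fock_emb_adj// hip0r.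
Qed.

Lemma fock_tensor_dense (sn : setting_normal S sD) (v : G) :
  (forall n (x : X n) d, hip v (tG (fock_in FX x) d) = 0) -> v = 0.
Proof.
move=> hv; apply: (ht_total hG) => x d.
apply: (module_dense ds hG (S := S) (B := [set w | exists n (x : X n), w = fock_in FX x])) => //.
  by move=> _ [n [y ->]].
by rewrite (fock_total FX).
Qed.

End FockTensor.

Section Poisson.
Variables (R : realType) (A : cstarType R) (S : setting A) (X : subproduct_system S).
Local Notation C := (cplx R).
Variables (H : hilbertType R) (T : ccc_rep X H).
Local Notation ss := (rep0_rep T).
Variable L : forall n, bop (tens ss (X n)) H.
Hypothesis hL : forall n, tilde (L n).
Local Notation xi n := (adj (L n)).
Variables (D : hilbertType R) (sD : A -> bop D D) (ds : star_rep sD).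
Variable B : bop H D.
Hypotheses (Bs : forall a h, B (rep0 T a h) = sD a (B h))
  (B_ip : forall h h', hip (B h) (B h') = hip h h' - hip (xi 1%N h) (xi 1%N h')).

Lemma defect_norm h : `|B h| <= `|h|.
Proof.
rewrite -(@ler_pXn2r _ 2)// ?nnegrE// -!hip_norm B_ip gerBl; exact: hip_ge0.
Qed.

(** Tensoring B^*B = 1 - xi_1^* xi_1 with X(n) gives |(1 (x) B) g|^2 = |g|^2 - |(1 (x) xi_1) g|^2.
    At g = xi_n h, [tens_shift_xi] rewrites the last term as |xi_(n+1) h|^2, and the sum over n
    telescopes. *)
Lemma tens_defect n : exists Bn : bop (tens ss (X n)) (tens ds (X n)),
  [/\ forall x h, Bn (tm ss x h) = tm ds x (B h),
      forall x d, adj Bn (tm ds x d) = tm ss x (adj B d) &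
      forall h h', hip (Bn (xi n h)) (Bn (xi n h')) =
        hip (xi n h) (xi n h') - hip (xi n.+1 h) (xi n.+1 h')].
Proof.
have [Bn [BE _ Ba]] := tens_map (X n) ss ds Bs defect_norm.
exists Bn; split=> // h h'.
have -> : n.+1 = (n + 1)%N by rewrite addn1.
rewrite -(tens_shift_xi hL) adjEr; set g := xi n h'; rewrite [X in _ - X]adjEr; set M := tens_shift hL n 1.
have -> : adj M (M (xi n h)) = xi n h - adj Bn (Bn (xi n h)).
  move: (xi n h) => v; rewrite -[v in v - _]bidE -!bcompE -scaleN1r addrC -bcombE; move: v.
  apply: (bop_ht (tmP ss (X n))) => x k.
  rewrite !bcompE bcombE bcompE bidE /M tens_shiftE tens_shift_adj BE Ba.
  have -> : L 1%N (xi 1%N k) = k - adj B (B k).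
    apply: hip_injl => k'; rewrite hipBl -[X in _ - X]adjEr B_ip opprB.
    by rewrite addrC subrK adjE.
  by rewrite (linB (ht_linr (tmP ss _) x)) scaleN1r addrC.
by rewrite hipBl opprB addrC subrK.
Qed.

Variables (FX : fock_space X) (G : hilbertType R) (tG : FX -> D -> G).
Hypothesis hG : htensor sD tG.

(* The Poisson kernel [sum_n (1 (x) B) T~_n^*]; its partial sums telescope. *)
Lemma poisson_ex : exists Ka : bop H G,
  (forall h h', (fun n => hip (xi n h) (xi n h')) @ \oo --> hip h h' - hip (Ka h) (Ka h')) /\
  forall n (y : X n) d, adj Ka (tG (fock_in FX y) d) = T n y (adj B d).
Proof.
pose Bn n := sval (cid (tens_defect n)).
have BnP n := svalP (cid (tens_defect n)).
pose w n := bcomp (fock_emb ds hG n) (bcomp (Bn n) (xi n)).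
have wE n h : w n h = fock_emb ds hG n (Bn n (xi n h)) by rewrite !bcompE.
have wo i j x y : i != j -> hip (w i x) (w j y) = 0 by move=> ij; rewrite !wE fock_emb_orth.
have wsum n h h' : \sum_(i < n) hip (w i h) (w i h') = hip h h' - hip (xi n h) (xi n h').
  elim: n => [|n IH]; first by rewrite big_ord0 (xi0 hL) subrr.
  have [_ _ BX] := BnP n.
  by rewrite big_ord_recr/= IH !wE fock_emb_iso BX addrA subrK.
have [n h|Ka [hK _]] := orth_sum_bop wo.
  under eq_bigr do rewrite -hip_norm; rewrite wsum !hip_norm gerBl exprn_ge0//.
exists Ka; split=> [h h'|n y d].
  rewrite (_ : (fun n => _) =
      fun n => hip h h' - hip (\sum_(i < n) w i h) (\sum_(i < n) w i h')).
    by apply: cvgB; [exact: cvg_cst|exact: cvg_hip].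
  by apply/funext => n; rewrite orth_sum_hip// wsum opprB addrC subrK.
apply: hip_injr => h; rewrite -adjE -(fock_embE ds hG).
rewrite (orth_sum_component hK (n := n)) => [|i ni]; last first.
  by rewrite wE -[RHS](hip0r (Bn i (xi i h))) adjE fock_emb_adj.
have [_ Ba _] := BnP n; have [LE _] := hL n.
by rewrite wE fock_emb_iso adjE Ba -[LHS]adjEr LE.
Qed.

End Poisson.

(** * The coisometric part *)

Section MakeRep.
Variables (R : realType) (A : cstarType R).

(** The common way to build representations: contractive tilde operators give complete contractivity
    through [tilde_bound_cc] and sigma-continuity through [auto_continuous], leaving only algebraic
    identities to check. *)
Lemma make_rep (S : setting A) (X : subproduct_system S) (H : hilbertType R) (s : A -> bop H H)
    (ss : star_rep s) (V : forall n, X n -> bop H H) :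
  Defs.nondegenerate s -> setting_normal S s ->
  (forall a h, V 0%N (sp_unit X a) h = s a h) ->
  (forall n, exists L : bop (tens ss (X n)) H,
     (forall x h, L (tm ss x h) = V n x h) /\ forall g, `|L g| <= `|g|) ->
  (forall n (x : X n) a h, V n (lact a x) h = s a (V n x h)) ->
  (forall n m (x : X n) (y : X m) h, V (n + m)%N (sp_mul x y) h = V n x (V m y h)) ->
  exists W : ccc_rep X H, (forall n x h, W n x h = V n x h) /\
    forall n, exists L : bop (tens (rep0_rep W) (X n)) H, tilde L.
Proof.
move=> nd sn V0 Vt Vlact Vmul.
have Vl n h : lin (fun x : X n => V n x h).
  have [L [LE _]] := Vt n; move=> c x y.
  by rewrite -!LE (ht_linl ss (tmP ss (X n))) linearP.
have vs : star_rep (fun a => V 0%N (sp_unit X a)).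
  split=> [c a b h|a b h|a x y]; rewrite !V0.
  - exact: (srep_linl ss).
  - exact: srepM.
  - exact: srep_adj.
have vnd : Defs.nondegenerate (fun a => V 0%N (sp_unit X a)).
  rewrite /Defs.nondegenerate -nd; congr (closure (lspan _)); apply/funext => v; apply/propext.
  by split=> -[a [h ->]]; exists a, h; rewrite V0.
have Vb n x h : `|V n x h| ^+ 2 <= hip h (s (mip x x) h).
  have [L [LE Lb]] := Vt n.
  by rewrite -LE -(ht_ip (tmP ss (X n))) hip_norm lerXn2r ?nnegrE.
have vcc n : completely_contractive (@V n).
  have [L [LE Lb]] := Vt n; apply: (tilde_bound_cc ss) => k x u.
  have -> : \sum_i V n (x i) (u i) = L (\sum_i tm ss (x i) (u i)).
    by rewrite linear_sum; apply: eq_bigr => i _; rewrite LE.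
  have -> : \sum_i \sum_j hip (u i) (s (mip (x i) (x j)) (u j)) = `|\sum_i tm ss (x i) (u i)| ^+ 2.
    rewrite -hip_norm hip_suml; apply: eq_bigr => i _; rewrite hip_sumr.
    by apply: eq_bigr => j _; rewrite (ht_ip (tmP ss (X n))).
  by rewrite lerXn2r ?nnegrE.
have vra n (x : X n) a h : V n (ract x a) h = V n x (V 0%N (sp_unit X a) h).
  by have [L [LE _]] := Vt n; rewrite V0 -!LE (ht_ract ss (tmP ss (X n))).
have vla n (x : X n) a h : V n (lact a x) h = V 0%N (sp_unit X a) (V n x h).
  by rewrite V0 Vlact.
have vc : setting_continuous V.
  case: S X V nd sn V0 Vt Vlact Vmul Vl vs vnd Vb vcc vra vla => //= N X V nd sn V0 Vt _ _ Vl vs _ Vb _ _ _.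
  have [K [pi [J hM]]] := vn_model_ex N; split; last first.
    by move=> n; apply: (auto_continuous ss sn) => // h; exact: Vl.
  apply: (vec_normal_continuous hM vs) => h k.
  by rewrite (_ : (fun a => _) = (fun a => hip h (s a k)))//; apply/funext => a; rewrite V0.
exists (Build_ccc_rep (fun n c x y h => Vl n h c x y) vs vnd vcc vra vla Vmul vc).
split=> // n; set W := Build_ccc_rep _ _ _ _ _ _ _ _; have [L [LE Lb]] := Vt n.
(* [rep0 W] agrees with s only pointwise, so the tensor products over the two are distinct spaces,
   linked by an isometry. *)
have [x y h k|J [Ji JE]] := ht_iso (tmP (rep0_rep W) (X n)) (f := fun x h => tm ss x h).
  by rewrite (ht_ip (tmP ss (X n))) /rep0 /= V0.
exists (bcomp L J); split=> [x h|g]; first by rewrite bcompE JE LE.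
by rewrite bcompE -[leRHS](isometric_norm _ Ji).
Qed.

End MakeRep.

Lemma setting_normal_compression (R : realType) (A : cstarType R) (S : setting A)
    (H K : hilbertType R) (s : A -> bop H H) (s' : A -> bop K K) (j : K -> H) :
  (forall a h k, hip h (s' a k) = hip (j h) (s a (j k))) ->
  setting_normal S s -> setting_normal S s'.
Proof.
case: S => //= N sj sn h k.
rewrite (_ : (fun a => _) = (fun a => hip (j h) (s a (j k)))); first exact: sn.
by apply/funext => a.
Qed.

Section CoisometricPart.
Variables (R : realType) (A : cstarType R) (S : setting A) (X : subproduct_system S).
Local Notation C := (cplx R).
Variables (H : hilbertType R) (T : ccc_rep X H).
Local Notation ss := (rep0_rep T).
Variable L : forall n, bop (tens ss (X n)) H.
Hypothesis hL : forall n, tilde (L n).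
Local Notation xi n := (adj (L n)).
Variables (G : hilbertType R) (Ka : bop H G).
Hypothesis Kalim : forall h h',
  (fun n => hip (xi n h) (xi n h')) @ \oo --> hip h h' - hip (Ka h) (Ka h').

(** The form <h, Q h'> is the Gram kernel of Q^(1/2), so q h |-> Q^(1/2) h defines the isometry j,
    which realises U inside H. It intertwines because Q, a weak limit of operators commuting with
    sigma, commutes with sigma, and so does its root. *)
Lemma coisometric_space : exists (U : hilbertType R) (q : bop H U),
  [/\ forall h h', hip (q h) (q h') = hip h h' - hip (Ka h) (Ka h'), total_family q &
      exists j : bop U H, isometric_bop j /\ forall a h, j (q (rep0 T a h)) = rep0 T a (j (q h))].
Proof.
pose Q := bcomb (-1) (bcomp (adj Ka) Ka) (bid H).
have QE h h' : hip h (Q h') = hip h h' - hip (Ka h) (Ka h').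
  by rewrite bcombE bcompE bidE scaleN1r addrC hipBr -adjE.
have QEl h h' : hip (Q h) h' = hip h h' - hip (Ka h) (Ka h').
  by rewrite bcombE bcompE bidE scaleN1r addrC hipBl -adjEr.
have Qlim h h' : (fun n => hip (xi n h) (xi n h')) @ \oo --> hip h (Q h') by rewrite QE.
have Qc a h : rep0 T a (Q h) = Q (rep0 T a h).
  apply: hip_injr => k; rewrite (srep_adjr ss); apply: clim_unique (Qlim _ _) _.
  rewrite (_ : (fun n => _) = (fun n => hip (xi n k) (xi n (rep0 T a h)))); first exact: Qlim.
  by apply/funext => n; rewrite !(xi_lact hL) -(srep_adjr (tlam_rep ss (X n))).
have [||Sq [Ss _ SS Sc]] := @bop_sqrt R H Q.
- by move=> x y; rewrite QE QEl.
- move=> x; apply: (ge0_limit _ (Qlim x x)) => n; exact: hip_ge0.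
have [U [q0 [q0E q0t]]] := kernel_space (psd_gram Sq).
have q0E' h h' : hip (q0 h) (q0 h') = hip h h' - hip (Ka h) (Ka h').
  by rewrite q0E Ss SS QE.
have [||q qE] := @bopP R H U q0 1.
- move=> c x y; apply: hip_total (q0t) _ => z.
  by rewrite hipDl hipZl !q0E linearP hipDl hipZl.
- move=> x; rewrite mul1r -(@ler_pXn2r _ 2)// ?nnegrE// -!hip_norm q0E' gerBl.
  exact: hip_ge0.
have [|j [ji jE]] := iso_extension (f := Sq) q0t.
  by move=> x y; rewrite q0E.
exists U, q; split=> [h h'|v hv|]; first by rewrite !qE.
  by apply: q0t => h; rewrite -qE.
exists j; split=> // a h; rewrite !qE !jE.
by rewrite -(Sc (rep0 T a))// => x.
Qed.

Variables (U : hilbertType R) (q : bop H U).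
Hypotheses (qE : forall h h', hip (q h) (q h') = hip h h' - hip (Ka h) (Ka h'))
  (qt : total_family q).

(** The compression j^* sigma j is multiplicative since the range of j is invariant; nondegeneracy
    and normality are inherited from sigma. *)
Lemma coisometric_sigma (j : bop U H) : isometric_bop j ->
  (forall a h, j (q (rep0 T a h)) = rep0 T a (j (q h))) ->
  exists sU : A -> bop U U, [/\ star_rep sU, forall a h, sU a (q h) = q (rep0 T a h),
    Defs.nondegenerate sU & setting_normal S sU].
Proof.
move=> ji jq; pose sU a := bcomp (adj j) (bcomp (rep0 T a) j).
have sq a h : sU a (q h) = q (rep0 T a h) by rewrite !bcompE -jq (isometric_adj ji).
have js a u : j (sU a u) = rep0 T a (j u).
  by rewrite -!bcompE; move: u; apply: (bop_total qt) => h; rewrite 2!bcompE sq jq.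
have jinj u v : j u = j v -> u = v.
  by move=> e; rewrite -(isometric_adj ji u) e (isometric_adj ji).
have us : star_rep sU.
  split=> [c a b u|a b u|a u v].
  - by apply: jinj; rewrite js linearP !js (srep_linl ss).
  - by apply: jinj; rewrite !js (srepM ss).
  - by rewrite -ji js (srep_adj ss) -js ji.
exists sU; split=> //.
  apply/total_closure => v hv; apply: qt => h.
  have : adj q v = 0.
    have /total_closure td := rep_nondegenerate T; apply: td => _ [a [k ->]].
    by rewrite -adjEr -[T 0%N _]/(rep0 T a) -sq; apply: hv; exists a, (q k).
  by rewrite adjEr => ->; rewrite hip0l.
apply: (setting_normal_compression (j := j) _ (rep0_normal T)) => a h k.
by rewrite -js ji.
Qed.

(** The difference D_n = T~_n T~_n^* - q^*q satisfies 0 <= D_n <= 1, the lower bound by monotonicity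
    in n. Hence |D_n h|^2 <= <h, D_n h>, and weak convergence is strong. *)
Lemma tilde_cvg h : (fun n => L n (xi n h)) @ \oo --> adj q (q h).
Proof.
have lim x : (fun n => hip (xi n x) (xi n x)) @ \oo --> hip (q x) (q x) by rewrite qE.
have low n x : hip (q x) (q x) <= hip (xi n x) (xi n x).
  have lim' : (fun m => hip (xi (m + n)%N x) (xi (m + n)%N x)) @ \oo --> hip (q x) (q x).
    by rewrite (cvg_shiftn n (fun n => hip (xi n x) (xi n x))).
  apply: (le_limit _ lim' (cvg_cst _)) => m; rewrite addnC -(tens_shift_xi hL) !hip_norm.
  by rewrite lerXn2r ?nnegrE// tens_shift_norm.
apply/cvgn_le0P => e e0.
have /cvgn_le0P/(_ _ (exprn_gt0 2 e0)) [n hn] := lim h; exists n => m /hn {}hn.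
rewrite -(@ler_pXn2r _ 2)// ?nnegrE ?(ltW e0)//; apply: le_trans hn.
pose Tm x := L m (xi m x) - adj q (q x).
have ip x y : hip x (Tm y) = hip (xi m x) (xi m y) - hip (q x) (q y).
  by rewrite hipBr adjEr -[X in _ - X]adjE.
have ipl x y : hip (Tm x) y = hip (xi m x) (xi m y) - hip (q x) (q y).
  by rewrite hipBl adjE -[X in _ - X]adjEr.
have h0 x : 0 <= hip x (Tm x) by rewrite ip subr_ge0.
rewrite -ip (ger0_norm (h0 h)).
apply: (positive_contraction (T := Tm)) => //.
- by move=> c x y; rewrite /Tm !linearP /= scalerBr scalerN addrACA.
- by move=> x y; rewrite ip ipl.
- move=> x; rewrite ip; apply: (@le_trans _ _ (hip (xi m x) (xi m x))).
    by rewrite gerBl hip_ge0.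
  by rewrite hip_norm lerXn2r ?nnegrE// (xi_norm hL).
Qed.

Variables (sU : A -> bop U U) (us : star_rep sU).
Hypothesis sq : forall a h, sU a (q h) = q (rep0 T a h).

Lemma q_norm h : `|q h| <= `|h|.
Proof.
rewrite -(@ler_pXn2r _ 2)// ?nnegrE// -!hip_norm qE gerBl; exact: hip_ge0.
Qed.

(** On elementary tensors, and by boundedness everywhere, M_m^* M_m with M_m = 1 (x) xi_m tends
    strongly to qn^* qn with qn = 1 (x) q. So <qn xi_n h, qn xi_n h'> is the limit in m of <xi_(n+m)
    h, xi_(n+m) h'>, that is <q h, q h'>. *)
Lemma coisometric_iso n : exists Y : bop U (tens us (X n)), isometric_bop Y /\
  forall x u, adj q (adj Y (tm us x u)) = T n x (adj q u).
Proof.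
have [qn [qnE _ qna]] := tens_map (X n) ss us (fun a h => esym (sq a h)) q_norm.
have lim g : (fun m => adj (tens_shift hL n m) (tens_shift hL n m g)) @ \oo --> adj qn (qn g).
  rewrite -bcompE; apply: (cvg_total (proj2 (tmP ss (X n))) (M := 1)
    (f := fun m g => adj (tens_shift hL n m) (tens_shift hL n m g))) => //.
  - by move=> m c x y; rewrite !linearP.
  - move=> m x; rewrite mul1r; apply: (le_trans _ (tens_shift_norm hL m x)).
    by rewrite -[leRHS]mul1r; apply: adj_norm => // y; rewrite mul1r tens_shift_norm.
  - move=> [x h]; rewrite bcompE /uncur /= qnE qna.
    under eq_fun do rewrite tens_shiftE tens_shift_adj.
    have [Bx hBx] := ht_bop x ss (tmP ss (X n)).
    by rewrite -hBx; under eq_fun do rewrite -hBx; apply: bop_cvg; exact: tilde_cvg.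
have qx h h' : hip (qn (xi n h)) (qn (xi n h')) = hip (q h) (q h').
  rewrite adjE; apply: clim_unique (cvg_hip (cvg_cst _) (lim (xi n h'))) _.
  rewrite (_ : (fun m => _) = (fun m => hip (xi (m + n)%N h) (xi (m + n)%N h'))).
    by rewrite qE (cvg_shiftn n (fun n => hip (xi n h) (xi n h'))).
  by apply/funext => m; rewrite -adjE (tens_shift_xi hL) addnC.
have [|Y [Yi YE]] := iso_extension (f := fun h => qn (xi n h)) qt.
  exact: qx.
exists Y; split=> // x u; apply: hip_injr => h.
have [LE _] := hL n.
by rewrite -adjE -adjE YE adjE qna -[LHS]adjEr LE.
Qed.

(** q has total range, so q^* is injective, and every identity for Z follows from the one for T
    after applying q^*. Full coisometry holds since the adjoint of the tilde operator is the
    isometry Y. *)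
Lemma coisometric_part : Defs.nondegenerate sU -> setting_normal S sU ->
  exists Z : ccc_rep X U, fully_coisometric Z /\
    forall n (x : X n) u, adj q (Z n x u) = T n x (adj q u).
Proof.
move=> nd sn; pose Y n := sval (cid (coisometric_iso n)).
have [Yi YE] : (forall n, isometric_bop (Y n)) /\
    forall n x u, adj q (adj (Y n) (tm us x u)) = T n x (adj q u).
  by split=> n; case: (svalP (cid (coisometric_iso n))).
have hV (n : nat) (x : X n) : exists V : bop U U, forall u, V u = adj (Y n) (tm us x u).
  have [B hB] := ht_bop x us (tmP us (X n)).
  by exists (bcomp (adj (Y n)) B) => u; rewrite bcompE hB.
pose V n x := sval (cid (hV n x)).
have VE n x u : V n x u = adj (Y n) (tm us x u) := svalP (cid (hV n x)) u.
have qV n x u : adj q (V n x u) = T n x (adj q u) by rewrite VE.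
have qinj u v : adj q u = adj q v -> u = v.
  move=> e; apply/eqP; rewrite -subr_eq0; apply/eqP/qt => h.
  by rewrite adjEr linearB /= e subrr hip0l.
have qs a u : adj q (sU a u) = rep0 T a (adj q u).
  by apply: (adj_intertwines ss us).
have V0 a u : V 0%N (sp_unit X a) u = sU a u.
  by apply: qinj; rewrite qV qs.
have [|||Z [ZE _]] := @make_rep R A S X U sU us V nd sn V0.
- move=> n; exists (adj (Y n)); split=> [x u|g]; first by rewrite VE.
  by rewrite -[leRHS]mul1r; apply: adj_norm => // u; rewrite mul1r isometric_norm.
- by move=> n x a u; apply: qinj; rewrite qs !qV rep_lact.
- by move=> n m x y u; apply: qinj; rewrite !qV rep_mul.
exists Z; split=> [n|n x u]; last by rewrite ZE.
exists (bid U); last by move=> h; rewrite bidE.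
exists (tens us (X n)), (@tm _ _ _ _ us (X n)), (adj (Y n)), (Y n); split.
- split; last by move=> x h; rewrite ZE VE.
  apply/hilbert_tensorP; split; last exact: (proj2 (tmP us (X n))).
  by move=> x y h k; rewrite (ht_ip (tmP us (X n))) /rep0 ZE V0.
- by move=> x y; rewrite -adjEr.
- by move=> h; rewrite bidE isometric_adj.
Qed.

End CoisometricPart.

(** * Assembling the dilation *)

Section DirectSum.
Variable R : realType.

Lemma direct_sum (G U : hilbertType R) : exists (K : hilbertType R) (i : bop G K) (j : bop U K),
  hilbert_sum i j.
Proof.
pose k (p q : G + U) : cplx R := match p, q with
  | inl g, inl g' => hip g g' | inr u, inr u' => hip u u' | _, _ => 0 end.
pose gp (p : G + U) : G := if p is inl g then g else 0.
pose up (p : G + U) : U := if p is inr u then u else 0.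
have kE p q : k p q = hip (gp p) (gp q) + hip (up p) (up q).
  by case: p q => [g|u] [g'|u'] /=; rewrite ?hip0l ?hip0r ?addr0 ?add0r.
have kpsd : psd k.
  have [sg pg] := psd_gram gp; have [su pu] := psd_gram up; split=> [p q|l].
    by rewrite !kE rmorphD /= sg su.
  have -> : kform k l l = kform (fun p q => hip (gp p) (gp q)) l l +
      kform (fun p q => hip (up p) (up q)) l l.
    rewrite /kform -big_split; apply: eq_bigr => p _; rewrite -big_split.
    by apply: eq_bigr => q _; rewrite kE mulrDr.
  by rewrite addr_ge0.
have [K [t [tE tt]]] := kernel_space kpsd.
have [||i iE] := @bopP R G K (fun g => t (inl g)) 1.
- move=> c x y; apply: hip_total (tt) _ => -[z|z]; rewrite hipDl hipZl !tE /= ?hipDl ?hipZl//.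
  by rewrite mulr0 addr0.
- by move=> x; rewrite mul1r -(@ler_pXn2r _ 2)// ?nnegrE// -!hip_norm tE.
have [||j jE] := @bopP R U K (fun u => t (inr u)) 1.
- move=> c x y; apply: hip_total (tt) _ => -[z|z]; rewrite hipDl hipZl !tE /= ?hipDl ?hipZl//.
  by rewrite mulr0 addr0.
- by move=> x; rewrite mul1r -(@ler_pXn2r _ 2)// ?nnegrE// -!hip_norm tE.
have ii : isometric_bop i by move=> x y; rewrite !iE tE.
have jj : isometric_bop j by move=> x y; rewrite !jE tE.
have ij g u : hip (i g) (j u) = 0 by rewrite iE jE tE.
exists K, i, j; split=> // v; exists (adj i v), (adj j v).
apply: hip_total (tt) _ => -[g|u]; rewrite hipDl.
  rewrite -iE ii -[hip (j _) _]hip_conj ij conjC0 addr0 -[RHS]adjEr//.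
by rewrite -jE ij jj add0r -[RHS]adjEr.
Qed.

Section SumOperators.
Variables (G U K : hilbertType R) (i : bop G K) (j : bop U K).
Hypothesis hK : hilbert_sum i j.

Lemma hilbert_sum_ip g u g' u' : hip (i g + j u) (i g' + j u') = hip g g' + hip u u'.
Proof.
have [ii jj ij _] := hK.
rewrite hipDl !hipDr ii jj ij -[hip (j u) _]hip_conj ij conjC0 add0r addr0//.
Qed.

Lemma hilbert_sum_adjl g u : adj i (i g + j u) = g.
Proof.
apply: hip_injr => x; rewrite -adjE -[i x]addr0 -(linear0 j) hilbert_sum_ip hip0l addr0//.
Qed.

Lemma hilbert_sum_adjr g u : adj j (i g + j u) = u.
Proof.
apply: hip_injr => x; rewrite -adjE -[j x]add0r -(linear0 i) hilbert_sum_ip hip0l add0r//.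
Qed.

Lemma hilbert_sum_split k : i (adj i k) + j (adj j k) = k.
Proof.
by have [_ _ _ /(_ k) [g [u ->]]] := hK; rewrite hilbert_sum_adjl hilbert_sum_adjr.
Qed.

Lemma hilbert_sum_norm k : `|k| ^+ 2 = `|adj i k| ^+ 2 + `|adj j k| ^+ 2.
Proof. by rewrite -[in LHS](hilbert_sum_split k) -!hip_norm hilbert_sum_ip. Qed.

Lemma sum_bop_ex (f : bop G G) (h : bop U U) : exists F : bop K K,
  forall k, F k = i (f (adj i k)) + j (h (adj j k)).
Proof.
exists (bcomb 1 (bcomp i (bcomp f (adj i))) (bcomp j (bcomp h (adj j)))) => k.
by rewrite bcombE scale1r !bcompE.
Qed.

End SumOperators.

Section SumNormal.
Variables (A : cstarType R) (G U K : hilbertType R) (i : bop G K) (j : bop U K).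
Hypothesis hK : hilbert_sum i j.

Lemma sum_normal S (sW : A -> bop G G) (sZ : A -> bop U U) (s : A -> bop K K) :
  star_rep sW -> star_rep sZ -> star_rep s ->
  (forall a k, s a k = i (sW a (adj i k)) + j (sZ a (adj j k))) ->
  setting_normal S sW -> setting_normal S sZ -> setting_normal S s.
Proof.
case: S => //= N wr zr ks sE wn zn.
have [M [pi [J hM]]] := vn_model_ex N.
have pis : star_rep pi by case: hM.
apply: (dominated_normal hM ks (t := fun p : G + U => match p with inl g => i g | inr u => j u end)).
  move=> v hv; rewrite -[LHS](hilbert_sum_split hK).
  have -> : adj i v = 0 by apply/hip_eq0; rewrite -adjEr; exact: (hv (inl _)).
  have -> : adj j v = 0 by apply/hip_eq0; rewrite -adjEr; exact: (hv (inr _)).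
  by rewrite !linear0 addr0.
have al := hilbert_sum_adjl hK; have ar := hilbert_sum_adjr hK.
move=> [g|u].
  have [|a|L hL] := predual_positive hM (w := fun a => hip g (sW a g)).
  - exact: wn.
  - by rewrite srep_sq// exprn_ge0.
  exists L => a; rewrite -[i g]addr0 -(linear0 j) sE al ar linear0.
  by rewrite -(@ler_pXn2r _ 2)// ?nnegrE// -hip_norm (hilbert_sum_ip hK) hip0l addr0
    hip_norm -!srep_sq// hL.
have [|a|L hL] := predual_positive hM (w := fun a => hip u (sZ a u)).
- exact: zn.
- by rewrite srep_sq// exprn_ge0.
exists L => a; rewrite -[j u]add0r -(linear0 i) sE al ar linear0.
by rewrite -(@ler_pXn2r _ 2)// ?nnegrE// -hip_norm (hilbert_sum_ip hK) hip0l add0r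
  hip_norm -!srep_sq// hL.
Qed.

End SumNormal.

Section SumRep.
Variables (A : cstarType R) (S : setting A) (X : subproduct_system S).
Variables (G U K : hilbertType R) (i : bop G K) (j : bop U K).
Hypothesis hK : hilbert_sum i j.
Variables (W : ccc_rep X G) (Z : ccc_rep X U).
Hypotheses (hW : forall n, exists L : bop (tens (rep0_rep W) (X n)) G, tilde L)
  (hZ : forall n, exists L : bop (tens (rep0_rep Z) (X n)) U, tilde L).

(** With A1 = 1 (x) i^* and A2 = 1 (x) j^*, one has A1^* A1 + A2^* A2 = 1; thus i L1 A1 + j L2 A2,
    the tilde operator of the sum, is a contraction. *)
Lemma direct_sum_rep : exists V : ccc_rep X K, forall n (x : X n) g u,
  V n x (i g + j u) = i (W n x g) + j (Z n x u).
Proof.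
have al := hilbert_sum_adjl hK; have ar := hilbert_sum_adjr hK.
pose V n x := sval (cid (sum_bop_ex i j (W n x) (Z n x))).
have VE n x k : V n x k = i (W n x (adj i k)) + j (Z n x (adj j k)).
  exact: (svalP (cid (sum_bop_ex i j (W n x) (Z n x)))).
pose sK a := V 0%N (sp_unit X a).
have sE a k : sK a k = i (rep0 W a (adj i k)) + j (rep0 Z a (adj j k)) by exact: VE.
have wr := rep0_rep W; have zr := rep0_rep Z.
have ks : star_rep sK.
  split=> [c a b k|a b k|a k k']; rewrite !sE.
  - by rewrite (srep_linl wr) (srep_linl zr) !linearP scalerDr addrACA.
  - by rewrite al ar (srepM wr) (srepM zr).
  - rewrite -[k' in LHS](hilbert_sum_split hK) -[k in RHS](hilbert_sum_split hK).
    by rewrite !(hilbert_sum_ip hK) (srep_adj wr) (srep_adj zr).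
have ai a k : adj i (sK a k) = rep0 W a (adj i k) by rewrite sE al.
have aj a k : adj j (sK a k) = rep0 Z a (adj j k) by rewrite sE ar.
have nd : Defs.nondegenerate sK.
  apply/total_closure => v hv; rewrite -[LHS](hilbert_sum_split hK).
  have /total_closure tW := rep_nondegenerate W; have /total_closure tZ := rep_nondegenerate Z.
  have hv' a k : hip v (sK a k) = 0 by apply: hv; exists a, k.
  have e1 : adj i v = 0.
    apply: tW => _ [a [g ->]]; rewrite -adjEr -[RHS](hv' a (i g)) sE; congr (hip v _).
    by rewrite -[i g]addr0 -(linear0 j) al ar !linear0 addr0.
  have e2 : adj j v = 0.
    apply: tZ => _ [a [u ->]]; rewrite -adjEr -[RHS](hv' a (j u)) sE; congr (hip v _).
    by rewrite -[j u]add0r -(linear0 i) al ar !linear0 add0r.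
  by rewrite e1 e2 !linear0 addr0.
have sn : setting_normal S sK.
  exact: (sum_normal hK wr zr ks sE (rep0_normal W) (rep0_normal Z)).
have [||||V' [V'E _]] := @make_rep R A S X K sK ks V nd sn.
- by [].
- move=> n; have [L1 [L1E L1b]] := hW n; have [L2 [L2E L2b]] := hZ n.
  have ni k : `|adj i k| <= `|k|.
    by rewrite -(@ler_pXn2r _ 2)// ?nnegrE// (hilbert_sum_norm hK k) lerDl exprn_ge0.
  have nj k : `|adj j k| <= `|k|.
    by rewrite -(@ler_pXn2r _ 2)// ?nnegrE// (hilbert_sum_norm hK k) lerDr exprn_ge0.
  have [A1 [A1E _ A1a]] := tens_map (X n) ks (rep0_rep W) ai ni.
  have [A2 [A2E _ A2a]] := tens_map (X n) ks (rep0_rep Z) aj nj.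
  have AA v : adj A1 (A1 v) + adj A2 (A2 v) = v.
    rewrite -[RHS]bidE -!bcompE -[bcomp _ _ _]scale1r -bcombE; move: v.
    apply: (bop_ht (tmP ks (X n))) => x k.
    rewrite bcombE !bcompE scale1r A1E A2E A1a A2a !adjK bidE -(linD (ht_linr (tmP ks (X n)) x)).
    by rewrite (hilbert_sum_split hK).
  exists (bcomb 1 (bcomp i (bcomp L1 A1)) (bcomp j (bcomp L2 A2))); split=> [x k|v].
    by rewrite bcombE scale1r !bcompE A1E A2E L1E L2E VE.
  rewrite bcombE scale1r !bcompE -(@ler_pXn2r _ 2)// ?nnegrE// -hip_norm (hilbert_sum_ip hK).
  rewrite !hip_norm -[leRHS]hip_norm -[X in _ <= hip _ X]AA hipDr -!adjE !hip_norm.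
  by rewrite lerD// lerXn2r ?nnegrE.
- by move=> n x a k; rewrite sE !VE al ar !rep_lact.
- by move=> n m x y k; rewrite !VE al ar !rep_mul.
by exists V' => n x g u; rewrite V'E VE al ar.
Qed.

End SumRep.

End DirectSum.

Section FockRep.
Variables (R : realType) (A : cstarType R) (S : setting A) (X : subproduct_system S).
Variables (D : hilbertType R) (sD : A -> bop D D) (ds : star_rep sD).
Hypothesis dn : setting_normal S sD.
Variables (FX : fock_space X) (G : hilbertType R) (tG : FX -> D -> G).
Hypothesis hG : htensor sD tG.
Local Notation emb := (fock_emb ds hG).

Lemma sp_mul_lact n m a (x : X n) (y : X m) : sp_mul (lact a x) y = lact a (sp_mul x y).
Proof. by rewrite /sp_mul sp_incl_lact tp_cat_lact sp_proj_lact. Qed.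

Lemma sp_mul_unit m a (y : X m) : sp_mul (sp_unit X a) y = lact a y :> X m.
Proof. by rewrite /sp_mul sp_incl0 tp_cat_unitl sp_proj_lact sp_proj_incl. Qed.

Lemma fock_bop (K : hilbertType R) (f g : bop G K) :
  (forall n (x : X n) d, f (tG (fock_in FX x) d) = g (tG (fock_in FX x) d)) -> forall v, f v = g v.
Proof.
move=> fg v; apply: hip_injr => k; rewrite !adjEr; congr (hip _ v).
apply/eqP; rewrite -subr_eq0; apply/eqP; apply: (fock_tensor_dense ds hG dn) => n x d.
by rewrite hipBl -!adjEr fg subrr.
Qed.

(** All degrees land in the same space, so the change of index disappears under [fock_in]. *)
Lemma fock_sp_mul_assoc n m k (x : X n) (y : X m) (z : X k) d :
  tG (fock_in FX (sp_mul x (sp_mul y z))) d = tG (fock_in FX (sp_mul (sp_mul x y) z)) d.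
Proof.
have e : (n + (m + k) = n + m + k)%N by rewrite addnA.
have cast i j (e' : i = j) (w : X i) : fock_in FX (index_cast (V := fun i => X i) e' w) = fock_in FX w.
  by case: _ / e'.
by rewrite -(cast _ _ e) -!(fock_embE ds hG) (sp_mul_assoc ds dn).
Qed.

Variables (lam : A -> bop G G) (ls : star_rep lam).
Hypothesis lamE : forall a x d, lam a (tG x d) = tG (lact a x) d.

(* La is the orthogonal sum over m of X(n) (x) X(m) (x) D -> X(n+m) (x) D. *)
Lemma fock_tilde n : exists La : bop (tens ls (X n)) G, (forall g, `|La g| <= `|g|) /\
  forall x m (y : X m) d, La (tm ls x (tG (fock_in FX y) d)) = tG (fock_in FX (sp_mul x y)) d.
Proof.
have Wl m a v : emb m (tlam ds (X m) a v) = lam a (emb m v).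
  rewrite -!bcompE; move: v; apply: (bop_ht (tmP ds (X m))) => x d.
  by rewrite !bcompE tlamE !fock_embE lamE fock_in_lact.
have hB m : exists B : bop (tens (tlam_rep ds (X m)) (X n)) (tens ls (X n)),
    (forall x g, B (tm _ x g) = tm ls x (emb m g)) /\
    forall x g, adj B (tm ls x g) = tm _ x (adj (emb m) g).
  have [|B [BE _ Ba]] := tens_map (X n) (tlam_rep ds (X m)) ls (Wl m).
    by move=> h; rewrite isometric_norm//; exact: fock_emb_iso.
  by exists B.
pose B m := sval (cid (hB m)).
have BE m x g : B m (tm _ x g) = tm ls x (emb m g) by case: (svalP (cid (hB m))).
have Ba m x g : adj (B m) (tm ls x g) = tm _ x (adj (emb m) g) by case: (svalP (cid (hB m))).
have Bi m : isometric_bop (B m).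
  move=> v w; rewrite adjE; congr (hip v _); rewrite -[RHS]bidE -bcompE; move: w.
  apply: (bop_ht (tmP _ (X n))) => x g.
  by rewrite bcompE BE Ba bidE (isometric_adj (fock_emb_iso hG (n := m))).
have emb0 i j g : i != j -> adj (emb i) (emb j g) = 0.
  move=> ij; apply: hip_injl => v; rewrite -adjEr hip0l.
  by apply: fock_emb_orth; rewrite eq_sym.
have Bo i j v w : i != j -> hip (B i v) (B j w) = 0.
  move=> ij; rewrite adjEr; have -> : adj (B j) (B i v) = 0; last by rewrite hip0l.
  apply: (ht_total (tmP _ (X n))) => x g.
  by rewrite -adjEr BE adjE Ba emb0// (lin0 (ht_linr (tmP _ (X n)) x)) hip0r.
have hCo m := mul_coisometry X ds dn n m.
pose Co m := sval (cid (hCo m)).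
have CoE m x (y : X m) d : Co m (tm _ x (tm ds y d)) = tm ds (sp_mul x y) d.
  by case: (svalP (cid (hCo m))).
have Cob m v : `|Co m v| <= `|v| by case: (svalP (cid (hCo m))).
pose w m := bcomp (emb (n + m)%N) (bcomp (Co m) (adj (B m))).
have wE m v : w m v = emb (n + m)%N (Co m (adj (B m) v)) by rewrite !bcompE.
have [i j x y ij|k v|La [LaE Lab]] := orth_sum_bop (w := w).
- by rewrite !wE fock_emb_orth// eqn_add2l.
- apply: le_trans (bessel Bi Bo k v); apply: ler_sum => i _.
  rewrite wE (isometric_norm _ (fock_emb_iso hG (n := _))).
  by rewrite lerXn2r ?nnegrE ?Cob.
exists La; split=> // x m y d; apply: hip_injl => k.
have wy i : w i (tm ls x (tG (fock_in FX y) d)) =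
    emb (n + i)%N (Co i (tm _ x (adj (emb i) (emb m (tm ds y d))))).
  by rewrite wE Ba fock_embE.
rewrite (orth_sum_component LaE (n := m)) => [|i im].
  by rewrite wy (isometric_adj (fock_emb_iso hG (n := m))) CoE fock_embE.
by rewrite wy emb0// (lin0 (ht_linr (tmP _ (X n)) x)) !linear0 hip0l.
Qed.

Lemma fock_rep : exists W : ccc_rep X G,
  (forall n (x : X n) m (y : X m) d, W n x (tG (fock_in FX y) d) = tG (fock_in FX (sp_mul x y)) d) /\
  forall n, exists L : bop (tens (rep0_rep W) (X n)) G, tilde L.
Proof.
pose La n := sval (cid (fock_tilde n)).
have Lab n g : `|La n g| <= `|g| by case: (svalP (cid (fock_tilde n))).
have LaE n x m (y : X m) d : La n (tm ls x (tG (fock_in FX y) d)) = tG (fock_in FX (sp_mul x y)) d.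
  by case: (svalP (cid (fock_tilde n))).
have hV n (x : X n) : exists V : bop G G, forall g, V g = La n (tm ls x g).
  have [B hB] := ht_bop x ls (tmP ls (X n)).
  by exists (bcomp (La n) B) => g; rewrite bcompE hB.
pose V n x := sval (cid (hV n x)).
have VE n x g : V n x g = La n (tm ls x g) := svalP (cid (hV n x)) g.
have VF n (x : X n) m (y : X m) d : V n x (tG (fock_in FX y) d) = tG (fock_in FX (sp_mul x y)) d.
  by rewrite VE.
have nd : Defs.nondegenerate lam.
  apply/total_closure => v hv; apply: (fock_tensor_dense ds hG dn) => n z d.
  have [J [Ji JE _]] := ht_incl (tmP ds (X n)) (tmP ds (sp_pow X n)) (@sp_incl_isom _ _ _ X n).
  rewrite -(fock_embE ds hG) adjEr -Ji JE.
  (* The inclusion of X(0+n) in X(0) (x) X(n): the elements a y have dense span in X(n), which makes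
     [lam] nondegenerate. *)
  apply: (module_dense ds (tmP ds (sp_pow X n)) dn _ (@sp_incl_tensor _ _ _ X 0 n z)).
  move=> _ [x [y ->]]; have [_ _ _ _ us] := sp_unitP X; have [a <-] := us x.
  rewrite sp_incl0 tp_cat_unitl -sp_incl_lact -JE Ji -adjEr fock_embE fock_in_lact -lamE.
  by apply: hv; exists a, (tG (fock_in FX y) d).
have sn : setting_normal S lam.
  exact: (lact_setting_normal (fock_setting FX) ds dn hG ls lamE).
have [||||W [WE Wt]] := @make_rep R A S X G lam ls V nd sn.
- move=> a; apply: fock_bop => m y d; rewrite VF lamE.
  by rewrite -fock_in_lact -[in RHS]sp_mul_unit.
- by move=> n; exists (La n); split=> [x g|g]; [rewrite VE|exact: Lab].
- move=> n x a g; rewrite -bcompE; move: g; apply: fock_bop => m y d.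
  by rewrite bcompE !VF lamE -fock_in_lact sp_mul_lact.
- move=> n m x y g; rewrite -bcompE; move: g; apply: fock_bop => k z d.
  by rewrite bcompE !VF fock_sp_mul_assoc.
exists W; split=> // n x m y d; by rewrite WE VF.
Qed.

End FockRep.

Lemma tilde_adj_unique (R : realType) (A : cstarType R) (S : setting A) (X : subproduct_system S)
    (H : hilbertType R) (T : ccc_rep X H) n (L : bop (tens (rep0_rep T) (X n)) H) (Q : bop H H) :
  tilde L -> is_tilde_tilde_adj T n Q -> forall h, Q h = L (adj L h).
Proof.
move=> [LE _] [G' [t [L' [L'' [hL' ha QE]]]]] h.
have [L0 [J [L0E _ LJ JJ]]] := tilde_transport hL'.
have L0L g : L0 g = L g by move: g; apply: (bop_ht (tmP (rep0_rep T) (X n))) => x k; rewrite LE.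
rewrite QE -(JJ (L'' h)) -LJ L0L; congr (L _); apply: hip_injr => g.
by rewrite -adjE -ha -LJ L0L adjE.
Qed.

(** Contractivity is read off the adjoint: L' L'' = 1 makes L'' isometric. *)
Lemma coisometric_tilde (R : realType) (A : cstarType R) (S : setting A) (X : subproduct_system S)
    (U : hilbertType R) (Z : ccc_rep X U) : fully_coisometric Z ->
  forall n, exists L : bop (tens (rep0_rep Z) (X n)) U, tilde L.
Proof.
move=> fc n; have [Q [G' [t [L' [L'' [hL' ha QE]]]]] Q1] := fc n.
have [L [J [LE Ji LJ _]]] := tilde_transport hL'; exists L; split=> // g.
rewrite LJ -[leRHS](isometric_norm _ Ji) -[leRHS]mul1r; move: (J g) => v.
have -> : L' v = adj L'' v.
  by apply: hip_injr => h; rewrite -adjE -hip_conj ha hip_conj.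
apply: adj_norm => // u; rewrite mul1r -(@ler_pXn2r _ 2)// ?nnegrE// -!hip_norm.
by rewrite -ha -QE Q1.
Qed.

(** Paired with a tensor of z, the adjoint of f moves to z. What remains are functionals x |-> <v, x
    (x) d>, which vanish everywhere once they vanish on the summands X(n). *)
Lemma shift_induced (R : realType) (A : cstarType R) (S : setting A) (X : subproduct_system S)
    (D : hilbertType R) (sD : A -> bop D D) (ds : star_rep sD) (dn : setting_normal S sD)
    (FX : fock_space X) (G : hilbertType R) (tG : FX -> D -> G) (hG : htensor sD tG)
    (f : FX -> FX) (L : bop G G) : adjointable f ->
  (forall n (x : X n) d, L (tG (fock_in FX x) d) = tG (f (fock_in FX x)) d) ->
  is_induced tG f L.
Proof.
move=> [f' ff'] Lf x d; apply: hip_injr => v; apply/eqP; rewrite -subr_eq0; apply/eqP.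
rewrite -hipBr; apply/eqP; set w := _ - _.
suff -> : w = 0 by rewrite hip0r.
apply: (ht_total hG) => z e; rewrite -[LHS]hip_conj; apply/eqP; rewrite conjC_eq0; apply/eqP.
have fip y : hip (tG z e) (tG (f y) d) = hip (tG (f' z) e) (tG y d).
  by rewrite !(ht_ip hG) -mip_star ff' mip_star.
rewrite hipBr fip adjEr -hipBl.
apply: (module_dense ds hG (S := S) (B := [set w | exists n (x : X n), w = fock_in FX x])) => //.
  by move=> _ [n [y ->]]; rewrite hipBl -adjEr Lf -fip subrr.
by rewrite (fock_total FX).
Qed.

Unset Implicit Arguments.

Theorem theorem2p22 (R : realType) (A : cstarType R) (S : setting A)
    (X : subproduct_system S) (H : hilbertType R) (T : ccc_rep X H)
    (* Delta_*(T), the space D with the restriction of sigma to it *)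
    (Delta : bop H H) (hDelta : is_defect T Delta)
    (D : hilbertType R) (iD : bop D H) (hiD : isometric_bop iD)
    (hD : range iD = closure (range Delta))
    (sD : A -> bop D D) (hsD : forall a d, iD (sD a d) = rep0 T a (iD d))
    (* the X-Fock space, the X-shift, and G = F_X (x)_sigma D *)
    (FX : fock_space X) (Sh : forall n, X n -> FX -> FX) (hSh : is_shift Sh)
    (G : hilbertType R) (tG : FX -> D -> G) (hG : hilbert_tensor sD tG) :
  exists (K : hilbertType R) (W : bop H K) (V : ccc_rep X K),
    dilation W T V /\
    exists (U : hilbertType R) (jG : bop G K) (jU : bop U K),
      hilbert_sum jG jU /\
      (exists Z : ccc_rep X U,
         fully_coisometric Z /\
         forall n (zeta : X n), exists2 L : bop G G,
           is_induced tG (Sh n zeta) L &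
           forall g u, V n zeta (jG g + jU u) = jG (L g) + jU (Z n zeta u)) /\
      ((forall u : U, u = 0) <-> pure T).
Proof.
have ss := rep0_rep T.
have iinj x y : iD x = iD y -> x = y.
  by move=> e; rewrite -(isometric_adj hiD x) e (isometric_adj hiD).
have ds : star_rep sD.
  split=> [c a b d|a b d|a d d'].
  - by apply: iinj; rewrite hsD linearP !hsD (srep_linl ss).
  - by apply: iinj; rewrite !hsD (srepM ss).
  - by rewrite -hiD hsD (srep_adj ss) -hsD hiD.
have dn : setting_normal S sD.
  apply: (setting_normal_compression (j := iD) _ (rep0_normal T)) => a h k.
  by rewrite -hsD hiD.
move/hilbert_tensorP: hG => hG'.
pose L n := sval (cid (tilde_ex hDelta n)).
have hL n : tilde (L n) := svalP (cid (tilde_ex hDelta n)).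
have [Q hQ [Dp DD]] := hDelta.
have QL h : Q h = L 1%N (adj (L 1%N) h) by exact: tilde_adj_unique.
(* Delta as a map into D; [iB] holds because the range of Delta lies in that of [iD]. *)
pose B := bcomp (adj iD) Delta.
have iB h : iD (B h) = Delta h.
  have : closure (range Delta) (Delta h) by apply: subset_closure; exists h.
  by rewrite -hD bcompE => -[d _ <-]; rewrite (isometric_adj hiD).
have B_ip h h' : hip (B h) (B h') = hip h h' - hip (adj (L 1%N) h) (adj (L 1%N) h').
  by rewrite -hiD !iB (positive_sym Dp) DD hipBr QL adjEr.
have Dc a h : Delta (rep0 T a h) = rep0 T a (Delta h).
  symmetry; apply: positive_commute => // k; rewrite !DD linearB /= !QL.
  by rewrite (xi_lact hL) (tilde_lact (proj1 (hL 1%N))).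
have Bs a h : B (rep0 T a h) = sD a (B h).
  by apply: iinj; rewrite hsD !iB.
have [Ka [Klim Kadj]] := poisson_ex hL ds Bs B_ip hG'.
have [U [q [qE qt [j [ji jq]]]]] := coisometric_space hL Klim.
have [sU [us sq und un]] := coisometric_sigma qt ji jq.
have [Z [Zfc qZ]] := coisometric_part hL Klim qE qt us sq und un.
have [lam [ls lamE]] := ht_lact ds hG'.
have [W [WF Wt]] := fock_rep ds dn hG' ls lamE.
have [K [iG [iU hK]]] := direct_sum G U.
have [V VE] := direct_sum_rep hK Wt (coisometric_tilde Zfc).
pose I := bcomb 1 (bcomp iG Ka) (bcomp iU q).
have IE h : I h = iG (Ka h) + iU (q h) by rewrite bcombE scale1r !bcompE.
(* Both sides are compared on tensors of y in X(m) with d, where they are T(x y) B^* d and T(x) T(y)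
   B^* d. *)
have KW n (x : X n) g : adj Ka (W n x g) = T n x (adj Ka g).
  rewrite -!bcompE; move: g; apply: (fock_bop ds dn hG') => m y d.
  by rewrite !bcompE WF !Kadj rep_mul.
have Qlim := tilde_cvg hL Klim qE.
exists K, I, V; split.
  split=> [h h'|n x]; first by rewrite !IE (hilbert_sum_ip hK) qE addrC subrK.
  exists (adj (V n x)), (adj (T n x)); split; [exact: adjP|exact: adjP|move=> h].
  apply: hip_injr => k; rewrite -adjE -(hilbert_sum_split hK k) VE !IE !(hilbert_sum_ip hK).
  by rewrite !(adjEr Ka) !(adjEr q) KW qZ !(adjE (T n x)).
exists U, iG, iU; split=> //; split.
  exists Z; split=> // n x; exists (W n x); last exact: VE.
  have [Sa SE] := hSh n x.
  by apply: (shift_induced ds dn hG' Sa) => m y d; rewrite WF SE.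
(* T~_n T~_n^* tends strongly to q^*q, so purity means q^*q = 0, that is q = 0; as q is total this
   says U = 0. *)
split=> [U0|[P hP P0] u].
  exists (fun n => bcomp (L n) (adj (L n))) => [n|h]; last first.
    have := Qlim h; rewrite (U0 (q h)) linear0.
    by under eq_fun do rewrite -bcompE.
  exists (tens (rep0_rep T) (X n)), (@tm _ _ _ _ (rep0_rep T) (X n)), (L n), (adj (L n)); split.
  - by split; [apply/hilbert_tensorP; exact: tmP|case: (hL n)].
  - exact: adjP.
  - by move=> h; rewrite bcompE.
apply: qt => h; suff -> : q h = 0 by rewrite hip0r.
apply: hip_eq0; rewrite adjEr; have -> : adj q (q h) = 0; last by rewrite hip0l.
apply: lim_unique (Qlim h) _; have := P0 h.
by under eq_fun do rewrite (tilde_adj_unique (hL _) (hP _)).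
Qed.
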